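(* Let $f(z)=z+a_2z^2+a_3z^3+\cdots\in\mathcal{C}_{\arcsin}$ and let $\Gamma_1,\Gamma_2,\Gamma_3$ be the first three inverse logarithmic coefficients of $f$. Then $$|\Gamma_1|\le \frac{1}{2\pi},\qquad |\Gamma_2|\le \frac{1}{6\pi},\qquad |\Gamma_3|\le \frac{1}{12\pi}.$$ The estimates are sharp, i.e. for each of them there is a function in $\mathcal{C}_{\arcsin}$ for which equality holds.
   Context: Let $\Omega=\{z\in\mathbb{C}:|z|<1\}$. Let $\mathcal{A}$ be the family of analytic functions $f$ in $\Omega$ normalized by $f(z)=z+\sum_{n=2}^{\infty}a_nz^n$, and let $\mathcal{S}\subset\mathcal{A}$ be the subclass of univalent functions. A Schwarz function is an analytic $\omega:\Omega\to\mathbb{C}$ with $\omega(0)=0$ and $|\omega(z)|\le 1$ on $\Omega$. For analytic $g,h$ in $\Omega$, $g\prec h$ (subordination) means that there is a Schwarz function $\omega$ with $g(z)=h(\omega(z))$ for all $z\in\Omega$. With $\arcsin$ the principal branch ($\arcsin 0=0$), define $$\mathcal{C}_{\arcsin}=\left\{f\in\mathcal{S}:\ 1+\frac{zf''(z)}{f'(z)}\prec 1+\frac{2}{\pi}\arcsin z \text{ in } \Omega\right\}.$$ The inverse logarithmic coefficients $\Gamma_n$ of $f\in\mathcal{S}$ are defined, near the origin, by $\log\left(\frac{f^{-1}(z)}{z}\right)=2\sum_{n=1}^{\infty}\Gamma_nz^n$ with $\log 1=0$. Thus $\Gamma_1=-\frac12a_2$, $\Gamma_2=-\frac12\left(a_3-\frac32a_2^2\right)$,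 $\Gamma_3=-\frac12\left(a_4-4a_2a_3+\frac{10}{3}a_2^3\right)$. *)

(* Defs.v *)
(* Stdlib real numbers with Coquelicot's complex numbers [C]. *)
From Stdlib Require Import Reals.
From Coquelicot Require Import Coquelicot.

Open Scope R_scope.

Definition Omega (z : C) : Prop := Cmod z < 1.

(* Functions on Omega are represented by total functions on [C]; only their
   values on Omega matter, since Omega is open. *)
Definition analytic_on_Omega (f : C -> C) : Prop :=
  forall z : C, Omega z -> @ex_derive C_AbsRing C_NormedModule f z.

Definition classA (f : C -> C) : Prop :=
  analytic_on_Omega f /\
  exists a : nat -> C,
    a 0%nat = RtoC 0 /\ a 1%nat = RtoC 1 /\
    forall z : C, Omega z -> @is_pseries C_AbsRing C_NormedModule a z (f z).

Definition univalent_on_Omega (f : C -> C) : Prop :=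
  forall z1 z2 : C, Omega z1 -> Omega z2 -> f z1 = f z2 -> z1 = z2.

Definition classS (f : C -> C) : Prop := classA f /\ univalent_on_Omega f.

Definition schwarz (w : C -> C) : Prop :=
  analytic_on_Omega w /\ w (RtoC 0) = RtoC 0 /\
  forall z : C, Omega z -> Cmod (w z) <= 1.

Definition subordinate (g h : C -> C) : Prop :=
  exists w : C -> C, schwarz w /\ forall z : C, Omega z -> g z = h (w z).

(* Principal argument, with values in (-PI, PI] for z <> 0. *)
Definition Carg (z : C) : R :=
  if Rle_dec 0 (Im z) then acos (Re z / Cmod z) else - acos (Re z / Cmod z).

Definition Clog (z : C) : C := (ln (Cmod z), Carg z).

Definition Csqrt (z : C) : C :=
  (RtoC (sqrt (Cmod z)) * (cos (Carg z / 2), sin (Carg z / 2)))%C.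

(* Principal branch: arcsin z = -i Log (i z + sqrt (1 - z^2)). *)
Definition Carcsin (z : C) : C :=
  (- Ci * Clog (Ci * z + Csqrt (RtoC 1 - z * z)))%C.

(* A univalent analytic f has f' <> 0 on Omega, so the total division below
   never divides by zero for f in S. *)
Definition C_arcsin (f : C -> C) : Prop :=
  classS f /\
  subordinate
    (fun z => RtoC 1 + z * C_derive (C_derive f) z / C_derive f z)%C
    (fun z => RtoC 1 + RtoC (2 / PI) * Carcsin z)%C.

(* For univalent f, the function g below is f^{-1} on the disc of radius r,
   so Gamma is uniquely determined by f.  The sum starts at n = 1, whence
   Gamma 0 = 0; w = 0 is left out because g w / w has a removable singularity
   there.  Since g w / w tends to 1, the branch of log with log 1 = 0 is the
   principal one near the origin. *)
Definition inv_log_coeffs (f : C -> C) (Gamma : nat -> C) : Prop :=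
  Gamma 0%nat = RtoC 0 /\
  exists (g : C -> C) (r : R),
    0 < r /\
    (forall w : C, Cmod w < r -> Omega (g w) /\ f (g w) = w) /\
    (forall w : C, 0 < Cmod w < r ->
       @is_pseries C_AbsRing C_NormedModule
         (fun n => (RtoC 2 * Gamma n)%C) w (Clog (g w / w)%C)).

(* Main.v *)
Require Import Defs.
From Stdlib Require Import Reals Lra Lia Psatz ClassicalEpsilon.
From Coquelicot Require Import Coquelicot.
Open Scope R_scope.

(** If [1 + z f''/f' = 1 + (2/pi) arcsin w], then [f'] cannot vanish in the unit disc, because a zero would force [z f''/f'] to be unbounded along a ray; hence [w = sin ((pi/2) z f''/f')] is holomorphic.  With [w = c1 z + c2 z^2 + c3 z^3 + ...] and [k = 2/pi], comparing coefficients gives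
    [Gamma_1 = - k/4 c1], [Gamma_2 = - k/12 (c2 - 5/4 k c1^2)] and
    [Gamma_3 = - k/24 (c3 - 5/2 k c1 c2 + (1/6 + 3/2 k^2) c1^3)].
    Since [|w| <= 1], the lower triangular Toeplitz matrix of [c1, c2, c3] is a contraction, and this yields [|c3 - m c1 c2 + n c1^3| <= 1] whenever [m^2 <= 4 n <= 4].
    Equality holds for [w = z], [z^2], [z^3]; there [f' = exp ((k/n) L (z^n))], where [L] is the primitive of [arcsin z / z], has positive real part, so [f] is univalent.
    Holomorphic functions here are twice complex differentiable, and the Cauchy formula is obtained by differentiating an integral over a contracting circle. *)

(** * Complex differentiation *)

(** [schwarz] grants one complex derivative, which yields neither a continuous derivative nor a
    power series at once; the series of [w] is therefore drawn from that of [f], which [classA]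
    supplies. Since |w| <= 1 admits boundary values, boundedness of [Carcsin] is proved on the
    closed disc, and sin (arcsin w) = w for every complex number. Only coefficients up to the third
    matter, so expansions with an O(z^4) remainder ([jet]) replace the manipulation of composed
    series. For the third coefficient, a Schur complement of the Toeplitz matrix gives |d c3 +
    conj(c1) c2^2| <= d^2 - |c2|^2 with d = 1 - |c1|^2, and m^2 <= 4 n <= 4 lets a completed square
    absorb the rest. With m = 5k/2 and n = 1/6 + 3k^2/2 this asks for k^2 <= 8/3 and k^2 <= 5/9,
    which holds because pi > 3. Sharpness also has an existence side: [Gamma] is a datum of the
    statement, so for the extremal functions a local inverse g and the logarithm of g w / w have to
    be constructed. *)

Definition tends {T} (F : (T -> Prop) -> Prop) (f : T -> C) (l : C) : Prop :=
  forall eps, 0 < eps -> F (fun x => Cmod (f x - l) < eps).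

Definition near (z : C) (P : C -> Prop) : Prop :=
  exists del, 0 < del /\ forall y, Cmod (y - z) < del -> P y.

Global Instance near_filter z : Filter (near z).
Proof.
constructor.
- exists 1; split; [lra | easy].
- intros P Q [d [Hd HP]] [e [He HQ]]. exists (Rmin d e). split.
  + now apply Rmin_glb_lt.
  + intros y Hy; split; [apply HP | apply HQ]; eapply Rlt_le_trans; try exact Hy.
    apply Rmin_l. apply Rmin_r.
- intros P Q HPQ [d [Hd HP]]. exists d; split; auto.
Qed.

Definition cont (f : C -> C) (z : C) : Prop := tends (near z) f (f z).

Lemma Cmod_sub_sym (a b : C) : Cmod (a - b) = Cmod (b - a).
Proof. replace (a - b)%C with (- (b - a))%C by ring. apply Cmod_opp. Qed.

Lemma Cmod_tri_sub (a b : C) : Cmod (a - b) <= Cmod a + Cmod b.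
Proof. rewrite <- (Cmod_opp b). apply Cmod_triangle. Qed.

Lemma Cmod_tri_inv (a b : C) : Cmod a - Cmod b <= Cmod (a - b).
Proof.
replace a with ((a - b) + b)%C at 1 by ring.
generalize (Cmod_triangle (a - b) b); lra.
Qed.

Lemma tends_ext {T} (F : (T -> Prop) -> Prop) {FF : Filter F} f g l :
  F (fun x => f x = g x) -> tends F f l -> tends F g l.
Proof.
intros E H eps He. generalize (filter_and _ _ E (H eps He)).
apply filter_imp. intros x [Hx Hy]. now rewrite <- Hx.
Qed.

Lemma tends_const {T} (F : (T -> Prop) -> Prop) {FF : Filter F} c :
  tends F (fun _ => c) c.
Proof.
intros eps He. apply filter_forall. intros _.
replace (c - c)%C with (RtoC 0) by ring. now rewrite Cmod_0.
Qed.

Lemma tends_plus {T} (F : (T -> Prop) -> Prop) {FF : Filter F} f g l m :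
  tends F f l -> tends F g m -> tends F (fun x => f x + g x)%C (l + m)%C.
Proof.
intros Hf Hg eps He.
assert (He2 : 0 < eps / 2) by lra.
generalize (filter_and _ _ (Hf _ He2) (Hg _ He2)).
apply filter_imp. intros x [H1 H2].
replace (f x + g x - (l + m))%C with ((f x - l) + (g x - m))%C by ring.
generalize (Cmod_triangle (f x - l) (g x - m)); lra.
Qed.

Lemma tends_mult {T} (F : (T -> Prop) -> Prop) {FF : Filter F} f g l m :
  tends F f l -> tends F g m -> tends F (fun x => f x * g x)%C (l * m)%C.
Proof.
intros Hf Hg eps He.
set (K := 1 + Cmod l + Cmod m).
assert (HK : 0 < K) by (unfold K; generalize (Cmod_ge_0 l) (Cmod_ge_0 m); lra).
set (e := Rmin 1 (eps / (2 * K))).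
assert (He2 : 0 < e).
{ apply Rmin_glb_lt; [lra |]. apply Rdiv_lt_0_compat; lra. }
assert (e1 : e <= 1) by apply Rmin_l.
assert (e2 : e * K <= eps / 2).
{ apply Rle_trans with (eps / (2 * K) * K).
  - apply Rmult_le_compat_r; [lra | apply Rmin_r].
  - right; field; lra. }
generalize (filter_and _ _ (Hf _ He2) (Hg _ He2)).
apply filter_imp. intros x [H1 H2].
replace (f x * g x - l * m)%C
  with ((f x - l) * (g x - m) + ((f x - l) * m + l * (g x - m)))%C by ring.
eapply Rle_lt_trans; [apply Cmod_triangle |].
eapply Rle_lt_trans; [apply Rplus_le_compat_l, Cmod_triangle |].
rewrite !Cmod_mult. unfold K in e2.
generalize (Cmod_ge_0 l) (Cmod_ge_0 m) (Cmod_ge_0 (f x - l)) (Cmod_ge_0 (g x - m)).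
intros. nra.
Qed.

Lemma tends_opp {T} (F : (T -> Prop) -> Prop) {FF : Filter F} f l :
  tends F f l -> tends F (fun x => - f x)%C (- l)%C.
Proof.
intros Hf eps He. generalize (Hf eps He). apply filter_imp. intros x Hx.
replace (- f x - - l)%C with (- (f x - l))%C by ring. now rewrite Cmod_opp.
Qed.

Lemma tends_comp {T} (F : (T -> Prop) -> Prop) {FF : Filter F} f l (g : C -> C) :
  tends F f l -> cont g l -> tends F (fun x => g (f x)) (g l).
Proof.
intros Hf Hg eps He. destruct (Hg eps He) as [d [Hd H]].
generalize (Hf d Hd). apply filter_imp. intros x Hx. now apply H.
Qed.

Lemma tends_le {T} (F : (T -> Prop) -> Prop) {FF : ProperFilter F} f l (M : R) :
  tends F f l -> F (fun x => Cmod (f x) <= M) -> Cmod l <= M.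
Proof.
intros Hf HM. apply Rnot_lt_le. intros Hlt.
assert (He : 0 < Cmod l - M) by lra.
destruct (filter_ex _ (filter_and _ _ HM (Hf _ He))) as [x [H1 H2]].
rewrite Cmod_sub_sym in H2. generalize (Cmod_tri_inv l (f x)); lra.
Qed.

Lemma tends_unique {T} (F : (T -> Prop) -> Prop) {FF : ProperFilter F} f l m :
  tends F f l -> tends F f m -> l = m.
Proof.
intros Hl Hm.
assert (H : Cmod (l - m) <= 0).
{ apply (tends_le F (fun x => f x + - f x)%C).
  - apply tends_plus; [apply _ | exact Hl |]. now apply tends_opp; [apply _ |].
  - apply filter_forall. intros x.
    replace (f x + - f x)%C with (RtoC 0) by ring. rewrite Cmod_0; lra. }
assert (E : (l - m)%C = RtoC 0).
{ apply Cmod_eq_0. generalize (Cmod_ge_0 (l - m)); lra. }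
replace l with (l - m + m)%C by ring. rewrite E; ring.
Qed.

Lemma cont_id z : cont (fun y => y) z.
Proof. intros eps He; exists eps; auto. Qed.

Lemma cont_inv (z : C) : z <> 0%C -> cont Cinv z.
Proof.
intros Hz eps He.
assert (Hm : 0 < Cmod z) by (apply Cmod_gt_0; exact Hz).
set (m := Cmod z) in *.
exists (Rmin (m / 2) (eps * m * m / 2)). split.
{ apply Rmin_glb_lt; [lra |]. apply Rdiv_lt_0_compat; [|lra].
  repeat apply Rmult_lt_0_compat; lra. }
intros y Hy.
assert (H1 : Cmod (y - z) < m / 2) by (eapply Rlt_le_trans; [exact Hy | apply Rmin_l]).
assert (H2 : Cmod (y - z) < eps * m * m / 2) by (eapply Rlt_le_trans; [exact Hy | apply Rmin_r]).
assert (Hy2 : m / 2 < Cmod y).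
{ rewrite Cmod_sub_sym in H1. generalize (Cmod_tri_inv z y). fold m; lra. }
assert (Hy0 : y <> 0%C) by (apply Cmod_gt_0; lra).
replace (/ y - / z)%C with ((z - y) / (y * z))%C by (field; auto).
rewrite Cmod_div by (now apply Cmult_neq_0).
rewrite Cmod_mult, Cmod_sub_sym. fold m.
apply Rmult_lt_reg_r with (Cmod y * m); [nra|].
unfold Rdiv. rewrite Rmult_assoc, Rinv_l by (apply Rgt_not_eq; nra).
assert (0 < eps * m) by nra. nra.
Qed.

(** Carathéodory's form of the derivative: a slope function that is continuous at [z]. The product,
    chain and inverse rules become algebra on slopes followed by a limit. *)
Definition Cder (f : C -> C) (z l : C) : Prop :=
  exists phi, (forall y, f y = f z + (y - z) * phi y)%C /\ phi z = l /\ cont phi z.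

Lemma Cder_eps f z l :
  Cder f z l <-> forall eps, 0 < eps -> near z (fun y =>
    Cmod (f y - f z - (y - z) * l) <= eps * Cmod (y - z)).
Proof.
split.
- intros [phi [H1 [H2 H3]]] eps He. generalize (H3 eps He).
  apply filter_imp. intros y Hy. rewrite (H1 y).
  replace (f z + (y - z) * phi y - f z - (y - z) * l)%C
    with ((phi y - phi z) * (y - z))%C by (rewrite H2; ring).
  rewrite Cmod_mult. apply Rmult_le_compat_r; [apply Cmod_ge_0 | lra].
- intros H.
  exists (fun y => if Ceq_dec y z then l else ((f y - f z) / (y - z))%C).
  split; [| split].
  + intros y. destruct (Ceq_dec y z) as [-> | n]; [ring |].
    field. intros E; apply n. replace y with (y - z + z)%C by ring. rewrite E; ring.
  + destruct (Ceq_dec z z); congruence.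
  + intros eps He. assert (He2 : 0 < eps / 2) by lra.
    generalize (H _ He2). apply filter_imp. intros y Hy.
    destruct (Ceq_dec z z) as [_|]; [| congruence].
    destruct (Ceq_dec y z) as [-> | n].
    * replace (l - l)%C with (RtoC 0) by ring. rewrite Cmod_0; lra.
    * assert (n' : (y - z)%C <> 0%C).
      { intros E; apply n. replace y with (y - z + z)%C by ring. rewrite E; ring. }
      assert (P : 0 < Cmod (y - z)) by (apply Cmod_gt_0; exact n').
      replace ((f y - f z) / (y - z) - l)%C
        with ((f y - f z - (y - z) * l) / (y - z))%C by (field; auto).
      rewrite Cmod_div by auto.
      apply Rle_lt_trans with (eps / 2); [| lra].
      apply Rmult_le_reg_r with (Cmod (y - z)); auto.
      unfold Rdiv at 1. rewrite Rmult_assoc, Rinv_l by lra. lra.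
Qed.

Lemma Cder_cont f z l : Cder f z l -> cont f z.
Proof.
intros [phi [H1 [H2 H3]]].
apply tends_ext with (fun y => f z + (y - z) * phi y)%C; [apply _ | |].
- apply filter_forall. intros y; now rewrite <- H1.
- assert (T : tends (near z) (fun y => f z + (y - z) * phi y)%C (f z + (z - z) * phi z)%C).
  { apply tends_plus; [apply _ | apply tends_const, _ |].
    apply tends_mult; [apply _ | | exact H3].
    apply tends_plus; [apply _ | apply cont_id | apply tends_const, _]. }
  replace (f z + (z - z) * phi z)%C with (f z) in T by ring. exact T.
Qed.

(** The slope function in [Cder] must serve every [y], so locality is not visible from the
    definition and passes through the epsilon form. *)
Lemma Cder_ext f g z l : near z (fun y => f y = g y) -> Cder f z l -> Cder g z l.
Proof.
intros E H. apply Cder_eps. intros eps He. rewrite Cder_eps in H.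
assert (Ez : f z = g z).
{ destruct E as [d [Hd E]]. apply E. replace (z - z)%C with (RtoC 0) by ring.
  now rewrite Cmod_0. }
generalize (filter_and _ _ E (H eps He)). apply filter_imp.
intros y [H1 H2]. now rewrite <- H1, <- Ez.
Qed.

Lemma Cder_unique f z l m : Cder f z l -> Cder f z m -> l = m.
Proof.
intros Hl Hm. rewrite Cder_eps in Hl, Hm.
destruct (Ceq_dec (l - m) 0) as [E | n].
- replace l with (l - m + m)%C by ring. rewrite E; ring.
- exfalso. apply Cmod_gt_0 in n.
  assert (He : 0 < Cmod (l - m) / 3) by lra.
  destruct (filter_and _ _ (Hl _ He) (Hm _ He)) as [d [Hd H]].
  set (y := (z + RtoC (d / 2))%C).
  assert (Hy : (y - z)%C = RtoC (d / 2)) by (unfold y; ring).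
  assert (Hy2 : Cmod (y - z) = d / 2) by (rewrite Hy, Cmod_R; apply Rabs_pos_eq; lra).
  destruct (H y) as [H1 H2]; [rewrite Hy2; lra |].
  generalize (Cmod_tri_sub (f y - f z - (y - z) * m) (f y - f z - (y - z) * l)).
  replace (f y - f z - (y - z) * m - (f y - f z - (y - z) * l))%C
    with ((y - z) * (l - m))%C by ring.
  rewrite Cmod_mult, Hy2 in *. nra.
Qed.

Lemma Cder_eq f z l m : Cder f z l -> l = m -> Cder f z m.
Proof. now intros H <-. Qed.

Lemma Cder_const c z : Cder (fun _ => c) z 0.
Proof.
exists (fun _ => 0%C). split; [intros; ring | split; [easy |]]. apply tends_const, _.
Qed.

Lemma Cder_id z : Cder (fun y => y) z 1.
Proof.
exists (fun _ => 1%C). split; [intros; ring | split; [easy |]]. apply tends_const, _.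
Qed.

Lemma Cder_plus f g z l m : Cder f z l -> Cder g z m -> Cder (fun y => f y + g y)%C z (l + m)%C.
Proof.
intros [p [P1 [P2 P3]]] [q [Q1 [Q2 Q3]]].
exists (fun y => p y + q y)%C. split; [| split].
- intros y. rewrite (P1 y), (Q1 y). ring.
- now rewrite P2, Q2.
- now apply tends_plus; [apply _ | |].
Qed.

Lemma Cder_mult f g z l m : Cder f z l -> Cder g z m ->
  Cder (fun y => f y * g y)%C z (l * g z + f z * m)%C.
Proof.
intros Hf Hg. assert (Cg := Cder_cont _ _ _ Hg). revert Hf Hg.
intros [p [P1 [P2 P3]]] [q [Q1 [Q2 Q3]]].
exists (fun y => p y * g y + f z * q y)%C. split; [| split].
- intros y. rewrite (P1 y), (Q1 y). ring.
- now rewrite P2, Q2.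
- apply tends_plus; [apply _ | |]; apply tends_mult; try apply _; auto.
  apply tends_const, _.
Qed.

Lemma Cder_comp f g z l m : Cder f z l -> Cder g (f z) m -> Cder (fun y => g (f y)) z (m * l)%C.
Proof.
intros Hf Hg. assert (Cf := Cder_cont _ _ _ Hf). revert Hf Hg.
intros [p [P1 [P2 P3]]] [q [Q1 [Q2 Q3]]].
exists (fun y => q (f y) * p y)%C. split; [| split].
- intros y. rewrite (Q1 (f y)). rewrite (P1 y) at 1. ring.
- now rewrite P2, Q2.
- apply tends_mult; [apply _ | | exact P3]. now apply (tends_comp (near z) f (f z) q).
Qed.

Lemma Csub_0 (a b : C) : (a - b)%C = 0%C -> a = b.
Proof. intros E. replace a with (a - b + b)%C by ring. rewrite E; ring. Qed.

Lemma Cder_inv (z : C) : z <> 0%C -> Cder Cinv z (- / (z * z))%C.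
Proof.
intros Hz.
(* The slope formula -1/(yz) breaks down at [y = 0], where [/ y] is only a convention; there the
   function is replaced by its tangent line at [z]. *)
apply Cder_ext with (fun y => if Ceq_dec y 0 then (/ z - (y - z) / (z * z))%C else (/ y)%C).
{ exists (Cmod z). split; [apply Cmod_gt_0; exact Hz |]. intros y Hy.
  destruct (Ceq_dec y 0) as [-> | n]; [| easy].
  exfalso. replace (0 - z)%C with (- z)%C in Hy by ring. rewrite Cmod_opp in Hy; lra. }
exists (fun y => if Ceq_dec y 0 then - / (z * z) else - / (y * z))%C. split; [| split].
- intros y. destruct (Ceq_dec z 0); [easy |].
  destruct (Ceq_dec y 0) as [-> | n']; field; auto.
- destruct (Ceq_dec z 0); easy.
- apply (tends_ext (near z) (fun y => - (/ y * / z))%C).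
  + exists (Cmod z). split; [apply Cmod_gt_0; exact Hz |]. intros y Hy.
    destruct (Ceq_dec y 0) as [-> | n].
    * exfalso. replace (0 - z)%C with (- z)%C in Hy by ring. rewrite Cmod_opp in Hy; lra.
    * field; auto.
  + destruct (Ceq_dec z 0); [easy |].
    replace (- / (z * z))%C with (- (/ z * / z))%C by (field; auto).
    apply tends_opp; [apply _ |]. apply tends_mult; [apply _ | |].
    now apply cont_inv. apply tends_const, _.
Qed.

Lemma tends_nonzero {T} (F : (T -> Prop) -> Prop) {FF : Filter F} (f : T -> C) (l : C) :
  tends F f l -> l <> 0%C -> F (fun x => f x <> 0%C).
Proof.
intros Hf Hl. apply Cmod_gt_0 in Hl. generalize (Hf _ Hl).
apply filter_imp. intros x Hx E. rewrite E in Hx.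
replace (0 - l)%C with (- l)%C in Hx by ring. rewrite Cmod_opp in Hx; lra.
Qed.

(** The slope of [g] is the reciprocal of the slope of [f] taken at [g y], and continuity of [g]
    carries it to [/ l]. Serves the logarithm, the square root and the local inverse of [f]. *)
Lemma Cder_inverse f g (w l : C) :
  cont g w -> near w (fun y => f (g y) = y) -> Cder f (g w) l -> l <> 0%C ->
  Cder g w (/ l)%C.
Proof.
intros Cg E [p [P1 [P2 P3]]] Hl.
assert (Ew : f (g w) = w).
{ destruct E as [d [Hd E]]. apply E. replace (w - w)%C with (RtoC 0) by ring.
  now rewrite Cmod_0. }
assert (Tp : tends (near w) (fun y => p (g y)) l).
{ rewrite <- P2. now apply tends_comp; [apply _ | |]. }
assert (N : near w (fun y => p (g y) <> 0%C)) by (eapply tends_nonzero; eauto; apply _).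
apply Cder_eps. intros eps He.
assert (Ti : tends (near w) (fun y => / p (g y))%C (/ l)%C).
{ apply tends_comp; [apply _ | exact Tp | now apply cont_inv]. }
generalize (filter_and _ _ (filter_and _ _ E N) (Ti _ He)). apply filter_imp.
intros y [[E1 N1] T1].
assert (Q := P1 (g y)). rewrite E1, Ew in Q.
replace (g y - g w - (y - w) * / l)%C with ((y - w) * (/ p (g y) - / l))%C.
2:{ assert (Q2 : (y - w)%C = ((g y - g w) * p (g y))%C) by (rewrite Q at 1; ring).
    rewrite Q2. field; auto. }
rewrite Cmod_mult, Rmult_comm. apply Rmult_le_compat_r; [apply Cmod_ge_0 | lra].
Qed.

(* Requiring [f'] to be differentiable makes [f] continuously differentiable, which is what the Cauchy formula needs, and is stable under all operations used. *)
Definition hol (U : C -> Prop) (f : C -> C) : Prop :=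
  exists f', forall z, U z -> Cder f z (f' z) /\ exists l, Cder f' z l.

Definition Cdisc (r : R) (z : C) : Prop := Cmod z < r.

Lemma Cdisc_near r z : Cdisc r z -> near z (Cdisc r).
Proof.
intros H. unfold Cdisc in *. exists (r - Cmod z). split; [lra |]. intros y Hy.
replace y with (y - z + z)%C by ring. generalize (Cmod_triangle (y - z) z); lra.
Qed.

Lemma hol_ext (U : C -> Prop) f g : (forall z, U z -> near z U) ->
  (forall z, U z -> f z = g z) -> hol U f -> hol U g.
Proof.
intros HU E [f' H]. exists f'. intros z Hz. destruct (H z Hz) as [H1 H2].
split; auto. apply Cder_ext with f; auto. generalize (HU z Hz). now apply filter_imp.
Qed.

Lemma hol_sub (U V : C -> Prop) f : (forall z, V z -> U z) -> hol U f -> hol V f.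
Proof. intros HV [f' H]. exists f'; auto. Qed.

Lemma hol_const U c : hol U (fun _ => c).
Proof.
exists (fun _ => 0%C). intros z _. split; [| exists 0%C]; apply Cder_const.
Qed.

Lemma hol_id U : hol U (fun z => z).
Proof.
exists (fun _ => 1%C). intros z _. split; [apply Cder_id | exists 0%C]; apply Cder_const.
Qed.

Lemma hol_plus U f g : hol U f -> hol U g -> hol U (fun z => f z + g z)%C.
Proof.
intros [f' Hf] [g' Hg]. exists (fun z => f' z + g' z)%C. intros z Hz.
destruct (Hf z Hz) as [F1 [l Fl]], (Hg z Hz) as [G1 [m Gm]]. split.
- now apply Cder_plus.
- exists (l + m)%C. now apply Cder_plus.
Qed.

Lemma hol_mult U f g : hol U f -> hol U g -> hol U (fun z => f z * g z)%C.
Proof.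
intros [f' Hf] [g' Hg]. exists (fun z => f' z * g z + f z * g' z)%C. intros z Hz.
destruct (Hf z Hz) as [F1 [l Fl]], (Hg z Hz) as [G1 [m Gm]]. split.
- now apply Cder_mult.
- eexists. apply Cder_plus; apply Cder_mult; eauto.
Qed.

Lemma hol_comp (U V : C -> Prop) f g : hol U f -> hol V g ->
  (forall z, U z -> V (f z)) -> hol U (fun z => g (f z)).
Proof.
intros [f' Hf] [g' Hg] HV. exists (fun z => g' (f z) * f' z)%C. intros z Hz.
destruct (Hf z Hz) as [F1 [l Fl]], (Hg _ (HV z Hz)) as [G1 [m Gm]]. split.
- now apply Cder_comp.
- eexists. apply (Cder_mult (fun y => g' (f y))); [apply Cder_comp |]; eauto.
Qed.

Lemma Cder_minus f g z l m : Cder f z l -> Cder g z m -> Cder (fun y => f y - g y)%C z (l - m)%C.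
Proof.
intros Hf Hg. apply Cder_plus; auto.
replace (- m)%C with (0 * g z + (-1) * m)%C by ring.
apply Cder_ext with (fun y => (-1) * g y)%C.
- apply filter_forall. intros; ring.
- apply (Cder_mult (fun _ => (-1)%C)); auto. apply Cder_const.
Qed.

Lemma hol_inv (U : C -> Prop) f : hol U f -> (forall z, U z -> f z <> 0%C) ->
  hol U (fun z => / f z)%C.
Proof.
intros Hf H0. apply (hol_comp U (fun z => z <> 0%C) f Cinv); auto.
exists (fun z => - / (z * z))%C. intros z Hz. split; [now apply Cder_inv |].
eexists. eapply Cder_ext.
2:{ apply Cder_minus. apply (Cder_const 0). apply (Cder_comp (fun y => y * y)%C Cinv).
    apply Cder_mult; apply Cder_id. apply Cder_inv. now apply Cmult_neq_0. }
apply filter_forall. intros; simpl. ring.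
Qed.

Lemma hol_cont U f z : hol U f -> U z -> cont f z.
Proof. intros [f' H] Hz. apply Cder_cont with (f' z). now apply H. Qed.

Lemma hol_pow U f n : hol U f -> hol U (fun z => f z ^ n)%C.
Proof.
intros Hf. induction n as [| n IH]; simpl.
- apply hol_const.
- now apply hol_mult.
Qed.

Lemma Cder_pow z n : Cder (fun y => y ^ n)%C z (INR n * z ^ pred n)%C.
Proof.
induction n as [| n IH].
- simpl. replace (0 * 1)%C with (RtoC 0) by ring. apply Cder_const.
- replace (INR (S n) * z ^ pred (S n))%C with (1 * z ^ n + z * (INR n * z ^ pred n))%C.
  + apply (Cder_mult (fun y => y)); auto. apply Cder_id.
  + rewrite S_INR, RtoC_plus. simpl pred. destruct n; simpl; ring.
Qed.

(** * Complex power series *)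

(** Sum over the indices below [n], one term fewer than [sum_n]: the empty sum exists, and
    [l - psum a N] is the sum of the terms from index [N] on. *)
Fixpoint psum (a : nat -> C) (n : nat) : C :=
  match n with O => 0%C | S n => (psum a n + a n)%C end.

Definition ser (a : nat -> C) (l : C) : Prop := tends eventually (psum a) l.

Lemma psum_ext a b n : (forall k, (k < n)%nat -> a k = b k) -> psum a n = psum b n.
Proof.
induction n as [| n IH]; intros H; simpl; auto.
rewrite IH, H; auto.
Qed.

Lemma psum_plus a b n : psum (fun k => a k + b k)%C n = (psum a n + psum b n)%C.
Proof. induction n as [| n IH]; simpl; [ring | rewrite IH; ring]. Qed.

Lemma psum_scal c a n : psum (fun k => c * a k)%C n = (c * psum a n)%C.
Proof. induction n as [| n IH]; simpl; [ring | rewrite IH; ring]. Qed.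

Lemma psum_shift a n : psum a (S n) = (a 0%nat + psum (fun k => a (S k)) n)%C.
Proof.
induction n as [| n IH]; [simpl; ring |].
change (psum a (S (S n))) with (psum a (S n) + a (S n))%C. rewrite IH. simpl; ring.
Qed.

Lemma sum_n_psum (a : nat -> C) n :
  @sum_n (NormedModule.AbelianMonoid C_AbsRing C_NormedModule) a n = psum a (S n).
Proof.
induction n as [| n IH].
- rewrite sum_O. simpl. ring.
- rewrite sum_Sn, IH. reflexivity.
Qed.

Lemma tends_locally (u : nat -> C) (l : C) :
  filterlim u eventually (@locally C_NormedModule l) <-> tends eventually u l.
Proof.
split.
- intros H eps He. apply (H (fun y => Cmod (y - l) < eps)).
  apply (locally_le_locally_norm (V := C_NormedModule)).
  now exists (mkposreal _ He).
- intros H P HP. apply (locally_norm_le_locally (V := C_NormedModule)) in HP.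
  destruct HP as [[e He] HP]. unfold filtermap.
  generalize (H e He). apply filter_imp. intros n Hn. now apply HP.
Qed.

Lemma eventually_S (P : nat -> Prop) : eventually P <-> eventually (fun n => P (S n)).
Proof.
split; intros [N HN].
- exists N. intros n Hn. apply HN; lia.
- exists (S N). intros [| n] Hn; [lia |]. apply HN; lia.
Qed.

Lemma is_series_ser (a : nat -> C) (l : C) :
  @is_series C_AbsRing C_NormedModule a l <-> ser a l.
Proof.
unfold is_series. rewrite tends_locally. unfold ser, tends.
split; intros H eps He; specialize (H eps He).
- apply eventually_S. revert H. apply filter_imp. intros n. now rewrite sum_n_psum.
- apply eventually_S in H. revert H. apply filter_imp. intros n. now rewrite sum_n_psum.
Qed.

Lemma ser_ext a b l : (forall n, a n = b n) -> ser a l -> ser b l.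
Proof.
intros E. apply tends_ext; [apply _ |]. apply filter_forall. intros n.
now apply psum_ext.
Qed.

Lemma pow_n_Cpow (z : C) n : @pow_n C_Ring z n = (z ^ n)%C.
Proof. induction n as [| n IH]; simpl; [easy | now rewrite IH]. Qed.

Lemma is_pseries_ser (a : nat -> C) (z l : C) :
  @is_pseries C_AbsRing C_NormedModule a z l <-> ser (fun n => a n * z ^ n)%C l.
Proof.
unfold is_pseries. rewrite is_series_ser.
split; apply ser_ext; intros n; rewrite <- pow_n_Cpow; apply Cmult_comm.
Qed.

Lemma ser_unique a l m : ser a l -> ser a m -> l = m.
Proof. apply tends_unique, _. Qed.

Lemma ser_plus a b l m : ser a l -> ser b m -> ser (fun n => a n + b n)%C (l + m)%C.
Proof.
intros Ha Hb. eapply tends_ext; [apply _ | | apply (tends_plus _ _ _ _ _ Ha Hb)].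
apply filter_forall. intros n. now rewrite psum_plus.
Qed.

Lemma ser_scal c a l : ser a l -> ser (fun n => c * a n)%C (c * l)%C.
Proof.
intros Ha. eapply tends_ext; [apply _ | |].
2: apply (tends_mult eventually (fun _ => c) (psum a)); [| exact Ha].
2: apply tends_const, _.
apply filter_forall. intros n. now rewrite psum_scal.
Qed.

Lemma ser_shift a l : ser a l <-> ser (fun n => a (S n)) (l - a 0%nat)%C.
Proof.
split; intros H eps He.
- assert (H2 := proj1 (eventually_S _) (H eps He)). revert H2. apply filter_imp.
  intros n. rewrite psum_shift.
  replace (psum (fun k => a (S k)) n - (l - a 0%nat))%C
    with (a 0%nat + psum (fun k => a (S k)) n - l)%C by ring. easy.
- apply eventually_S. generalize (H eps He). apply filter_imp.
  intros n. rewrite psum_shift.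
  replace (psum (fun k => a (S k)) n - (l - a 0%nat))%C
    with (a 0%nat + psum (fun k => a (S k)) n - l)%C by ring. easy.
Qed.

Lemma ser_shift_n a l N : ser a l -> ser (fun n => a (N + n)%nat) (l - psum a N)%C.
Proof.
intros H. induction N as [| N IH].
- simpl. replace (l - 0)%C with l by ring. exact H.
- apply ser_shift in IH. simpl psum. rewrite Nat.add_0_r in IH.
  replace (l - (psum a N + a N))%C with (l - psum a N - a N)%C by ring.
  revert IH. apply ser_ext. intros n. f_equal; lia.
Qed.

(** Comparison test that also keeps a bound on the sum; the tail estimates and the differentiation
    of power series rest on that bound. *)
Lemma ser_dom (a : nat -> C) (b : nat -> R) :
  (forall n, Cmod (a n) <= b n) -> ex_series b ->
  exists l, ser a l /\ Cmod l <= Series b.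
Proof.
intros H Hb.
destruct (ex_series_le (K := C_AbsRing) (V := C_CompleteNormedModule) a b H Hb) as [l Hl].
exists l. apply is_series_ser in Hl. split; auto.
apply (tends_le eventually (psum a)); auto.
apply filter_forall. intros n.
assert (B : forall n, 0 <= b n) by (intros k; eapply Rle_trans; [apply Cmod_ge_0 | apply H]).
apply Rle_trans with (sum_n b n).
(* [psum a n] stops before index [n], so the last term of [sum_n b n] is removed for the
   induction. *)
- apply Rle_trans with (sum_n b n - b n).
  + induction n as [| n IH].
    * rewrite sum_O. simpl. rewrite Cmod_0. lra.
    * rewrite sum_Sn. simpl. eapply Rle_trans; [apply Cmod_triangle |].
      generalize (H n). change plus with Rplus. lra.
  + generalize (B n); lra.
- apply (is_lim_seq_incr_compare (sum_n b)).
  + apply (Series_correct b Hb).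
  + intros k. rewrite sum_Sn. generalize (B (S k)). change plus with Rplus. lra.
Qed.

Lemma ser_geom_le (a : nat -> C) l K q : 0 <= q < 1 ->
  (forall n, Cmod (a n) <= K * q ^ n) -> ser a l -> Cmod l <= K / (1 - q).
Proof.
intros Hq H Hl.
assert (G : is_series (fun n => K * q ^ n) (K * / (1 - q))).
{ apply (is_series_scal (V := R_NormedModule) K (fun n => q ^ n) (/ (1 - q))). apply is_series_geom. rewrite Rabs_pos_eq; lra. }
destruct (ser_dom a _ H (ex_intro _ _ G)) as [m [Hm1 Hm2]].
rewrite (ser_unique _ _ _ Hl Hm1). now rewrite (is_series_unique _ _ G) in Hm2.
Qed.

Lemma ser_bounded a l : ser a l -> exists K, 0 < K /\ forall n, Cmod (a n) <= K.
Proof.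
intros H. destruct (H 1 Rlt_0_1) as [N HN].
assert (B : exists K, 0 < K /\ forall n, (n < N)%nat -> Cmod (a n) <= K).
{ clear HN. induction N as [| N [K [HK IH]]].
  - exists 1. split; [lra | intros; lia].
  - exists (K + Cmod (a N)). split; [generalize (Cmod_ge_0 (a N)); lra |].
    intros n Hn. generalize (Cmod_ge_0 (a N)). intros P.
    destruct (Nat.eq_dec n N) as [-> | ne]; [lra |].
    assert (n < N)%nat as L by lia. specialize (IH n L). lra. }
destruct B as [K [HK B]]. exists (K + 2). split; [lra |]. intros n.
destruct (Nat.lt_ge_cases n N) as [L | L]; [specialize (B n L); lra |].
assert (H1 := HN n L). assert (H2 := HN (S n) ltac:(lia)). simpl in H2.
replace (a n) with ((psum a n + a n - l) - (psum a n - l))%C by ring.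
generalize (Cmod_tri_sub (psum a n + a n - l) (psum a n - l)). lra.
Qed.

Lemma pseries_coef_bound a rho h : 0 < rho ->
  ser (fun n => a n * RtoC rho ^ n)%C h ->
  exists K, 0 < K /\ forall n, Cmod (a n) * rho ^ n <= K.
Proof.
intros Hr H. destruct (ser_bounded _ _ H) as [K [HK B]]. exists K. split; auto.
intros n. specialize (B n).
rewrite Cmod_mult, Cmod_pow, Cmod_R, Rabs_pos_eq in B by lra. exact B.
Qed.

(** Up to half the radius the ratio |z| / rho is at most 1/2, so the geometric tail is at most 1 /
    (1 - 1/2) = 2 times the bound on its first term. *)
Lemma pseries_tail a rho K (z l : C) N : 0 < rho ->
  (forall n, Cmod (a n) * rho ^ n <= K) -> Cmod z <= rho / 2 ->
  ser (fun n => a n * z ^ n)%C l ->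
  Cmod (l - psum (fun n => a n * z ^ n)%C N) <= 2 * K * (Cmod z / rho) ^ N.
Proof.
intros Hr B Hz H. apply (ser_shift_n _ _ N) in H.
set (q := Cmod z / rho).
assert (Hq : 0 <= q <= 1 / 2).
{ unfold q. split; [apply Rdiv_le_0_compat; [apply Cmod_ge_0 | lra] |].
  apply Rmult_le_reg_r with rho; auto. unfold Rdiv at 1.
  rewrite Rmult_assoc, Rinv_l by lra. lra. }
assert (Hzq : Cmod z = q * rho) by (unfold q; field; lra).
assert (K0 : 0 <= K).
{ specialize (B 0%nat). simpl in B. generalize (Cmod_ge_0 (a 0%nat)). lra. }
apply (ser_geom_le _ _ (K * q ^ N) q) in H; [| lra |].
- eapply Rle_trans; [exact H |].
  apply Rle_trans with (K * q ^ N * 2); [| lra].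
  apply Rmult_le_compat_l.
  + apply Rmult_le_pos; auto. apply pow_le; lra.
  + rewrite <- (Rinv_inv 2). apply Rinv_le_contravar; lra.
- intros n. rewrite Cmod_mult, Cmod_pow, Hzq, Rpow_mult_distr, Rmult_assoc, <- pow_add.
  replace (Cmod (a (N + n)%nat) * (q ^ (N + n) * rho ^ (N + n)))
    with (Cmod (a (N + n)%nat) * rho ^ (N + n) * q ^ (N + n)) by ring.
  apply Rmult_le_compat_r; [apply pow_le; lra | apply B].
Qed.

(** A chosen sum, arbitrary when the series diverges. It lets a function be defined by its power
    series before convergence is known; [CSer_correct] gives it meaning. *)
Definition CSer (a : nat -> C) : C := epsilon (inhabits (RtoC 0)) (ser a).

Lemma CSer_correct a l : ser a l -> ser a (CSer a).
Proof. intros H. unfold CSer. apply epsilon_spec. now exists l. Qed.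

Lemma ser_at_0 a : ser (fun n => a n * 0 ^ n)%C (a 0%nat).
Proof.
apply ser_shift. apply ser_ext with (fun _ => 0%C); [intros; simpl; ring |].
replace (a 0%nat - a 0%nat * 0 ^ 0)%C with (RtoC 0) by (simpl; ring).
intros eps He. exists 0%nat. intros m _.
replace (psum (fun _ => RtoC 0) m) with (RtoC 0).
- replace (0 - 0)%C with (RtoC 0) by ring. now rewrite Cmod_0.
- induction m; simpl; [easy | rewrite <- IHm; ring].
Qed.

(** Removes the singularity of f z / z at 0: the shifted series defines the quotient there too.
    Applied to [f], to its local inverse and to the arcsine. *)
Lemma pseries_div a f R0 : (forall z, Cmod z < R0 -> ser (fun n => a n * z ^ n)%C (f z)) ->
  a 0%nat = 0%C -> exists h, forall z, Cmod z < R0 ->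
    ser (fun n => a (S n) * z ^ n)%C (h z) /\ f z = (z * h z)%C.
Proof.
intros H A0. exists (fun z => CSer (fun n => a (S n) * z ^ n)%C). intros z Hz.
assert (K : exists l, ser (fun n => a (S n) * z ^ n)%C l /\ f z = (z * l)%C).
{ destruct (Ceq_dec z 0) as [-> | n].
  - exists (a 1%nat). split; [apply (ser_at_0 (fun n => a (S n))) |].
    rewrite (ser_unique _ _ _ (H 0%C Hz) (ser_at_0 a)), A0. ring.
  - exists (f z / z)%C. split; [| field; auto].
    assert (S1 := proj1 (ser_shift _ _) (H z Hz)). cbv beta in S1. rewrite A0 in S1.
    apply (ser_scal (/ z)) in S1.
    replace (/ z * (f z - 0 * z ^ 0))%C with (f z / z)%C in S1 by (simpl; field; auto).
    revert S1. apply ser_ext. intros m. simpl. field. auto. }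
destruct K as [l [Hl ->]]. rewrite <- (ser_unique _ _ _ Hl (CSer_correct _ _ Hl)). auto.
Qed.

(** Since n^2 <= (n+1)(n+2), the twice differentiated geometric series dominates. *)
Lemma ex_series_sq_geom q : 0 <= q < 1 -> ex_series (fun n => INR n ^ 2 * q ^ n).
Proof.
intros Hq.
assert (R1 : Rbar_le 1 (CV_radius (fun _ => 1))).
{ destruct (CV_radius_bounded (fun _ => 1)) as [H _]. apply H. exists 1.
  intros n. rewrite pow1, Rmult_1_r, Rabs_R1. lra. }
assert (E : ex_pseries (PS_derive (PS_derive (fun _ => 1))) q).
{ apply CV_radius_inside. rewrite CV_radius_derive, CV_radius_derive. eapply Rbar_lt_le_trans; eauto.
  simpl. rewrite Rabs_pos_eq; lra. }
apply (ex_series_le (V := R_CompleteNormedModule) _ _) with (2 := E).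
intros n.
change (Rabs (INR n ^ 2 * q ^ n)
  <= @pow_n R_Ring q n * (INR (S n) * (INR (S (S n)) * 1))).
replace (@pow_n R_Ring q n) with (q ^ n) by (symmetry; apply pow_n_pow).
assert (0 <= q ^ n) by (apply pow_le; lra).
assert (P := pos_INR n). rewrite Rabs_pos_eq.
- rewrite !S_INR. nra.
- apply Rmult_le_pos; auto. apply pow2_ge_0.
Qed.

(** Second-order remainder of a power. Passing from n to n+1 multiplies the remainder by y and adds
    n z^(n-1) (y-z)^2, and n^2 + n <= (n+1)^2. The factor rho^2 stands on the left so that no
    exponent n - 2 occurs. *)
Lemma pow_taylor_bound (y z : C) rho n : Cmod y <= rho -> Cmod z <= rho ->
  rho ^ 2 * Cmod (y ^ n - z ^ n - (y - z) * (INR n * z ^ pred n))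
  <= INR n ^ 2 * rho ^ n * Cmod (y - z) ^ 2.
Proof.
intros Hy Hz. assert (Hr : 0 <= rho) by (generalize (Cmod_ge_0 y); lra).
induction n as [| n IH].
- simpl. replace (1 - 1 - (y - z) * (0 * 1))%C with (RtoC 0) by ring. rewrite Cmod_0. lra.
- assert (E : (y ^ S n - z ^ S n - (y - z) * (INR (S n) * z ^ pred (S n)) =
    y * (y ^ n - z ^ n - (y - z) * (INR n * z ^ pred n))
    + (y - z) * (y - z) * (INR n * z ^ pred n))%C).
  { rewrite S_INR, RtoC_plus. destruct n; simpl; ring. }
  rewrite E. set (W := (y ^ n - z ^ n - (y - z) * (INR n * z ^ pred n))%C) in *.
  apply Rle_trans with (rho ^ 2 * (rho * Cmod W
    + Cmod (y - z) ^ 2 * (INR n * Cmod z ^ pred n))).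
  + apply Rmult_le_compat_l; [nra |].
    eapply Rle_trans; [apply Cmod_triangle |].
    rewrite !Cmod_mult, Cmod_R, Cmod_pow, (Rabs_pos_eq (INR n)) by apply pos_INR.
    generalize (Cmod_ge_0 W). nra.
  + assert (P : rho ^ 2 * (INR n * Cmod z ^ pred n) <= INR n * rho ^ S n).
    { destruct n as [| n]; [simpl; lra |].
      replace (INR (S n) * rho ^ S (S n)) with (rho ^ 2 * (INR (S n) * rho ^ n)) by (simpl; ring).
      apply Rmult_le_compat_l; [nra |]. apply Rmult_le_compat_l; [apply pos_INR |].
      simpl pred. apply pow_incr. split; [apply Cmod_ge_0 | auto]. }
    rewrite S_INR.
    replace (rho ^ 2 * (rho * Cmod W + Cmod (y - z) ^ 2 * (INR n * Cmod z ^ pred n)))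
      with (rho * (rho ^ 2 * Cmod W)
        + Cmod (y - z) ^ 2 * (rho ^ 2 * (INR n * Cmod z ^ pred n))) by ring.
    apply Rle_trans with (rho * (INR n ^ 2 * rho ^ n * Cmod (y - z) ^ 2)
      + Cmod (y - z) ^ 2 * (INR n * rho ^ S n)).
    { apply Rplus_le_compat; apply Rmult_le_compat_l; auto. apply pow2_ge_0. }
    replace (rho * (INR n ^ 2 * rho ^ n * Cmod (y - z) ^ 2)
      + Cmod (y - z) ^ 2 * (INR n * rho ^ S n))
      with ((INR n ^ 2 + INR n) * rho ^ S n * Cmod (y - z) ^ 2) by (simpl; ring).
    apply Rmult_le_compat_r; [apply pow2_ge_0 |].
    apply Rmult_le_compat_r; [now apply pow_le |].
    generalize (pos_INR n); nra.
Qed.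

Lemma pseries_Cder (a : nat -> C) (h : C -> C) R0 :
  (forall z, Cmod z < R0 -> ser (fun n => a n * z ^ n)%C (h z)) ->
  exists h', forall z, Cmod z < R0 ->
    Cder h z (h' z) /\ ser (fun n => INR (S n) * a (S n) * z ^ n)%C (h' z).
Proof.
intros H. exists (fun z => CSer (fun n => INR (S n) * a (S n) * z ^ n)%C). intros z Hz.
assert (Z0 := Cmod_ge_0 z).
(* Two radii between |z| and R0: the coefficients are bounded by means of the outer one, while [y]
   stays within the inner one. The ratio [q = r1 / r] < 1 then absorbs the factor n^2. *)
set (r1 := Cmod z + (R0 - Cmod z) / 3). set (r := Cmod z + 2 * (R0 - Cmod z) / 3).
assert (H1 : 0 < r1) by (unfold r1; lra).
assert (Hr : 0 < r) by (unfold r; lra).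
assert (Hrr : r1 < r) by (unfold r, r1; lra).
assert (HzR : Cmod z < r1) by (unfold r1; lra).
assert (HrR : r < R0) by (unfold r; lra).
destruct (pseries_coef_bound a r (h (RtoC r)) Hr) as [K [HK B]].
{ apply H. rewrite Cmod_R, Rabs_pos_eq; lra. }
set (q := r1 / r).
assert (Hq : 0 <= q < 1).
{ unfold q. split; [apply Rdiv_le_0_compat; lra |].
  apply Rmult_lt_reg_r with r; auto. unfold Rdiv. rewrite Rmult_assoc, Rinv_l; lra. }
assert (Hr1q : r1 = q * r) by (unfold q; field; lra).
assert (SQ := ex_series_sq_geom q Hq).
set (S2 := Series (fun n => INR n ^ 2 * q ^ n)).
assert (B1 : forall n, Cmod (a n) * r1 ^ n <= K * q ^ n).
{ intros n. rewrite Hr1q, Rpow_mult_distr.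
  replace (Cmod (a n) * (q ^ n * r ^ n)) with (Cmod (a n) * r ^ n * q ^ n) by ring.
  apply Rmult_le_compat_r; [apply pow_le; lra | auto]. }
assert (E : exists l, ser (fun n => INR n * a n * z ^ pred n)%C l).
{ destruct (ser_dom (fun n => INR n * a n * z ^ pred n)%C
    (fun n => K / r1 * (INR n ^ 2 * q ^ n))) as [l [Hl _]].
  - intros n. rewrite !Cmod_mult, Cmod_pow, Cmod_R, Rabs_pos_eq by apply pos_INR.
    destruct n as [| n]; [simpl; lra |].
    apply Rle_trans with (INR (S n) * (Cmod (a (S n)) * r1 ^ S n) / r1).
    + replace (INR (S n) * (Cmod (a (S n)) * r1 ^ S n) / r1)
        with (INR (S n) * Cmod (a (S n)) * r1 ^ n) by (simpl; field; lra).
      apply Rmult_le_compat_l.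
      * apply Rmult_le_pos; [apply pos_INR | apply Cmod_ge_0].
      * simpl pred. apply pow_incr; lra.
    + unfold Rdiv. rewrite (Rmult_comm K), Rmult_assoc, (Rmult_comm _ (/ r1)), Rmult_assoc.
      rewrite (Rmult_comm (INR (S n))), Rmult_assoc.
      apply Rmult_le_compat_l; [left; now apply Rinv_0_lt_compat |].
      apply Rle_trans with (K * q ^ S n * INR (S n)).
      * apply Rmult_le_compat_r; [apply pos_INR | apply B1].
      * assert (0 <= K * q ^ S n) by (apply Rmult_le_pos; [lra | apply pow_le; lra]).
        assert (1 <= INR (S n)) by (rewrite S_INR; generalize (pos_INR n); lra).
        replace (K * (INR (S n) ^ 2 * q ^ S n)) with (K * q ^ S n * INR (S n) ^ 2) by ring.
        apply Rmult_le_compat_l; auto. nra.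
  - apply (ex_series_scal_l (V := R_NormedModule) (K / r1)). exact SQ.
  - now exists l. }
destruct E as [l Hl].
assert (Hl2 : ser (fun n => INR (S n) * a (S n) * z ^ n)%C l).
{ apply ser_shift in Hl. replace (l - INR 0 * a 0%nat * z ^ pred 0)%C with l in Hl by (simpl; ring).
  exact Hl. }
assert (Hl3 := CSer_correct _ _ Hl2). split; auto.
rewrite (ser_unique _ _ _ Hl3 Hl2). clear Hl3.
apply Cder_eps. intros eps He.
set (M := K / r1 ^ 2 * S2 + 1).
assert (S20 : 0 <= S2).
{ destruct (ser_dom (fun _ => 0%C) (fun n => INR n ^ 2 * q ^ n)) as [m [_ Hm]]; auto.
  - intros n. rewrite Cmod_0. apply Rmult_le_pos; [apply pow2_ge_0 | apply pow_le; lra].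
  - generalize (Cmod_ge_0 m). unfold S2. lra. }
assert (HM : 0 < M).
{ unfold M. assert (0 <= K / r1 ^ 2 * S2); [| lra]. apply Rmult_le_pos; auto.
  apply Rdiv_le_0_compat; [lra | apply pow_lt; lra]. }
exists (Rmin (r1 - Cmod z) (eps / M)). split.
{ apply Rmin_glb_lt; [lra | apply Rdiv_lt_0_compat; lra]. }
intros y Hy.
assert (Y1 : Cmod (y - z) < r1 - Cmod z) by (eapply Rlt_le_trans; [exact Hy | apply Rmin_l]).
assert (Y2 : Cmod (y - z) < eps / M) by (eapply Rlt_le_trans; [exact Hy | apply Rmin_r]).
assert (Y3 : Cmod y <= r1).
{ replace y with (y - z + z)%C by ring. generalize (Cmod_triangle (y - z) z); lra. }
assert (Sy := H y ltac:(lra)). assert (Sz := H z Hz).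
assert (SS := ser_plus _ _ _ _ (ser_plus _ _ _ _ Sy (ser_scal (-1) _ _ Sz))
  (ser_scal (- (y - z)) _ _ Hl)).
replace (h y - h z - (y - z) * l)%C with (h y + -1 * h z + - (y - z) * l)%C by ring.
destruct (ser_dom (fun n => a n * y ^ n + -1 * (a n * z ^ n) + - (y - z) * (INR n * a n * z ^ pred n))%C
  (fun n => (K / r1 ^ 2 * Cmod (y - z) ^ 2) * (INR n ^ 2 * q ^ n))) as [m [Hm1 Hm2]].
- intros n.
  replace (a n * y ^ n + -1 * (a n * z ^ n) + - (y - z) * (INR n * a n * z ^ pred n))%C
    with (a n * (y ^ n - z ^ n - (y - z) * (INR n * z ^ pred n)))%C by ring.
  rewrite Cmod_mult.
  assert (T := pow_taylor_bound y z r1 n Y3 ltac:(lra)).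
  set (W := Cmod (y ^ n - z ^ n - (y - z) * (INR n * z ^ pred n))) in *.
  assert (Q2 : 0 < r1 ^ 2) by (apply pow_lt; lra).
  apply Rmult_le_reg_l with (r1 ^ 2); auto.
  replace (r1 ^ 2 * (K / r1 ^ 2 * Cmod (y - z) ^ 2 * (INR n ^ 2 * q ^ n)))
    with ((INR n ^ 2 * Cmod (y - z) ^ 2) * (K * q ^ n)) by (field; lra).
  apply Rle_trans with (Cmod (a n) * (INR n ^ 2 * r1 ^ n * Cmod (y - z) ^ 2)).
  + replace (r1 ^ 2 * (Cmod (a n) * W)) with (Cmod (a n) * (r1 ^ 2 * W)) by ring.
    apply Rmult_le_compat_l; auto. apply Cmod_ge_0.
  + replace (Cmod (a n) * (INR n ^ 2 * r1 ^ n * Cmod (y - z) ^ 2))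
      with ((INR n ^ 2 * Cmod (y - z) ^ 2) * (Cmod (a n) * r1 ^ n)) by ring.
    apply Rmult_le_compat_l; auto. apply Rmult_le_pos; apply pow2_ge_0.
- apply (ex_series_scal_l (V := R_NormedModule) (K / r1 ^ 2 * Cmod (y - z) ^ 2)). exact SQ.
- rewrite (ser_unique _ _ _ SS Hm1). eapply Rle_trans; [exact Hm2 |].
  rewrite Series_scal_l. fold S2.
  assert (P := Cmod_ge_0 (y - z)).
  replace (K / r1 ^ 2 * Cmod (y - z) ^ 2 * S2)
    with (K / r1 ^ 2 * S2 * Cmod (y - z) * Cmod (y - z)) by ring.
  apply Rmult_le_compat_r; auto.
  apply Rle_trans with (M * (eps / M)); [| right; field; apply Rgt_not_eq; exact HM].
  assert (0 <= K / r1 ^ 2 * S2).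
  { apply Rmult_le_pos; auto. apply Rdiv_le_0_compat; [lra | apply pow_lt; lra]. }
  apply Rmult_le_compat; auto; [unfold M; lra | lra].
Qed.

Lemma pseries_hol (a : nat -> C) (h : C -> C) R0 :
  (forall z, Cmod z < R0 -> ser (fun n => a n * z ^ n)%C (h z)) -> hol (Cdisc R0) h.
Proof.
intros H. destruct (pseries_Cder a h R0 H) as [h' H'].
destruct (pseries_Cder (fun n => INR (S n) * a (S n))%C h' R0) as [h2 H2].
{ intros z Hz. now apply H'. }
exists h'. intros z Hz. split; [now apply H' |]. exists (h2 z). now apply H2.
Qed.

(** The constant term is read off from the tail bound as [z] tends to 0; dividing by [z] then shifts
    the series. The hypothesis leaves out the origin so that it survives this division. *)
Lemma pseries_zero (c : nat -> C) r : 0 < r ->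
  (forall z, 0 < Cmod z < r -> ser (fun n => c n * z ^ n)%C 0) -> forall n, c n = 0%C.
Proof.
intros Hr H n. revert c H.
assert (base : forall c, (forall z, 0 < Cmod z < r -> ser (fun n => c n * z ^ n)%C 0) -> c 0%nat = 0%C).
{ intros c H.
  destruct (pseries_coef_bound c (r / 2) 0 ltac:(lra)) as [K [HK B]].
  { apply H. rewrite Cmod_R, Rabs_pos_eq; lra. }
  apply Cmod_eq_0. apply Rle_antisym; [| apply Cmod_ge_0].
  apply Rnot_lt_le. intros P.
  (* The tail beyond [c 0] is at most 2 K t / (r/2), which this [t] makes at most half of |c 0|. *)
  set (t := Rmin (r / 4) (r / (8 * K) * Cmod (c 0%nat))).
  assert (T0 : 0 < t).
  { apply Rmin_glb_lt; [lra |]. apply Rmult_lt_0_compat; auto. apply Rdiv_lt_0_compat; lra. }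
  assert (T1 : t <= r / 4) by apply Rmin_l.
  assert (T2 : t <= r / (8 * K) * Cmod (c 0%nat)) by apply Rmin_r.
  assert (Ct : Cmod (RtoC t) = t) by (rewrite Cmod_R, Rabs_pos_eq; lra).
  assert (Q := pseries_tail c (r / 2) K (RtoC t) 0 1 ltac:(lra) B ltac:(lra)
    (H (RtoC t) ltac:(lra))).
  simpl in Q. rewrite Ct in Q.
  replace (0 - (0 + c 0%nat * 1))%C with (- c 0%nat)%C in Q by ring.
  rewrite Cmod_opp in Q.
  assert (2 * K * (t / (r / 2) * 1) <= Cmod (c 0%nat) / 2); [| lra].
  apply Rle_trans with (2 * K * (r / (8 * K) * Cmod (c 0%nat) / (r / 2) * 1)).
  - apply Rmult_le_compat_l; [lra |]. apply Rmult_le_compat_r; [lra |].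
    apply Rmult_le_compat_r; auto. left. apply Rinv_0_lt_compat; lra.
  - right. field. lra. }
induction n as [| n IH]; intros c H; [now apply base |].
apply (IH (fun k => c (S k))). intros z Hz. assert (c0 := base c H).
specialize (H z Hz). apply ser_shift in H. rewrite c0 in H.
assert (z0 : z <> 0%C) by (apply Cmod_gt_0; lra).
apply (ser_scal (/ z)) in H.
replace (/ z * (0 - 0 * z ^ 0))%C with (RtoC 0) in H by (simpl; ring).
revert H. apply ser_ext. intros k. simpl. field; auto.
Qed.

Lemma pseries_unique (a b : nat -> C) (h : C -> C) r : 0 < r ->
  (forall z, 0 < Cmod z < r -> ser (fun n => a n * z ^ n)%C (h z)) ->
  (forall z, 0 < Cmod z < r -> ser (fun n => b n * z ^ n)%C (h z)) ->
  forall n, a n = b n.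
Proof.
intros Hr Ha Hb n. apply Csub_0.
apply (pseries_zero (fun k => a k - b k)%C r Hr). intros z Hz.
assert (S := ser_plus _ _ _ _ (Ha z Hz) (ser_scal (-1) _ _ (Hb z Hz))).
replace (h z + -1 * h z)%C with (RtoC 0) in S by ring.
revert S. apply ser_ext. intros; ring.
Qed.

Lemma pseries_prim a h R0 : (forall z, Cmod z < R0 -> ser (fun n => a n * z ^ n)%C (h z)) ->
  exists (b : nat -> C) (H : C -> C), b 0%nat = 0%C /\ (forall n, (INR (S n) * b (S n))%C = a n) /\
    forall z, Cmod z < R0 -> ser (fun n => b n * z ^ n)%C (H z) /\ Cder H z (h z).
Proof.
intros Ha.
set (b := fun n => match n with O => RtoC 0 | S m => (a m / INR (S m))%C end).
assert (nz : forall n, RtoC (INR (S n)) <> 0%C).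
{ intros n X. apply RtoC_inj in X. generalize (pos_INR n). rewrite S_INR in X. lra. }
assert (Hb : forall z, Cmod z < R0 -> exists l, ser (fun n => b n * z ^ n)%C l).
{ intros z Hz. assert (Z0 := Cmod_ge_0 z). set (r := (Cmod z + R0) / 2).
  assert (Hr : 0 < r) by (unfold r; lra).
  destruct (pseries_coef_bound a r (h (RtoC r)) Hr) as [K [HK B]].
  { apply Ha. rewrite Cmod_R, Rabs_pos_eq; unfold r; lra. }
  set (q := Cmod z / r).
  assert (Hq : 0 <= q < 1).
  { unfold q. split; [apply Rdiv_le_0_compat; lra |].
    apply Rmult_lt_reg_r with r; auto. unfold Rdiv. rewrite Rmult_assoc, Rinv_l; unfold r in *; lra. }
  assert (Hzq : Cmod z = q * r) by (unfold q; field; lra).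
  destruct (ser_dom (fun n => b (S n) * z ^ S n)%C (fun n => K * Cmod z * q ^ n)) as [l [Hl _]].
  - intros n. unfold b. rewrite Cmod_mult, Cmod_div, Cmod_pow, Cmod_R, Rabs_pos_eq
      by (auto; apply pos_INR).
    simpl (Cmod z ^ S n).
    replace (K * Cmod z * q ^ n) with (K * (Cmod z * q ^ n)) by ring.
    apply Rle_trans with (Cmod (a n) * (Cmod z * Cmod z ^ n)).
    + apply Rmult_le_compat_r.
      * apply Rmult_le_pos; auto. now apply pow_le.
      * rewrite <- (Rmult_1_r (Cmod (a n))) at 2. apply Rmult_le_compat_l; [apply Cmod_ge_0 |].
        rewrite <- Rinv_1. apply Rinv_le_contravar; [lra |]. rewrite S_INR. generalize (pos_INR n); lra.
    + replace (Cmod z ^ n) with (r ^ n * q ^ n) by (rewrite Hzq, Rpow_mult_distr; ring).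
      replace (Cmod (a n) * (Cmod z * (r ^ n * q ^ n))) with (Cmod (a n) * r ^ n * (Cmod z * q ^ n)) by ring.
      apply Rmult_le_compat_r; auto. apply Rmult_le_pos; auto. apply pow_le; lra.
  - apply (ex_series_scal_l (V := R_NormedModule) (K * Cmod z)).
    apply ex_series_geom. rewrite Rabs_pos_eq; lra.
  - exists (l + b 0%nat * z ^ 0)%C. apply ser_shift.
    replace (l + b 0%nat * z ^ 0 - b 0%nat * z ^ 0)%C with l by ring. exact Hl. }
exists b, (fun z : C => CSer (fun n => (b n * z ^ n)%C)).
assert (Hn : forall n, (INR (S n) * b (S n))%C = a n).
{ intros n. unfold b. field. apply nz. }
assert (HS : forall z, Cmod z < R0 -> ser (fun n => b n * z ^ n)%C (CSer (fun n => b n * z ^ n)%C)).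
{ intros z Hz. destruct (Hb z Hz) as [l Hl]. apply (CSer_correct _ _ Hl). }
split; [reflexivity | split; [exact Hn |]]. intros z Hz. split; [auto |].
destruct (pseries_Cder b _ R0 HS) as [h' Hh]. destruct (Hh z Hz) as [D1 D2].
rewrite (ser_unique (fun n => a n * z ^ n)%C (h z) (h' z)); auto.
revert D2. apply ser_ext. intros n. now rewrite Hn.
Qed.

(** * The exponential and integrals over circles *)

Lemma Cder_real (f : C -> C) (t : R) (l : C) : Cder f (RtoC t) l ->
  is_derive (fun s : R => Re (f (RtoC s))) t (Re l) /\
  is_derive (fun s : R => Im (f (RtoC s))) t (Im l).
Proof.
intros H. rewrite Cder_eps in H.
(* [Re] and [Im] are treated together as a real-linear functional bounded by the modulus. *)
assert (K : forall p : C -> R, (forall a, Rabs (p a) <= Cmod a) ->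
  (forall a b, p (a - b)%C = p a - p b) -> (forall (x : R) a, p (x * a)%C = x * p a) ->
  is_derive (fun s : R => p (f (RtoC s))) t (p l)).
{ intros p P1 P2 P3. apply is_derive_Reals. intros eps He.
  assert (He2 : 0 < eps / 2) by lra.
  destruct (H _ He2) as [d [Hd HH]]. exists (mkposreal d Hd). intros x Hx Hxd. simpl in Hxd.
  specialize (HH (RtoC (t + x))).
  assert (E : (RtoC (t + x) - RtoC t)%C = RtoC x) by (rewrite RtoC_plus; ring).
  rewrite E, Cmod_R in HH. specialize (HH Hxd).
  apply Rle_lt_trans with (eps / 2); [| lra].
  apply Rmult_le_reg_r with (Rabs x); [now apply Rabs_pos_lt |].
  rewrite <- Rabs_mult.
  replace (((p (f (RtoC (t + x))) - p (f (RtoC t))) / x - p l) * x)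
    with (p (f (RtoC (t + x)) - f (RtoC t) - x * l)%C).
  - eapply Rle_trans; [apply P1 | exact HH].
  - rewrite !P2, P3. field; auto. }
split; apply K.
- apply re_le_Cmod.
- intros [] []; reflexivity.
- intros x []; simpl; ring.
- intros [x y]. simpl. eapply Rle_trans; [apply Rmax_r | apply (Rmax_Cmod (x, y))].
- intros [] []; reflexivity.
- intros x []; simpl; ring.
Qed.

Lemma im_le_Cmod (c : C) : Rabs (Im c) <= Cmod c.
Proof. destruct c as [x y]. eapply Rle_trans; [apply Rmax_r | apply (Rmax_Cmod (x, y))]. Qed.

Lemma Cmod_le_ReIm (c : C) : Cmod c <= Rabs (Re c) + Rabs (Im c).
Proof.
destruct c as [x y]. simpl.
replace (x, y) with (RtoC x + Ci * RtoC y)%C by (unfold RtoC, Ci, Cplus, Cmult; simpl; f_equal; ring).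
eapply Rle_trans; [apply Cmod_triangle |].
rewrite Cmod_mult, Cmod_Ci, !Cmod_R. lra.
Qed.

Lemma C_ext (a b : C) : Re a = Re b -> Im a = Im b -> a = b.
Proof. destruct a, b; simpl; intros; subst; reflexivity. Qed.

(* Complex mean-value inequality: apply the real mean value theorem to [Re (conj v * phi) - |v| m], where [v] is the total increment. *)
Lemma mean_value_ineq (phi dphi : C -> C) (m dm : R -> R) a b : a <= b ->
  (forall t, a <= t <= b -> Cder phi (RtoC t) (dphi (RtoC t))) ->
  (forall t, a <= t <= b -> is_derive m t (dm t)) ->
  (forall t, a <= t <= b -> Cmod (dphi (RtoC t)) <= dm t) ->
  Cmod (phi (RtoC b) - phi (RtoC a)) <= m b - m a.
Proof.
intros Hab Hp Hm Hle.
set (v := (phi (RtoC b) - phi (RtoC a))%C).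
set (f := fun t : R => Re (Cconj v * phi (RtoC t))%C - Cmod v * m t).
assert (Df : forall t, a <= t <= b ->
  is_derive f t (Re (Cconj v * dphi (RtoC t))%C - Cmod v * dm t)).
{ intros t Ht. apply (is_derive_minus (fun t : R => Re (Cconj v * phi (RtoC t))%C)).
  - apply (Cder_real (fun z => Cconj v * phi z)%C).
    replace (Cconj v * dphi (RtoC t))%C
      with (0 * phi (RtoC t) + Cconj v * dphi (RtoC t))%C by ring.
    apply (Cder_mult (fun _ => Cconj v)). apply Cder_const. auto.
  - apply (is_derive_scal m). auto. }
destruct (MVT_gen f a b (fun t => Re (Cconj v * dphi (RtoC t))%C - Cmod v * dm t)) as [c [Hc E]].
- rewrite Rmin_left, Rmax_right by auto. intros x Hx. apply Df; lra.
- rewrite Rmin_left, Rmax_right by auto. intros x Hx. apply continuity_pt_filterlim.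
  apply (ex_derive_continuous f). eexists. now apply Df.
- rewrite Rmin_left, Rmax_right in Hc by auto.
  assert (N : Re (Cconj v * dphi (RtoC c))%C - Cmod v * dm c <= 0).
  { assert (Q := re_le_Cmod (Cconj v * dphi (RtoC c))%C). rewrite Cmod_mult, Cmod_conj in Q.
    apply Rabs_le_between in Q. generalize (Hle c Hc) (Cmod_ge_0 v). nra. }
  assert (F : f b - f a <= 0) by (rewrite E; nra).
  unfold f in F.
  assert (V : Re (Cconj v * phi (RtoC b))%C - Re (Cconj v * phi (RtoC a))%C = Cmod v ^ 2).
  { rewrite Cmod2_alt. unfold v. destruct (phi (RtoC b)), (phi (RtoC a)). simpl. ring. }
  assert (W : Cmod v * Cmod v <= Cmod v * (m b - m a)) by nra.
  destruct (Req_dec (Cmod v) 0) as [Z | Z].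
  + rewrite Z. destruct (MVT_gen m a b dm) as [c' [Hc' E']].
    * rewrite Rmin_left, Rmax_right by auto. intros x Hx. apply Hm; lra.
    * rewrite Rmin_left, Rmax_right by auto. intros x Hx. apply continuity_pt_filterlim.
      apply (ex_derive_continuous m). eexists. now apply Hm.
    * rewrite Rmin_left, Rmax_right in Hc' by auto. rewrite E'.
      apply Rmult_le_pos; [| lra]. eapply Rle_trans; [apply Cmod_ge_0 | now apply Hle].
  + assert (P := Cmod_ge_0 v). apply Rmult_le_reg_l with (Cmod v); lra.
Qed.

Definition Cexp (z : C) : C := (exp (Re z) * cos (Im z), exp (Re z) * sin (Im z)).

Lemma Cexp_plus z w : Cexp (z + w) = (Cexp z * Cexp w)%C.
Proof.
destruct z as [x y], w as [u v]. unfold Cexp, Cmult. simpl.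
rewrite exp_plus, cos_plus, sin_plus. f_equal; ring.
Qed.

Lemma Cexp_0 : Cexp 0 = 1%C.
Proof. unfold Cexp. simpl. rewrite exp_0, cos_0, sin_0. unfold RtoC. f_equal; ring. Qed.

Lemma Cexp_neq_0 z : Cexp z <> 0%C.
Proof.
intros E. assert (H : (Cexp z * Cexp (- z))%C = 1%C).
{ rewrite <- Cexp_plus. replace (z + - z)%C with (RtoC 0) by ring. apply Cexp_0. }
rewrite E in H. assert (X : (0 * Cexp (- z))%C = 0%C) by ring. rewrite X in H.
apply (f_equal Re) in H. simpl in H. lra.
Qed.

Lemma Cexp_opp z : Cexp (- z) = (/ Cexp z)%C.
Proof.
assert (H : (Cexp z * Cexp (- z))%C = 1%C).
{ rewrite <- Cexp_plus. replace (z + - z)%C with (RtoC 0) by ring. apply Cexp_0. }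
assert (N := Cexp_neq_0 z).
replace (Cexp (- z)) with ((Cexp z * Cexp (- z)) / Cexp z)%C by (field; auto).
rewrite H. field; auto.
Qed.

Lemma Cmod_Cexp z : Cmod (Cexp z) = exp (Re z).
Proof.
unfold Cexp, Cmod. simpl fst; simpl snd.
replace ((exp (Re z) * cos (Im z)) ^ 2 + (exp (Re z) * sin (Im z)) ^ 2)
  with (exp (Re z) ^ 2 * ((sin (Im z))² + (cos (Im z))²)) by (unfold Rsqr; ring).
rewrite sin2_cos2, Rmult_1_r. apply sqrt_pow2. left; apply exp_pos.
Qed.

Lemma deriv_near0 (f : R -> R) l : is_derive f 0 l -> forall eps, 0 < eps ->
  exists d, 0 < d /\ forall x, Rabs x < d -> Rabs (f x - f 0 - l * x) <= eps * Rabs x.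
Proof.
intros H eps He. apply is_derive_Reals in H. destruct (H eps He) as [[d Hd] HH].
exists d. split; auto. intros x Hx.
destruct (Req_dec x 0) as [-> | n].
- replace (f 0 - f 0 - l * 0) with 0 by ring. rewrite Rabs_R0. lra.
- specialize (HH x n Hx). rewrite Rplus_0_l in HH.
  replace (f x - f 0 - l * x) with (((f x - f 0) / x - l) * x) by (field; auto).
  rewrite Rabs_mult. apply Rmult_le_compat_r; [apply Rabs_pos | lra].
Qed.

Lemma Cder_Cexp_0 : Cder Cexp 0 1.
Proof.
apply Cder_eps. intros eps He.
(* The real and the imaginary error come to at most 4 e M and 5 e M with M = |z|, so eps / 20
   suffices; e <= 1 keeps the products of two errors linear in e M. *)
set (e := Rmin 1 (eps / 20)).
assert (He1 : 0 < e) by (apply Rmin_glb_lt; lra).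
assert (He2 : e <= 1) by apply Rmin_l. assert (He3 : e <= eps / 20) by apply Rmin_r.
assert (X1 : is_derive exp 0 1) by (auto_derive; [easy | rewrite exp_0; ring]).
assert (X2 : is_derive cos 0 0) by (auto_derive; [easy | rewrite sin_0; ring]).
assert (X3 : is_derive sin 0 1) by (auto_derive; [easy | rewrite cos_0; ring]).
destruct (deriv_near0 _ _ X1 e He1) as [d1 [D1 Y1]].
destruct (deriv_near0 _ _ X2 e He1) as [d2 [D2 Y2]].
destruct (deriv_near0 _ _ X3 e He1) as [d3 [D3 Y3]].
exists (Rmin e (Rmin d1 (Rmin d2 d3))). split; [apply Rmin_glb_lt; [| apply Rmin_glb_lt; [| apply Rmin_glb_lt]]; auto |].
intros z Hz.
replace (z - 0)%C with z in * by ring.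
assert (Z0 := re_le_Cmod z). assert (Z1 := im_le_Cmod z). destruct z as [x y]. simpl in Z0, Z1.
assert (B0 := Rlt_le_trans _ _ _ Hz (Rmin_l _ _)).
assert (B := Rlt_le_trans _ _ _ Hz (Rmin_r _ _)).
assert (B1 := Rlt_le_trans _ _ _ B (Rmin_l _ _)).
assert (B' := Rlt_le_trans _ _ _ B (Rmin_r _ _)).
assert (B2 := Rlt_le_trans _ _ _ B' (Rmin_l _ _)).
assert (B3 := Rlt_le_trans _ _ _ B' (Rmin_r _ _)).
specialize (Y1 x ltac:(lra)). specialize (Y2 y ltac:(lra)). specialize (Y3 y ltac:(lra)).
rewrite exp_0 in Y1. rewrite cos_0 in Y2. rewrite sin_0 in Y3.
rewrite Cexp_0. set (M := Cmod (x, y)) in *.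
assert (M0 : 0 <= M) by apply Cmod_ge_0.
eapply Rle_trans; [apply Cmod_le_ReIm |]. simpl.
set (A := exp x - 1 - 1 * x) in *. set (Bc := cos y - 1 - 0 * y) in *. set (S := sin y - 0 - 1 * y) in *.
assert (EX : exp x = 1 + x + A) by (unfold A; ring).
assert (EC : cos y = 1 + Bc) by (unfold Bc; ring).
assert (ES : sin y = y + S) by (unfold S; ring).
rewrite EX, EC, ES.
replace ((1 + x + A) * (1 + Bc) + - (1) + - (x * 1 - y * 0)) with (A + (1 + x + A) * Bc) by ring.
replace ((1 + x + A) * (y + S) + - 0 + - (x * 0 + y * 1)) with (S + (x + A) * (y + S)) by ring.
assert (A1 : Rabs A <= e * M) by (eapply Rle_trans; [exact Y1 | apply Rmult_le_compat_l; lra]).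
assert (A2 : Rabs Bc <= e * M) by (eapply Rle_trans; [exact Y2 | apply Rmult_le_compat_l; lra]).
assert (A3 : Rabs S <= e * M) by (eapply Rle_trans; [exact Y3 | apply Rmult_le_compat_l; lra]).
clearbody A Bc S M.
assert (e * M <= M) by nra.
assert (L1 : Rabs (A + (1 + x + A) * Bc) <= e * M + 3 * (e * M)).
{ eapply Rle_trans; [apply Rabs_triang |]. apply Rplus_le_compat; auto.
  rewrite Rabs_mult. apply Rmult_le_compat; auto; try apply Rabs_pos.
  eapply Rle_trans; [apply Rabs_triang |].
  eapply Rle_trans; [apply Rplus_le_compat_r, Rabs_triang |]. rewrite Rabs_R1. lra. }
assert (L2 : Rabs (S + (x + A) * (y + S)) <= e * M + 4 * (e * M)).
{ eapply Rle_trans; [apply Rabs_triang |]. apply Rplus_le_compat; auto.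
  rewrite Rabs_mult. replace (4 * (e * M)) with ((2 * e) * (2 * M)) by ring.
  apply Rmult_le_compat; try apply Rabs_pos;
    (eapply Rle_trans; [apply Rabs_triang |]; lra). }
nra.
Qed.

Lemma Cder_Cexp z : Cder Cexp z (Cexp z).
Proof.
apply Cder_ext with (fun y => Cexp z * Cexp (y - z))%C.
- apply filter_forall. intros y. rewrite <- Cexp_plus. f_equal; ring.
- apply Cder_eq with (0 * Cexp (z - z) + Cexp z * (1 * (1 - 0)))%C; [| ring].
  apply (Cder_mult (fun _ => Cexp z) (fun y => Cexp (y - z))); [apply Cder_const |].
  apply (Cder_comp (fun y => y - z)%C Cexp).
  + apply Cder_minus; [apply Cder_id | apply Cder_const].
  + replace (z - z)%C with (RtoC 0) by ring. apply Cder_Cexp_0.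
Qed.

Lemma hol_Cexp U : hol U Cexp.
Proof. exists Cexp. intros z _. split; [| exists (Cexp z)]; apply Cder_Cexp. Qed.

Lemma Cexp_pow z n : (Cexp z ^ n)%C = Cexp (INR n * z).
Proof.
induction n as [| n IH].
- simpl. rewrite <- Cexp_0. f_equal. ring.
- rewrite S_INR, RtoC_plus. simpl Cpow. rewrite IH, <- Cexp_plus. f_equal. ring.
Qed.

Definition circ (r t : R) : C := (RtoC r * Cexp (Ci * RtoC t))%C.

Lemma Cmod_circ r t : 0 <= r -> Cmod (circ r t) = r.
Proof.
intros Hr. unfold circ. rewrite Cmod_mult, Cmod_R, Cmod_Cexp, Rabs_pos_eq by auto.
simpl. replace (0 * t - 1 * 0) with 0 by ring. rewrite exp_0. ring.
Qed.

Lemma circ_periodic r : circ r (2 * PI) = circ r 0.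
Proof.
unfold circ, Cexp. simpl. replace (0 * 0 + 1 * (2 * PI)) with (2 * PI) by ring.
replace (0 * 0 + 1 * 0) with 0 by ring.
replace (0 * (2 * PI) - 1 * 0) with 0 by ring. replace (0 * 0 - 1 * 0) with 0 by ring.
now rewrite cos_2PI, sin_2PI, cos_0, sin_0.
Qed.

Definition contR (G : R -> C) : Prop := forall t, tends (@locally R_UniformSpace t) G (G t).

Definition CInt (G : R -> C) : C :=
  (RInt (fun t => Re (G t)) 0 (2 * PI), RInt (fun t => Im (G t)) 0 (2 * PI)).

Lemma tends_part {T} (F : (T -> Prop) -> Prop) {FF : Filter F} (G : T -> C) l :
  tends F G l -> filterlim (fun x => Re (G x)) F (locally (Re l)) /\
                 filterlim (fun x => Im (G x)) F (locally (Im l)).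
Proof.
intros H. split; apply filterlim_locally; intros [e He]; generalize (H e He);
  apply filter_imp; intros x Hx; eapply Rle_lt_trans; try exact Hx.
- apply (re_le_Cmod (G x - l)).
- apply (im_le_Cmod (G x - l)).
Qed.

Lemma contR_ex_RInt G a b : contR G ->
  ex_RInt (fun t => Re (G t)) a b /\ ex_RInt (fun t => Im (G t)) a b.
Proof.
intros H. split; apply (ex_RInt_continuous (V := R_CompleteNormedModule)); intros t _;
  apply (tends_part _ G (G t) (H t)).
Qed.

Lemma contR_plus F G : contR F -> contR G -> contR (fun t => F t + G t)%C.
Proof. intros HF HG t. apply tends_plus; auto; apply _. Qed.

Lemma contR_mult F G : contR F -> contR G -> contR (fun t => F t * G t)%C.
Proof. intros HF HG t. apply tends_mult; auto; apply _. Qed.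

Lemma contR_const c : contR (fun _ => c).
Proof. intros t. apply tends_const, _. Qed.

Lemma contR_comp F (g : C -> C) : contR F -> (forall t, cont g (F t)) -> contR (fun t => g (F t)).
Proof. intros HF Hg t. apply tends_comp; auto; apply _. Qed.

Lemma tends_fst (s t : R) :
  tends (@locally (prod_UniformSpace R_UniformSpace R_UniformSpace) (s, t)) (fun p => RtoC (fst p)) (RtoC s).
Proof.
intros e He. exists (mkposreal e He). intros [x y] [H1 H2]. simpl in *.
rewrite <- RtoC_minus, Cmod_R. exact H1.
Qed.

Lemma tends_snd (s t : R) :
  tends (@locally (prod_UniformSpace R_UniformSpace R_UniformSpace) (s, t)) (fun p => RtoC (snd p)) (RtoC t).
Proof.
intros e He. exists (mkposreal e He). intros [x y] [H1 H2]. simpl in *.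
rewrite <- RtoC_minus, Cmod_R. exact H2.
Qed.

Lemma contR_RtoC : contR RtoC.
Proof.
intros t e He. exists (mkposreal e He). intros x H. simpl in *.
rewrite <- RtoC_minus, Cmod_R. exact H.
Qed.

Lemma cont_circ_arg (r : R) z : cont (fun u => r * Cexp (Ci * u))%C z.
Proof.
apply (hol_cont (fun _ => True)); [| easy]. apply hol_mult; [apply hol_const |].
apply (hol_comp _ (fun _ => True) (fun u => Ci * u)%C); [| apply hol_Cexp | easy].
apply hol_mult; [apply hol_const | apply hol_id].
Qed.

Lemma contR_circ r : contR (circ r).
Proof.
apply (contR_comp RtoC (fun u => r * Cexp (Ci * u))%C); [apply contR_RtoC |].
intros t. apply cont_circ_arg.
Qed.

Lemma CInt_ext F G : (forall t, F t = G t) -> CInt F = CInt G.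
Proof. intros H. unfold CInt. f_equal; apply RInt_ext; intros t _; now rewrite H. Qed.

Lemma CInt_plus F G : contR F -> contR G -> CInt (fun t => F t + G t)%C = (CInt F + CInt G)%C.
Proof.
intros HF HG. destruct (contR_ex_RInt F 0 (2 * PI) HF), (contR_ex_RInt G 0 (2 * PI) HG).
apply C_ext; simpl.
- apply (RInt_plus (V := R_CompleteNormedModule) (fun t => Re (F t)) (fun t => Re (G t))); auto.
- apply (RInt_plus (V := R_CompleteNormedModule) (fun t => Im (F t)) (fun t => Im (G t))); auto.
Qed.

Lemma CInt_scal c G : contR G -> CInt (fun t => c * G t)%C = (c * CInt G)%C.
Proof.
intros HG. destruct (contR_ex_RInt G 0 (2 * PI) HG) as [H1 H2].
destruct c as [x y]. apply C_ext; simpl.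
- rewrite <- (RInt_scal (V := R_CompleteNormedModule) _ 0 (2 * PI) x) by auto.
  rewrite <- (RInt_scal (V := R_CompleteNormedModule) _ 0 (2 * PI) y) by auto.
  rewrite <- (RInt_minus (V := R_CompleteNormedModule)); [easy | |].
  + apply (ex_RInt_scal (V := R_NormedModule)); auto.
  + apply (ex_RInt_scal (V := R_NormedModule)); auto.
- rewrite <- (RInt_scal (V := R_CompleteNormedModule) _ 0 (2 * PI) x) by auto.
  rewrite <- (RInt_scal (V := R_CompleteNormedModule) _ 0 (2 * PI) y) by auto.
  rewrite <- (RInt_plus (V := R_CompleteNormedModule)); [easy | |].
  + apply (ex_RInt_scal (V := R_NormedModule)); auto.
  + apply (ex_RInt_scal (V := R_NormedModule)); auto.
Qed.

Lemma CInt_const c : CInt (fun _ => c) = (RtoC (2 * PI) * c)%C.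
Proof.
unfold CInt. rewrite !RInt_const. destruct c. unfold Cmult, RtoC. simpl.
unfold scal; simpl; unfold mult; simpl. f_equal; ring.
Qed.

Lemma RInt_abs_le (g : R -> R) M : ex_RInt g 0 (2 * PI) ->
  (forall t, 0 <= t <= 2 * PI -> Rabs (g t) <= M) ->
  Rabs (RInt g 0 (2 * PI)) <= 2 * PI * M.
Proof.
intros H B. assert (P := PI_RGT_0).
replace (2 * PI * M) with ((2 * PI - 0) * M) by ring.
apply (abs_RInt_le_const g 0 (2 * PI) M); auto. lra.
Qed.

(** Bounding the two parts separately costs a factor 2 over the optimal 2 pi M; this is harmless, as
    the bound serves a remainder that tends to 0. *)
Lemma CInt_bound G M : contR G ->
  (forall t, 0 <= t <= 2 * PI -> Cmod (G t) <= M) -> Cmod (CInt G) <= 4 * PI * M.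
Proof.
intros HG B. destruct (contR_ex_RInt G 0 (2 * PI) HG) as [H1 H2].
eapply Rle_trans; [apply Cmod_le_ReIm |].
replace (4 * PI * M) with (2 * PI * M + 2 * PI * M) by ring.
apply Rplus_le_compat; apply RInt_abs_le; auto; intros t Ht; eapply Rle_trans; try apply (B t Ht).
apply re_le_Cmod. apply im_le_Cmod.
Qed.

Lemma CInt_Cder F F' : (forall t : R, Cder F (RtoC t) (F' (RtoC t))) ->
  contR (fun t => F' (RtoC t)) ->
  CInt (fun t => F' (RtoC t)) = (F (RtoC (2 * PI)) - F (RtoC 0))%C.
Proof.
intros H HC.
apply C_ext; simpl.
- apply (is_RInt_unique (V := R_CompleteNormedModule)).
  apply (is_RInt_derive (V := R_CompleteNormedModule) (fun t => Re (F (RtoC t)))).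
  + intros t _. apply Cder_real, H.
  + intros t _. apply (tends_part _ _ _ (HC t)).
- apply (is_RInt_unique (V := R_CompleteNormedModule)).
  apply (is_RInt_derive (V := R_CompleteNormedModule) (fun t => Im (F (RtoC t)))).
  + intros t _. apply Cder_real, H.
  + intros t _. apply (tends_part _ _ _ (HC t)).
Qed.

(** Differentiation under the integral sign. The parameter of [G] is complex so that the rules for
    [Cder] apply, while the derivative is taken along real parameters. *)
Lemma CInt_param (G G' : C -> R -> C) (s d : R) : 0 < d ->
  (forall u : R, Rabs (u - s) < d -> forall t,
     Cder (fun v => G v t) (RtoC u) (G' (RtoC u) t)) ->
  (forall t, tends (@locally (prod_UniformSpace R_UniformSpace R_UniformSpace) (s, t))
     (fun p => G' (RtoC (fst p)) (snd p)) (G' (RtoC s) t)) ->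
  (forall u : R, Rabs (u - s) < d -> contR (G (RtoC u))) ->
  is_derive (fun u => Re (CInt (G (RtoC u)))) s (Re (CInt (G' (RtoC s)))) /\
  is_derive (fun u => Im (CInt (G (RtoC u)))) s (Im (CInt (G' (RtoC s)))).
Proof.
intros Hd HD HT HC.
assert (K : forall p : C -> R,
  (forall u : R, Rabs (u - s) < d -> forall t,
     is_derive (fun v : R => p (G (RtoC v) t)) u (p (G' (RtoC u) t))) ->
  (forall t, filterlim (fun q => p (G' (RtoC (fst q)) (snd q)))
     (@locally (prod_UniformSpace R_UniformSpace R_UniformSpace) (s, t))
     (locally (p (G' (RtoC s) t)))) ->
  (forall u : R, Rabs (u - s) < d -> ex_RInt (fun t => p (G (RtoC u) t)) 0 (2 * PI)) ->
  is_derive (fun u => RInt (fun t => p (G (RtoC u) t)) 0 (2 * PI)) s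
    (RInt (fun t => p (G' (RtoC s) t)) 0 (2 * PI))).
{ intros p P1 P2 P3.
  assert (E : RInt (fun t => p (G' (RtoC s) t)) 0 (2 * PI) =
    RInt (fun t => Derive (fun u => p (G (RtoC u) t)) s) 0 (2 * PI)).
  { apply RInt_ext. intros t _. symmetry. apply is_derive_unique. apply P1.
    replace (s - s) with 0 by ring. rewrite Rabs_R0. lra. }
  rewrite E. apply (is_derive_RInt_param (fun u t => p (G (RtoC u) t))).
  - exists (mkposreal d Hd). intros u Hu t _. eexists. apply P1. exact Hu.
  - intros t _. apply continuity_2d_pt_ext_loc with (fun u v => p (G' (RtoC u) v)).
    + exists (mkposreal d Hd). intros u v Hu _. symmetry. apply is_derive_unique. apply P1.
      exact Hu.
    + apply continuity_2d_pt_filterlim. apply P2.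
  - exists (mkposreal d Hd). intros u Hu. apply P3. exact Hu. }
split; apply K.
- intros u Hu t. apply (Cder_real (fun v => G v t)). now apply HD.
- intros t. apply (tends_part _ _ _ (HT t)).
- intros u Hu. apply (contR_ex_RInt (G (RtoC u)) 0 (2 * PI) (HC u Hu)).
- intros u Hu t. apply (Cder_real (fun v => G v t)). now apply HD.
- intros t. apply (tends_part _ _ _ (HT t)).
- intros u Hu. apply (contR_ex_RInt (G (RtoC u)) 0 (2 * PI) (HC u Hu)).
Qed.

(** * The Cauchy formula and Taylor series *)

Lemma C_neq_Cmod (a b : C) : Cmod b < Cmod a -> (a - b)%C <> 0%C.
Proof. intros H E. apply Csub_0 in E. subst. lra. Qed.

Lemma circ_neq_0 r t : 0 < r -> circ r t <> 0%C.
Proof. intros Hr. apply Cmod_gt_0. rewrite Cmod_circ; lra. Qed.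

Lemma circ_sub_neq_0 r t z : Cmod z < r -> (circ r t - z)%C <> 0%C.
Proof.
intros Hz. assert (P := Cmod_ge_0 z). apply C_neq_Cmod. rewrite Cmod_circ; lra.
Qed.

Lemma contR_kernel r z : Cmod z < r -> contR (fun t => circ r t / (circ r t - z))%C.
Proof.
intros Hz. apply contR_mult; [apply contR_circ |].
apply (contR_comp (fun t => circ r t - z)%C Cinv).
- apply contR_plus; [apply contR_circ | apply contR_const].
- intros t. apply cont_inv. now apply circ_sub_neq_0.
Qed.

Lemma contR_hol h rho r : 0 <= r < rho -> hol (Cdisc rho) h -> contR (fun t => h (circ r t)).
Proof.
intros Hr Hh. apply contR_comp; [apply contR_circ |]. intros t.
apply (hol_cont (Cdisc rho)); auto. unfold Cdisc. rewrite Cmod_circ; lra.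
Qed.

Lemma Cder_circ_arg (r : R) u : Cder (fun u => r * Cexp (Ci * u))%C u (r * (Ci * Cexp (Ci * u)))%C.
Proof.
eapply Cder_eq.
- apply (Cder_mult (fun _ => RtoC r) (fun u => Cexp (Ci * u))); [apply Cder_const |].
  apply (Cder_comp (fun u => Ci * u)%C Cexp); [| apply Cder_Cexp].
  apply (Cder_mult (fun _ => Ci) (fun u => u)); [apply Cder_const | apply Cder_id].
- cbv beta. ring.
Qed.

(* The curve [z + s (zeta - z)] contracts the circle to [z]; since its [s]- and [theta]-derivatives are proportional, the integral does not depend on [s]. *)
Lemma cauchy_formula h rho r z : hol (Cdisc rho) h -> Cmod z < r < rho ->
  CInt (fun t => h (circ r t) * (circ r t / (circ r t - z)))%C =
  (h z * CInt (fun t => circ r t / (circ r t - z)))%C.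
Proof.
intros Hh Hr. assert (Z0 := Cmod_ge_0 z). assert (Hh' := Hh). destruct Hh' as [h' H'].
set (pt := fun (u : C) (t : R) => (z + u * (circ r t - z))%C).
set (G := fun (u : C) (t : R) => (h (pt u t) * (circ r t / (circ r t - z)))%C).
set (G' := fun (u : C) (t : R) => (h' (pt u t) * circ r t)%C).
(* A margin beyond [0,1] for the parameter, so that the integral is differentiable at both ends: the
   contracted circles stay within radius (1 + 2 eta) r = r + (rho - r)/2 < rho. *)
set (eta := (rho - r) / (4 * r)).
assert (He : 0 < eta) by (apply Rdiv_lt_0_compat; lra).
assert (Her : eta * r = (rho - r) / 4) by (unfold eta; field; lra).
assert (Hpt : forall u t, - eta < u < 1 + eta -> Cdisc rho (pt (RtoC u) t)).
{ intros u t Hu. unfold Cdisc, pt.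
  replace (z + u * (circ r t - z))%C with (RtoC (1 - u) * z + RtoC u * circ r t)%C
    by (rewrite RtoC_minus; ring).
  eapply Rle_lt_trans; [apply Cmod_triangle |].
  rewrite !Cmod_mult, !Cmod_R, Cmod_circ by lra.
  assert (B : Rabs (1 - u) + Rabs u <= 1 + 2 * eta) by (unfold Rabs; repeat destruct Rcase_abs; lra).
  assert (Rabs (1 - u) * Cmod z <= Rabs (1 - u) * r)
    by (apply Rmult_le_compat_l; [apply Rabs_pos | lra]).
  assert ((Rabs (1 - u) + Rabs u) * r <= (1 + 2 * eta) * r) by (apply Rmult_le_compat_r; lra).
  nra. }
assert (Cpt : forall u t, Cder (fun v => pt v t) u (circ r t - z)%C).
{ intros u t. eapply Cder_eq.
  - apply (Cder_plus (fun _ => z)); [apply Cder_const |].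
    apply (Cder_mult (fun v => v) (fun _ => circ r t - z)%C); [apply Cder_id | apply Cder_const].
  - ring. }
assert (DG : forall u t, - eta < u < 1 + eta -> Cder (fun v => G v t) (RtoC u) (G' (RtoC u) t)).
{ intros u t Hu. unfold G. eapply Cder_eq.
  - apply (Cder_mult (fun v => h (pt v t)) (fun _ => circ r t / (circ r t - z))%C);
      [| apply Cder_const].
    apply (Cder_comp (fun v => pt v t) h); [apply Cpt |]. apply H'. now apply Hpt.
  - unfold G'. field. apply circ_sub_neq_0; lra. }
assert (CptR : forall u, contR (pt u)).
{ intros u. apply contR_plus; [apply contR_const |].
  apply contR_mult; [apply contR_const |].
  apply contR_plus; [apply contR_circ | apply contR_const]. }
assert (CG : forall u : R, - eta < u < 1 + eta -> contR (G (RtoC u))).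
{ intros u Hu. apply contR_mult; [| apply contR_kernel; lra].
  apply contR_comp; [apply CptR |]. intros t. apply (hol_cont (Cdisc rho)); auto. }
assert (Ch' : forall w, Cdisc rho w -> cont h' w).
{ intros w Hw. destruct (H' w Hw) as [_ [l Hl]]. now apply Cder_cont in Hl. }
assert (DJ : forall u : R, - eta < u < 1 + eta ->
  is_derive (fun u => Re (CInt (G (RtoC u)))) u (Re (CInt (G' (RtoC u)))) /\
  is_derive (fun u => Im (CInt (G (RtoC u)))) u (Im (CInt (G' (RtoC u))))).
{ intros u Hu. set (d := Rmin (u + eta) (1 + eta - u)).
  assert (Hd : 0 < d) by (apply Rmin_glb_lt; lra).
  assert (Hd2 : forall v, Rabs (v - u) < d -> - eta < v < 1 + eta).
  { intros v Hv. assert (V1 := Rlt_le_trans _ _ _ Hv (Rmin_l _ _)).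
    assert (V2 := Rlt_le_trans _ _ _ Hv (Rmin_r _ _)).
    apply Rabs_lt_between in V1. apply Rabs_lt_between in V2. lra. }
  apply (CInt_param G G' u d); auto.
  intros t. apply tends_mult; [apply _ | |].
  - apply (tends_comp _ (fun p : R * R => pt (RtoC (fst p)) (snd p)) (pt (RtoC u) t) h').
    + apply tends_plus; [apply _ | apply tends_const, _ |].
      apply tends_mult; [apply _ | apply tends_fst |].
      apply tends_plus; [apply _ | | apply tends_const, _].
      apply (tends_comp _ (fun p : R * R => RtoC (snd p)) (RtoC t) (fun u => r * Cexp (Ci * u))%C);
        [apply tends_snd | apply cont_circ_arg].
    + apply Ch', Hpt; auto.
  - apply (tends_comp _ (fun p : R * R => RtoC (snd p)) (RtoC t) (fun u => r * Cexp (Ci * u))%C);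
      [apply tends_snd | apply cont_circ_arg]. }
assert (ZJ : forall u : R, 0 < u < 1 + eta -> CInt (G' (RtoC u)) = 0%C).
{ intros u Hu.
  assert (u0 : RtoC u <> 0%C) by (intros E; apply RtoC_inj in E; lra).
  (* A primitive in theta of the s-derivative of the integrand. It is periodic, so the integral of
     that derivative vanishes; dividing by [Ci * u] is why [u = 0] is excluded. *)
  set (F := fun v : C => (h (z + u * (r * Cexp (Ci * v) - z)) * / (Ci * u))%C).
  set (F' := fun v : C => (h' (z + u * (r * Cexp (Ci * v) - z)) * (r * Cexp (Ci * v)))%C).
  assert (Ci0 : Ci <> 0%C) by (apply Cmod_gt_0; rewrite Cmod_Ci; lra).
  transitivity (F (RtoC (2 * PI)) - F (RtoC 0))%C.
  - apply (CInt_Cder F F').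
    + intros t. unfold F. eapply Cder_eq.
      * apply (Cder_mult (fun v => h (z + u * (r * Cexp (Ci * v) - z))%C) (fun _ => / (Ci * u))%C);
          [| apply Cder_const].
        apply (Cder_comp (fun v => z + u * (r * Cexp (Ci * v) - z))%C h).
        -- apply (Cder_plus (fun _ => z)); [apply Cder_const |].
           apply (Cder_mult (fun _ => RtoC u) (fun v => r * Cexp (Ci * v) - z)%C); [apply Cder_const |].
           apply Cder_minus; [apply Cder_circ_arg | apply Cder_const].
        -- apply H'. apply (Hpt u t). lra.
      * unfold F'. field. auto.
    + apply (contR_mult (fun t => h' (pt (RtoC u) t))); [| apply contR_circ].
      apply contR_comp; [apply CptR |]. intros t. apply Ch', Hpt. lra.
  - unfold F. change (r * Cexp (Ci * RtoC (2 * PI)))%C with (circ r (2 * PI)).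
    change (r * Cexp (Ci * RtoC 0))%C with (circ r 0). rewrite circ_periodic. ring. }
assert (E : CInt (G 1) = CInt (G 0)).
{ assert (K : forall p : C -> R, p 0%C = 0 ->
    (forall u : R, - eta < u < 1 + eta ->
      is_derive (fun u => p (CInt (G (RtoC u)))) u (p (CInt (G' (RtoC u))))) ->
    p (CInt (G 1)) = p (CInt (G 0))).
  { intros p p0 Hp.
    (* The derivative is known to vanish only for u > 0. The mean value theorem uses it on the open
       interval and asks only for continuity at the ends. *)
    destruct (MVT_gen (fun u => p (CInt (G (RtoC u)))) 0 1 (fun u => if Rlt_dec 0 u then 0 else 0))
      as [c [_ Hc]].
    - rewrite Rmin_left, Rmax_right by lra. intros x Hx.
      specialize (Hp x ltac:(lra)). rewrite ZJ, p0 in Hp by lra.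
      destruct (Rlt_dec 0 x); exact Hp.
    - rewrite Rmin_left, Rmax_right by lra. intros x Hx. apply continuity_pt_filterlim.
      apply (ex_derive_continuous (fun u => p (CInt (G (RtoC u))))). eexists. apply Hp. lra.
    - destruct (Rlt_dec 0 c); lra. }
  apply C_ext; [apply (K Re) | apply (K Im)]; try reflexivity; intros u Hu; apply (DJ u Hu). }
replace (CInt (fun t => h (circ r t) * (circ r t / (circ r t - z)))%C) with (CInt (G 1)).
- rewrite E. rewrite <- CInt_scal by (apply contR_kernel; lra).
  apply CInt_ext. intros t. unfold G, pt. do 2 f_equal. ring.
- apply CInt_ext. intros t. unfold G, pt. do 2 f_equal. ring.
Qed.

Lemma contR_inv_pow r n : 0 < r -> contR (fun t => / circ r t ^ n)%C.
Proof.
intros Hr. apply (contR_comp (fun t => circ r t ^ n)%C Cinv).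
- apply (contR_comp (circ r) (fun z => z ^ n)%C); [apply contR_circ |]. intros t.
  apply (hol_cont (fun _ => True)); auto. apply (hol_pow _ (fun z => z)), hol_id.
- intros t. apply cont_inv. apply Cpow_nz. now apply circ_neq_0.
Qed.

(** Cauchy's coefficient integral over the circle of radius [r]. That it does not depend on [r]
    follows later from uniqueness of power series. *)
Definition fourier (h : C -> C) (r : R) (n : nat) : C :=
  (/ RtoC (2 * PI) * CInt (fun t => h (circ r t) * / circ r t ^ n))%C.

(** Geometric expansion of the Cauchy kernel: after n terms the remainder is the same integral with
    the extra factor (z / zeta)^n, and |z| < r sends it to 0. *)
Lemma kernel_series h rho r z : hol (Cdisc rho) h -> Cmod z < r < rho ->
  ser (fun n => RtoC (2 * PI) * fourier h r n * z ^ n)%C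
    (CInt (fun t => h (circ r t) * (circ r t / (circ r t - z)))%C).
Proof.
intros Hh Hr. assert (Z0 := Cmod_ge_0 z).
assert (Ch := contR_hol h rho r ltac:(lra) Hh).
assert (P2 : RtoC (2 * PI) <> 0%C).
{ intros E; apply RtoC_inj in E. generalize PI_RGT_0; lra. }
assert (CK := contR_mult _ _ Ch (contR_kernel r z ltac:(lra))).
assert (CR : forall n, contR (fun t => (z ^ n * / circ r t ^ n)
  * (h (circ r t) * (circ r t / (circ r t - z))))%C).
{ intros n. apply contR_mult; auto. apply contR_mult; [apply contR_const |].
  apply contR_inv_pow; lra. }
assert (REM : forall n, CInt (fun t => h (circ r t) * (circ r t / (circ r t - z)))%C =
  (psum (fun n => RtoC (2 * PI) * fourier h r n * z ^ n) n +
   CInt (fun t => (z ^ n * / circ r t ^ n) * (h (circ r t) * (circ r t / (circ r t - z)))))%C).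
{ induction n as [| n IH].
  - simpl. rewrite Cplus_0_l. apply CInt_ext. intros t. field. apply circ_sub_neq_0; lra.
  - rewrite IH. simpl psum. rewrite <- Cplus_assoc. f_equal. unfold fourier.
    replace (RtoC (2 * PI) * (/ RtoC (2 * PI) * CInt (fun t => h (circ r t) * / circ r t ^ n)) * z ^ n)%C
      with (z ^ n * CInt (fun t => h (circ r t) * / circ r t ^ n))%C by (field; auto).
    rewrite <- CInt_scal by (apply contR_mult; auto; apply contR_inv_pow; lra).
    rewrite <- CInt_plus.
    + apply CInt_ext. intros t. simpl.
      assert (N1 := circ_neq_0 r t ltac:(lra)). assert (N2 := circ_sub_neq_0 r t z ltac:(lra)).
      assert (N3 := Cpow_nz _ n N1). field. auto.
    + apply contR_mult; [apply contR_const |]. apply contR_mult; auto. apply contR_inv_pow; lra.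
    + apply CR. }
assert (BD : exists M, 0 < M /\ forall t, 0 <= t <= 2 * PI ->
  Cmod (h (circ r t) * (circ r t / (circ r t - z))) <= M).
{ assert (Cm : forall t, continuity_pt (fun t => Cmod (h (circ r t) * (circ r t / (circ r t - z)))%C) t).
  { intros t eps He. destruct (CK t eps He) as [[d Hd] H]. exists d. split; auto.
    intros x [_ Hx]. simpl. unfold R_dist. eapply Rle_lt_trans; [| apply (H x Hx)].
    apply Rabs_le_between. split; [| apply Cmod_tri_inv].
    rewrite Cmod_sub_sym. generalize (Cmod_tri_inv (h (circ r t) * (circ r t / (circ r t - z)))
     (h (circ r x) * (circ r x / (circ r x - z)))). lra. }
  destruct (continuity_ab_maj (fun t => Cmod (h (circ r t) * (circ r t / (circ r t - z)))%C) 0 (2 * PI))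
    as [t0 [Ht0 _]].
  - generalize PI_RGT_0; lra.
  - auto.
  - exists (Cmod (h (circ r t0) * (circ r t0 / (circ r t0 - z)))%C + 1). split.
    + generalize (Cmod_ge_0 (h (circ r t0) * (circ r t0 / (circ r t0 - z)))%C); lra.
    + intros t Ht. specialize (Ht0 t Ht). lra. }
destruct BD as [M [HM BD]].
set (q := Cmod z / r).
assert (Hq : 0 <= q < 1).
{ unfold q. split; [apply Rdiv_le_0_compat; lra |].
  apply Rmult_lt_reg_r with r; [lra |]. unfold Rdiv. rewrite Rmult_assoc, Rinv_l; lra. }
intros eps He.
destruct (pow_lt_1_zero q ltac:(rewrite Rabs_pos_eq; lra) (eps / (4 * PI * M))) as [N HN].
{ apply Rdiv_lt_0_compat; auto. generalize PI_RGT_0; nra. }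
exists N. intros n Hn. rewrite (REM n).
match goal with |- Cmod (?a - (?a + ?b)) < _ => replace (a - (a + b))%C with (- b)%C by ring end.
rewrite Cmod_opp.
apply Rle_lt_trans with (4 * PI * (q ^ n * M)).
- apply CInt_bound; auto. intros t Ht.
  assert (N1 := circ_neq_0 r t ltac:(lra)).
  rewrite Cmod_mult, Cmod_mult, Cmod_inv, !Cmod_pow, Cmod_circ by (try apply Cpow_nz; auto; lra).
  apply Rmult_le_compat; auto; try apply Cmod_ge_0.
  + apply Rmult_le_pos; [apply pow_le; lra |]. left. apply Rinv_0_lt_compat, pow_lt; lra.
  + right. unfold q, Rdiv. rewrite Rpow_mult_distr, pow_inv. ring.
- specialize (HN n Hn). rewrite Rabs_pos_eq in HN by (apply pow_le; lra).
  assert (P := PI_RGT_0).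
  replace eps with (4 * PI * (eps / (4 * PI * M) * M)) by (field; lra).
  apply Rmult_lt_compat_l; [lra |]. apply Rmult_lt_compat_r; auto.
Qed.

(** The Cauchy formula turns the kernel series into the Taylor series once the integral of the
    kernel is known to be 2 pi; that value is obtained from the kernel series of the constant 1. *)
Lemma hol_series_r h rho r z : hol (Cdisc rho) h -> Cmod z < r < rho ->
  ser (fun n => fourier h r n * z ^ n)%C (h z).
Proof.
intros Hh Hr. assert (P := PI_RGT_0).
assert (P2 : RtoC (2 * PI) <> 0%C) by (intros E; apply RtoC_inj in E; lra).
assert (one : CInt (fun t => 1 * (circ r t / (circ r t - z)))%C = RtoC (2 * PI)).
{ assert (S1 := kernel_series (fun _ => 1%C) rho r z (hol_const _ _) Hr).
  cbv beta in S1. apply (ser_unique _ _ _ S1).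
  assert (C0 : fourier (fun _ => 1%C) r 0 = 1%C).
  { unfold fourier. replace (CInt (fun t => 1 * / circ r t ^ 0)%C) with (RtoC (2 * PI)).
    - field; auto.
    - rewrite (CInt_ext _ (fun _ => 1%C)).
      + rewrite CInt_const. ring.
      + intros t. simpl. field. }
  assert (Cn : forall n, fourier (fun _ => 1%C) r (S n) = 0%C).
  { intros n. unfold fourier.
    (* On the circle 1 / zeta^(n+1) is a multiple of exp (k t), whose primitive is 2 pi periodic
       because [k] is a nonzero integer multiple of i. *)
    set (k := (- (Ci * INR (S n)))%C).
    assert (k0 : k <> 0%C).
    { unfold k. apply Cmod_gt_0. rewrite Cmod_opp, Cmod_mult, Cmod_Ci, Cmod_R.
      rewrite Rmult_1_l. apply Rabs_pos_lt. apply not_0_INR; lia. }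
    assert (E : forall t, (1 * / circ r t ^ S n)%C = (/ (r ^ S n) * Cexp (k * t))%C).
    { intros t. unfold circ. rewrite Cpow_mult_l, Cexp_pow.
      replace (k * t)%C with (- (INR (S n) * (Ci * t)))%C by (unfold k; ring).
      rewrite Cexp_opp. assert (X := Cexp_neq_0 (INR (S n) * (Ci * t))%C).
      assert (Y : RtoC r <> 0%C) by (intros E; apply RtoC_inj in E; generalize (Cmod_ge_0 z); lra).
      assert (Y2 := Cpow_nz _ (S n) Y). field. auto. }
    rewrite (CInt_ext _ _ E).
    assert (CE : contR (fun t : R => Cexp (k * t))).
    { apply (contR_comp RtoC (fun u => Cexp (k * u))); [apply contR_RtoC |]. intros t.
      apply (hol_cont (fun _ => True)); auto.
      apply (hol_comp _ (fun _ => True) (fun u => k * u)%C); [| apply hol_Cexp | easy].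
      apply hol_mult; [apply hol_const | apply hol_id]. }
    rewrite CInt_scal by auto.
    replace (CInt (fun t : R => Cexp (k * t))) with (RtoC 0); [ring |].
    rewrite (CInt_Cder (fun u => / k * Cexp (k * u))%C (fun u => Cexp (k * u))); auto.
    - replace (Cexp (k * RtoC (2 * PI))) with (Cexp (k * RtoC 0)); [ring |].
      replace (k * 0)%C with (- (INR (S n) * (Ci * 0)))%C by (unfold k; ring).
      replace (k * RtoC (2 * PI))%C with (- (INR (S n) * (Ci * RtoC (2 * PI))))%C by (unfold k; ring).
      rewrite !Cexp_opp, <- !Cexp_pow.
      assert (Q := circ_periodic 1). unfold circ in Q. rewrite !Cmult_1_l in Q. now rewrite Q.
    - intros t. eapply Cder_eq.
      + apply (Cder_mult (fun _ => / k)%C (fun u => Cexp (k * u))); [apply Cder_const |].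
        apply (Cder_comp (fun u => k * u)%C Cexp); [| apply Cder_Cexp].
        apply (Cder_mult (fun _ => k) (fun u => u)); [apply Cder_const | apply Cder_id].
      + cbv beta. field. auto. }
  intros eps He. exists 1%nat. intros n Hn.
  replace (psum (fun n => RtoC (2 * PI) * fourier (fun _ => 1%C) r n * z ^ n)%C n) with (RtoC (2 * PI)).
  - replace (RtoC (2 * PI) - RtoC (2 * PI))%C with (RtoC 0) by ring. now rewrite Cmod_0.
  - destruct n as [| n]; [lia |]. clear Hn. induction n as [| n IH].
    + simpl. rewrite C0. ring.
    + change (psum (fun n => RtoC (2 * PI) * fourier (fun _ => 1%C) r n * z ^ n)%C (S (S n)))
      with (psum (fun n => RtoC (2 * PI) * fourier (fun _ => 1%C) r n * z ^ n)%C (S n)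
         + RtoC (2 * PI) * fourier (fun _ => 1%C) r (S n) * z ^ (S n))%C.
      rewrite <- IH, Cn. ring. }
assert (SH := kernel_series h rho r z Hh Hr).
rewrite (cauchy_formula h rho) in SH by auto.
rewrite (CInt_ext _ (fun t => 1 * (circ r t / (circ r t - z)))%C) in SH.
2:{ intros t. field. apply circ_sub_neq_0. lra. }
rewrite one in SH. apply (ser_scal (/ RtoC (2 * PI))) in SH.
replace (/ RtoC (2 * PI) * (h z * RtoC (2 * PI)))%C with (h z) in SH by (field; auto).
revert SH. apply ser_ext. intros n. field. auto.
Qed.

(** Coefficients computed on the single radius rho / 2 serve all of the disc, because the series for
    any two radii agree near 0. The integral formula for every radius is what the Bessel argument
    uses. *)
Theorem hol_pseries h rho : 0 < rho -> hol (Cdisc rho) h ->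
  exists a : nat -> C,
    (forall z, Cmod z < rho -> ser (fun n => a n * z ^ n)%C (h z)) /\
    (forall r n, 0 < r < rho ->
       CInt (fun t => h (circ r t) * / circ r t ^ n)%C = (RtoC (2 * PI) * a n)%C).
Proof.
intros Hrho Hh. exists (fourier h (rho / 2)).
assert (U : forall r n, 0 < r < rho -> fourier h r n = fourier h (rho / 2) n).
{ intros r n Hr.
  assert (Hm : 0 < Rmin r (rho / 2)) by (apply Rmin_glb_lt; lra).
  assert (M1 := Rmin_l r (rho / 2)). assert (M2 := Rmin_r r (rho / 2)).
  apply (pseries_unique _ _ h _ Hm); intros z Hz; apply (hol_series_r h rho); auto; lra. }
split.
- intros z Hz. assert (Z0 := Cmod_ge_0 z).
  apply ser_ext with (fun n => fourier h ((Cmod z + rho) / 2) n * z ^ n)%C.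
  + intros n. rewrite U by lra. reflexivity.
  + apply (hol_series_r h rho); auto. lra.
- intros r n Hr. rewrite <- (U r n Hr). unfold fourier.
  assert (P2 : RtoC (2 * PI) <> 0%C).
  { intros E; apply RtoC_inj in E. generalize PI_RGT_0; lra. }
  field. auto.
Qed.

(** * Third-order expansions and the Toeplitz contraction *)

Definition bdd (f : C -> C) : Prop := exists M, near 0 (fun z => Cmod (f z) <= M).

Lemma bdd_const c : bdd (fun _ => c).
Proof. exists (Cmod c). apply filter_forall. intros; lra. Qed.

Lemma bdd_plus f g : bdd f -> bdd g -> bdd (fun z => f z + g z)%C.
Proof.
intros [M HM] [N HN]. exists (M + N). generalize (filter_and _ _ HM HN).
apply filter_imp. intros z [H1 H2]. eapply Rle_trans; [apply Cmod_triangle | lra].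
Qed.

Lemma bdd_mult f g : bdd f -> bdd g -> bdd (fun z => f z * g z)%C.
Proof.
intros [M HM] [N HN]. exists (M * N). generalize (filter_and _ _ HM HN).
apply filter_imp. intros z [H1 H2]. rewrite Cmod_mult.
apply Rmult_le_compat; auto; apply Cmod_ge_0.
Qed.

Lemma near_self z (P : C -> Prop) : near z P -> P z.
Proof.
intros [d [Hd H]]. apply H. replace (z - z)%C with (RtoC 0) by ring. now rewrite Cmod_0.
Qed.

Lemma bdd_cont f : cont f 0 -> bdd f.
Proof.
intros H. exists (Cmod (f 0) + 1). generalize (H 1 Rlt_0_1). apply filter_imp.
intros z Hz. generalize (Cmod_tri_inv (f z) (f 0)). lra.
Qed.

Lemma bdd_id : bdd (fun z => z).
Proof. apply bdd_cont, cont_id. Qed.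

(** The remainder factor is only locally bounded, with no regularity, so sums, products and
    compositions reduce to ring identities and boundedness. *)
Definition jet (f : C -> C) (a0 a1 a2 a3 : C) : Prop :=
  exists e, bdd e /\
    near 0 (fun z => f z = a0 + a1 * z + a2 * z ^ 2 + a3 * z ^ 3 + z ^ 4 * e z)%C.

Lemma jet_ext f g a0 a1 a2 a3 : near 0 (fun z => f z = g z) ->
  jet f a0 a1 a2 a3 -> jet g a0 a1 a2 a3.
Proof.
intros E [e [He H]]. exists e. split; auto. generalize (filter_and _ _ E H).
apply filter_imp. intros z [H1 H2]. congruence.
Qed.

Lemma jet_coef f a0 a1 a2 a3 b0 b1 b2 b3 : jet f a0 a1 a2 a3 ->
  a0 = b0 -> a1 = b1 -> a2 = b2 -> a3 = b3 -> jet f b0 b1 b2 b3.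
Proof. intros; subst; auto. Qed.

Lemma jet_const c : jet (fun _ => c) c 0 0 0.
Proof.
exists (fun _ => 0%C). split; [apply bdd_const |]. apply filter_forall. intros; simpl; ring.
Qed.

Lemma jet_id : jet (fun z => z) 0 1 0 0.
Proof.
exists (fun _ => 0%C). split; [apply bdd_const |]. apply filter_forall. intros; simpl; ring.
Qed.

Lemma jet_plus f g a0 a1 a2 a3 b0 b1 b2 b3 : jet f a0 a1 a2 a3 -> jet g b0 b1 b2 b3 ->
  jet (fun z => f z + g z)%C (a0 + b0) (a1 + b1) (a2 + b2) (a3 + b3).
Proof.
intros [e [He H]] [d [Hd G]]. exists (fun z => e z + d z)%C.
split; [now apply bdd_plus |]. generalize (filter_and _ _ H G).
apply filter_imp. intros z [-> ->]. ring.
Qed.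

Lemma bdd_ext f g : near 0 (fun z => f z = g z) -> bdd f -> bdd g.
Proof.
intros E [M H]. exists M. generalize (filter_and _ _ E H). apply filter_imp.
intros z [<- H2]. exact H2.
Qed.

Lemma jet_bdd f a0 a1 a2 a3 : jet f a0 a1 a2 a3 -> bdd f.
Proof.
intros [e [He H]].
apply bdd_ext with (fun z => a0 + a1 * z + a2 * (z * z) + a3 * (z * (z * z)) + z * (z * (z * z)) * e z)%C.
- revert H. apply filter_imp. intros z ->. simpl; ring.
- repeat (apply bdd_plus || apply bdd_mult || apply bdd_const || apply bdd_id || exact He).
Qed.

Lemma jet_mult f g a0 a1 a2 a3 b0 b1 b2 b3 : jet f a0 a1 a2 a3 -> jet g b0 b1 b2 b3 ->
  jet (fun z => f z * g z)%C (a0 * b0) (a0 * b1 + a1 * b0) (a0 * b2 + a1 * b1 + a2 * b0)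
    (a0 * b3 + a1 * b2 + a2 * b1 + a3 * b0).
Proof.
intros Hf Hg. assert (Bg := jet_bdd _ _ _ _ _ Hg). destruct Hf as [e [He H]], Hg as [d [Hd G]].
(* Everything of order at least four in the product: the remainder of [f] times all of [g], and for
   each a_i the part of [g] from order 4 - i on. *)
exists (fun z => e z * g z + a0 * d z + a1 * (z * d z + b3) + a2 * (b2 + b3 * z + z * (z * d z))
  + a3 * (b1 + b2 * z + b3 * (z * z) + z * (z * (z * d z))))%C.
split.
- repeat (apply bdd_plus || apply bdd_mult || apply bdd_const || apply bdd_id || assumption).
- generalize (filter_and _ _ H G). apply filter_imp. intros z [E1 E2].
  rewrite E1. rewrite E2 at 1 2. simpl. ring [E2].
Qed.

Lemma jet_tends f a0 a1 a2 a3 : jet f a0 a1 a2 a3 -> tends (near 0) f a0.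
Proof.
intros H. destruct H as [e [[M HM] H]].
assert (Q : bdd (fun z => a1 + a2 * z + a3 * (z * z) + z * (z * z) * e z)%C).
{ repeat (apply bdd_plus || apply bdd_mult || apply bdd_const || apply bdd_id).
  now exists M. }
destruct Q as [K HK]. intros eps He.
assert (HS : near 0 (fun z => Cmod z < eps / (1 + Rabs K))).
{ exists (eps / (1 + Rabs K)). split.
  - apply Rdiv_lt_0_compat; auto. generalize (Rabs_pos K); lra.
  - intros y. now replace (y - 0)%C with y by ring. }
generalize (filter_and _ _ (filter_and _ _ H HK) HS). apply filter_imp.
intros z [[E1 E2] E3].
replace (f z - a0)%C with (z * (a1 + a2 * z + a3 * (z * z) + z * (z * z) * e z))%C
  by (rewrite E1; simpl; ring).
rewrite Cmod_mult. assert (P := Rabs_pos K). assert (P2 := Rle_abs K).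
apply Rle_lt_trans with (Cmod z * (1 + Rabs K)).
- apply Rmult_le_compat_l; [apply Cmod_ge_0 | lra].
- apply Rlt_le_trans with (eps / (1 + Rabs K) * (1 + Rabs K)).
  + apply Rmult_lt_compat_r; lra.
  + right; field; lra.
Qed.

(** The inner function has no constant term, so [u = z v] with [v] bounded and u^4 e(u) = z^4 v^4
    e(u); as [u] tends to 0, the factor e(u) stays bounded. *)
Lemma jet_comp f u a0 a1 a2 a3 u1 u2 u3 : jet f a0 a1 a2 a3 -> jet u 0 u1 u2 u3 ->
  jet (fun z => f (u z)) a0 (a1 * u1) (a1 * u2 + a2 * u1 ^ 2)
    (a1 * u3 + 2 * a2 * u1 * u2 + a3 * u1 ^ 3).
Proof.
intros Hf Hu. assert (Tu := jet_tends _ _ _ _ _ Hu).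
assert (U2 := jet_mult _ _ _ _ _ _ _ _ _ _ Hu Hu).
assert (U3 := jet_mult _ _ _ _ _ _ _ _ _ _ Hu U2).
destruct Hf as [e [[M HM] H]].
destruct HM as [d1 [D1 HM]]. destruct H as [d2 [D2 H]].
assert (Hv : exists v, bdd v /\ near 0 (fun z => u z = z * v z)%C).
{ destruct Hu as [eu [Heu Hu]]. exists (fun z => u1 + u2 * z + u3 * (z * z) + z * (z * z) * eu z)%C.
  split.
  - repeat (apply bdd_plus || apply bdd_mult || apply bdd_const || apply bdd_id || assumption).
  - revert Hu. apply filter_imp. intros z ->. simpl; ring. }
destruct Hv as [v [Bv Ev]].
assert (R : jet (fun z => u z ^ 4 * e (u z))%C 0 0 0 0).
{ exists (fun z => v z * v z * (v z * v z) * e (u z))%C. split.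
  - repeat (apply bdd_mult || assumption).
    exists M. generalize (Tu d1 D1). apply filter_imp. intros z Hz. now apply HM.
  - revert Ev. apply filter_imp. intros z ->. simpl; ring. }
assert (J := jet_plus _ _ _ _ _ _ _ _ _ _ (jet_plus _ _ _ _ _ _ _ _ _ _
  (jet_plus _ _ _ _ _ _ _ _ _ _ (jet_plus _ _ _ _ _ _ _ _ _ _ (jet_const a0)
   (jet_mult _ _ _ _ _ _ _ _ _ _ (jet_const a1) Hu))
   (jet_mult _ _ _ _ _ _ _ _ _ _ (jet_const a2) U2))
   (jet_mult _ _ _ _ _ _ _ _ _ _ (jet_const a3) U3)) R).
apply jet_ext with (2 := jet_coef _ _ _ _ _ a0 (a1 * u1) (a1 * u2 + a2 * u1 ^ 2)
    (a1 * u3 + 2 * a2 * u1 * u2 + a3 * u1 ^ 3) J ltac:(ring) ltac:(ring) ltac:(simpl; ring) ltac:(simpl; ring)).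
generalize (Tu d2 D2). apply filter_imp. intros z Hz. rewrite (H (u z) Hz). simpl; ring.
Qed.

Lemma C_small_0 (c : C) K d : 0 < d -> (forall t, 0 < t < d -> Cmod c <= K * t) -> c = 0%C.
Proof.
intros Hd H. apply Cmod_eq_0. apply Rle_antisym; [| apply Cmod_ge_0].
apply Rnot_lt_le. intros P.
assert (PK := Rabs_pos K). assert (PK2 := Rle_abs K).
set (t := Rmin (d / 2) (Cmod c / (2 * (1 + Rabs K)))).
assert (T0 : 0 < t) by (apply Rmin_glb_lt; [lra | apply Rdiv_lt_0_compat; lra]).
assert (T1 : t <= d / 2) by apply Rmin_l.
assert (T2 : t <= Cmod c / (2 * (1 + Rabs K))) by apply Rmin_r.
specialize (H t ltac:(lra)).
assert ((1 + Rabs K) * t <= Cmod c / 2).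
{ apply Rle_trans with ((1 + Rabs K) * (Cmod c / (2 * (1 + Rabs K)))).
  - apply Rmult_le_compat_l; lra.
  - right; field; lra. }
nra.
Qed.

Lemma jet_zero a0 a1 a2 a3 : jet (fun _ => 0%C) a0 a1 a2 a3 ->
  a0 = 0%C /\ a1 = 0%C /\ a2 = 0%C /\ a3 = 0%C.
Proof.
(* Coefficients are peeled off by dividing by powers of [z], which leaves the identity valid only
   off the origin. *)
assert (base : forall f b, bdd f -> near 0 (fun z => z <> RtoC 0 -> RtoC 0 = (b + z * f z)%C) -> b = 0%C).
{ intros f b [M HM] H. destruct (filter_and _ _ HM H) as [d [Hd K]].
  apply (C_small_0 b M d Hd). intros t Ht.
  assert (Ct : Cmod (RtoC t) = t) by (rewrite Cmod_R, Rabs_pos_eq; lra).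
  destruct (K (RtoC t)) as [K1 K2].
  { replace (t - 0)%C with (RtoC t) by ring. lra. }
  assert (E : b = (- (t * f t))%C).
  { replace b with (b + t * f t - t * f t)%C by ring. rewrite <- K2; [ring |].
    intros E; apply RtoC_inj in E; lra. }
  rewrite E, Cmod_opp, Cmod_mult, Ct, Rmult_comm. apply Rmult_le_compat_r; lra. }
intros [e [He H]].
assert (A0 : a0 = 0%C).
{ apply (base (fun z => a1 + a2 * z + a3 * (z * z) + z * (z * z) * e z)%C).
  - repeat (apply bdd_plus || apply bdd_mult || apply bdd_const || apply bdd_id || assumption).
  - revert H. apply filter_imp. intros z E _. rewrite E. simpl; ring. }
assert (A1 : a1 = 0%C).
{ apply (base (fun z => a2 + a3 * z + (z * z) * e z)%C).
  - repeat (apply bdd_plus || apply bdd_mult || apply bdd_const || apply bdd_id || assumption).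
  - revert H. apply filter_imp. intros z E n. subst a0.
    replace (RtoC 0) with (/ z * 0)%C by ring. rewrite E. simpl; field; auto. }
assert (A2 : a2 = 0%C).
{ apply (base (fun z => a3 + z * e z)%C).
  - repeat (apply bdd_plus || apply bdd_mult || apply bdd_const || apply bdd_id || assumption).
  - revert H. apply filter_imp. intros z E n. subst a0 a1.
    replace (RtoC 0) with (/ (z * z) * 0)%C by ring. rewrite E. simpl; field; auto. }
assert (A3 : a3 = 0%C).
{ apply (base e); auto.
  revert H. apply filter_imp. intros z E n. subst a0 a1 a2.
  replace (RtoC 0) with (/ (z * (z * z)) * 0)%C by ring. rewrite E. simpl; field; auto. }
auto.
Qed.

Lemma jet_unique f a0 a1 a2 a3 b0 b1 b2 b3 : jet f a0 a1 a2 a3 -> jet f b0 b1 b2 b3 ->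
  a0 = b0 /\ a1 = b1 /\ a2 = b2 /\ a3 = b3.
Proof.
intros Ha Hb.
assert (J := jet_plus _ _ _ _ _ _ _ _ _ _ Ha
   (jet_mult _ _ _ _ _ _ _ _ _ _ (jet_const (-1)) Hb)).
apply (jet_ext _ (fun _ => 0%C)) in J.
2:{ apply filter_forall. intros; ring. }
apply jet_zero in J. destruct J as [E0 [E1 [E2 E3]]].
repeat split; apply Csub_0; [rewrite <- E0 | rewrite <- E1 | rewrite <- E2 | rewrite <- E3]; ring.
Qed.

Lemma jet_series a f R0 : 0 < R0 ->
  (forall z, Cmod z < R0 -> ser (fun n => a n * z ^ n)%C (f z)) ->
  jet f (a 0%nat) (a 1%nat) (a 2%nat) (a 3%nat).
Proof.
intros HR H.
destruct (pseries_coef_bound a (R0 / 2) (f (RtoC (R0 / 2))) ltac:(lra)) as [K [HK B]].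
{ apply H. rewrite Cmod_R, Rabs_pos_eq; lra. }
exists (fun z => if Ceq_dec z 0 then RtoC 0 else
  (f z - psum (fun n => a n * z ^ n) 4) / z ^ 4)%C.
split.
- exists (2 * K / (R0 / 2) ^ 4). exists (R0 / 4). split; [lra |]. intros z Hz.
  replace (z - 0)%C with z in Hz by ring.
  destruct (Ceq_dec z 0) as [-> | n].
  + rewrite Cmod_0. apply Rdiv_le_0_compat; [lra | apply pow_lt; lra].
  + assert (T := pseries_tail a (R0 / 2) K z (f z) 4 ltac:(lra) B ltac:(lra) (H z ltac:(lra))).
    assert (Z : 0 < Cmod z) by (apply Cmod_gt_0; exact n).
    rewrite Cmod_div by now apply Cpow_nz. rewrite Cmod_pow.
    apply Rmult_le_reg_r with (Cmod z ^ 4); [apply pow_lt; lra |].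
    unfold Rdiv at 1. rewrite Rmult_assoc, Rinv_l by (apply pow_nonzero; lra).
    rewrite Rmult_1_r. eapply Rle_trans; [exact T |]. right. field. lra.
- exists R0. split; auto. intros z Hz. replace (z - 0)%C with z in Hz by ring.
  destruct (Ceq_dec z 0) as [-> | n].
  + assert (S0 := H 0%C). rewrite Cmod_0 in S0. specialize (S0 HR).
    rewrite (ser_unique _ _ _ S0 (ser_at_0 a)). simpl. ring.
  + simpl. field. auto.
Qed.

Definition Cpoly (b0 b1 b2 b3 z : C) : C := (b0 + b1 * z + b2 * z ^ 2 + b3 * z ^ 3)%C.

Lemma jet_Cpoly b0 b1 b2 b3 : jet (Cpoly b0 b1 b2 b3) b0 b1 b2 b3.
Proof.
exists (fun _ => 0%C). split; [apply bdd_const |]. apply filter_forall.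
intros; unfold Cpoly; simpl; ring.
Qed.

Lemma hol_Cpoly U b0 b1 b2 b3 : hol U (Cpoly b0 b1 b2 b3).
Proof.
unfold Cpoly. repeat (apply hol_plus || apply hol_mult || apply hol_const || apply hol_id || apply hol_pow).
Qed.

(** On the circle conj zeta = r^2 / zeta, so the conjugated polynomial is a combination of powers of
    1 / zeta and each term gives a Taylor coefficient of [h]. *)
Lemma circ_inner h rho r a0 a1 a2 a3 b0 b1 b2 b3 : 0 < r < rho -> hol (Cdisc rho) h ->
  jet h a0 a1 a2 a3 ->
  CInt (fun t => h (circ r t) * Cconj (Cpoly b0 b1 b2 b3 (circ r t)))%C =
  (RtoC (2 * PI) * (a0 * Cconj b0 + a1 * Cconj b1 * RtoC (r ^ 2) + a2 * Cconj b2 * RtoC (r ^ 4)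
     + a3 * Cconj b3 * RtoC (r ^ 6)))%C.
Proof.
intros Hr Hh J. destruct (hol_pseries h rho ltac:(lra) Hh) as [a [Ha Ia]].
destruct (jet_unique _ _ _ _ _ _ _ _ _ J (jet_series a h rho ltac:(lra) Ha)) as [E0 [E1 [E2 E3]]].
rewrite E0, E1, E2, E3. clear J E0 E1 E2 E3 a0 a1 a2 a3.
assert (Ch := contR_hol h rho r ltac:(lra) Hh).
set (G := fun n t => (h (circ r t) * / circ r t ^ n)%C).
assert (CG : forall n, contR (G n)) by (intros n; apply contR_mult; auto; apply contR_inv_pow; lra).
rewrite (CInt_ext _ (fun t => Cconj b0 * G 0%nat t + RtoC (r ^ 2) * Cconj b1 * G 1%nat t
  + RtoC (r ^ 4) * Cconj b2 * G 2%nat t + RtoC (r ^ 6) * Cconj b3 * G 3%nat t)%C).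
- assert (CS : forall c n, contR (fun t => c * G n t)%C)
    by (intros; apply contR_mult; auto; apply contR_const).
  rewrite !CInt_plus, !CInt_scal; auto; try (repeat apply contR_plus; auto; fail).
  unfold G. rewrite !Ia by lra. ring.
- intros t. unfold G, Cpoly. rewrite !Cplus_conj, !Cmult_conj, !Cpow_conj.
  assert (N := circ_neq_0 r t ltac:(lra)).
  assert (E : Cconj (circ r t) = (RtoC (r ^ 2) / circ r t)%C).
  { assert (M := Cmod2_conj (circ r t)). rewrite Cmod_circ in M by lra.
    rewrite M. field; auto. }
  rewrite E. replace (RtoC (r ^ 4)) with (RtoC (r ^ 2) * RtoC (r ^ 2))%C
    by (rewrite <- RtoC_mult; f_equal; ring).
  replace (RtoC (r ^ 6)) with (RtoC (r ^ 2) * RtoC (r ^ 2) * RtoC (r ^ 2))%C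
    by (rewrite <- !RtoC_mult; f_equal; ring).
  simpl. field. auto.
Qed.

(* The lower triangular Toeplitz matrix of the coefficients of a bounded function is a contraction: Bessel's inequality for [w p] on circles of radius [r < 1]. *)
Lemma toeplitz_contraction w c1 c2 c3 p0 p1 p2 : hol (Cdisc 1) w ->
  (forall z, Cmod z < 1 -> Cmod (w z) <= 1) -> jet w 0 c1 c2 c3 ->
  Cmod (c1 * p0) ^ 2 + Cmod (c2 * p0 + c1 * p1) ^ 2 + Cmod (c3 * p0 + c2 * p1 + c1 * p2) ^ 2
  <= Cmod p0 ^ 2 + Cmod p1 ^ 2 + Cmod p2 ^ 2.
Proof.
intros Hw Bw Jw.
set (p := Cpoly p0 p1 p2 0).
set (b1 := (c1 * p0)%C). set (b2 := (c2 * p0 + c1 * p1)%C). set (b3 := (c3 * p0 + c2 * p1 + c1 * p2)%C).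
set (Q := Cpoly 0 b1 b2 b3). set (h := fun z => (w z * p z)%C).
assert (Hh : hol (Cdisc 1) h) by (apply hol_mult; [exact Hw | apply hol_Cpoly]).
assert (Jh : jet h 0 b1 b2 b3).
{ eapply jet_coef; [apply (jet_mult _ _ _ _ _ _ _ _ _ _ Jw (jet_Cpoly p0 p1 p2 0)) | | | |];
  unfold b1, b2, b3; ring. }
assert (main : forall r, 0 < r < 1 ->
  Cmod b1 ^ 2 * r ^ 2 + Cmod b2 ^ 2 * r ^ 4 + Cmod b3 ^ 2 * r ^ 6
  <= Cmod p0 ^ 2 + Cmod p1 ^ 2 * r ^ 2 + Cmod p2 ^ 2 * r ^ 4).
{ intros r Hr.
  assert (I1 := circ_inner p 1 r _ _ _ _ p0 p1 p2 0 Hr (hol_Cpoly _ _ _ _ _) (jet_Cpoly p0 p1 p2 0)).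
  assert (I2 := circ_inner h 1 r _ _ _ _ 0 b1 b2 b3 Hr Hh Jh).
  assert (I3 := circ_inner Q 1 r _ _ _ _ 0 b1 b2 b3 Hr (hol_Cpoly _ _ _ _ _) (jet_Cpoly 0 b1 b2 b3)).
  assert (Cc : forall F, contR F -> contR (fun t => Cconj (F t))).
  { intros F HF t eps He. generalize (HF t eps He). apply filter_imp. intros x.
    now rewrite <- Cminus_conj, Cmod_conj. }
  assert (CP : contR (fun t => p (circ r t))) by (apply (contR_hol _ 1); [lra | apply hol_Cpoly]).
  assert (CQ : contR (fun t => Q (circ r t))) by (apply (contR_hol _ 1); [lra | apply hol_Cpoly]).
  assert (CH : contR (fun t => h (circ r t))) by (apply (contR_hol _ 1); [lra | exact Hh]).
  set (F1 := fun t => (p (circ r t) * Cconj (p (circ r t)))%C).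
  set (F2 := fun t => (h (circ r t) * Cconj (Q (circ r t)))%C).
  set (F3 := fun t => (Q (circ r t) * Cconj (Q (circ r t)))%C).
  assert (C1 : contR F1) by (apply contR_mult; auto).
  assert (C2 : contR F2) by (apply contR_mult; auto).
  assert (C3 : contR F3) by (apply contR_mult; auto).
  (* Pointwise |p|^2 - 2 Re (h conj Q) + |Q|^2 >= |h - Q|^2 >= 0, because |h| <= |p|. As [Q] is the
     Taylor polynomial of [h], the integrals of h conj Q and |Q|^2 agree, which leaves that of |Q|^2
     at most that of |p|^2. *)
  assert (I : 0 <= Re (CInt (fun t => F1 t + (-2) * F2 t + F3 t)%C)).
  { unfold CInt. simpl fst. apply RInt_ge_0.
    - generalize PI_RGT_0; lra.
    - apply (contR_ex_RInt (fun t => F1 t + (-2) * F2 t + F3 t)%C).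
      repeat apply contR_plus; auto. apply contR_mult; auto. apply contR_const.
    - intros t _. unfold F1, F2, F3, h.
      assert (W := Bw (circ r t) ltac:(rewrite Cmod_circ; lra)).
      set (W0 := w (circ r t)) in *. set (P0 := p (circ r t)). set (Q0 := Q (circ r t)).
      assert (N1 : Cmod (W0 * P0 - Q0) ^ 2 >= 0) by (apply Rle_ge, pow2_ge_0).
      assert (N2 : Cmod (W0 * P0) ^ 2 <= Cmod P0 ^ 2).
      { rewrite Cmod_mult, Rpow_mult_distr. assert (V := Cmod_ge_0 W0).
        assert (Cmod W0 ^ 2 <= 1) by nra. generalize (pow2_ge_0 (Cmod P0)). nra. }
      rewrite Cmod2_alt in N1. rewrite (Cmod2_alt (W0 * P0)), (Cmod2_alt P0) in N2.
      destruct (W0 * P0)%C as [x y], P0 as [u v], Q0 as [s q]. simpl in *. nra. }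
  rewrite !CInt_plus, CInt_scal in I; auto; try (repeat apply contR_plus; auto);
    try (apply contR_mult; auto; apply contR_const).
  unfold F1, F2, F3 in I. unfold p at 2, Q at 1 3 in I. rewrite I1, I2, I3 in I.
  assert (E : forall x : C, (x * Cconj x)%C = RtoC (Cmod x ^ 2)) by (intros; now rewrite <- Cmod2_conj).
  rewrite !E in I.
  replace (RtoC 0 * Cconj 0)%C with (RtoC 0) in I by ring.
  rewrite Cmod_0 in I. rewrite <- !RtoC_mult, <- !RtoC_plus, <- !RtoC_mult, <- ?RtoC_plus in I.
  simpl Re in I. assert (PP := PI_RGT_0). nra. }
assert (X1 := Cmod_ge_0 b1). assert (X2 := Cmod_ge_0 b2). assert (X3 := Cmod_ge_0 b3).
set (X := Cmod b1 ^ 2 + Cmod b2 ^ 2 + Cmod b3 ^ 2).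
set (Y := Cmod p0 ^ 2 + Cmod p1 ^ 2 + Cmod p2 ^ 2).
assert (HX : 0 <= X) by (unfold X; generalize (pow2_ge_0 (Cmod b1)) (pow2_ge_0 (Cmod b2)) (pow2_ge_0 (Cmod b3)); lra).
(* All powers of [r] on the left are at least r^6, those on the right at most 1; it remains to let
   [r] tend to 1. *)
assert (K : forall r, 0 < r < 1 -> r ^ 6 * X <= Y).
{ intros r Hr. specialize (main r Hr).
  assert (r2 : 0 < r ^ 2 <= 1) by (split; [apply pow_lt | ]; nra).
  replace (r ^ 6) with (r ^ 2 * r ^ 2 * r ^ 2) in * by ring.
  replace (r ^ 4) with (r ^ 2 * r ^ 2) in * by ring.
  set (s := r ^ 2) in *. unfold X, Y.
  generalize (pow2_ge_0 (Cmod b1)) (pow2_ge_0 (Cmod b2)) (pow2_ge_0 (Cmod b3))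
    (pow2_ge_0 (Cmod p0)) (pow2_ge_0 (Cmod p1)) (pow2_ge_0 (Cmod p2)). intros.
  assert (s * s <= 1) by nra. assert (s * s * s <= s) by nra. assert (s * s * s <= s * s) by nra.
  nra. }
apply Rnot_lt_le. intros L.
assert (HX2 : 0 < X) by (assert (0 <= Y) by (generalize (K (1/2) ltac:(lra)); nra); lra).
(* By Bernoulli (1 - d)^6 >= 1 - 6 d, so the radius 1 - d loses at most half of the gap X - Y. *)
set (d := Rmin (1 / 2) ((X - Y) / (12 * X))).
assert (D0 : 0 < d) by (apply Rmin_glb_lt; [lra | apply Rdiv_lt_0_compat; unfold X, Y in *; lra]).
assert (D1 : d <= 1 / 2) by apply Rmin_l.
assert (D2 : d <= (X - Y) / (12 * X)) by apply Rmin_r.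
specialize (K (1 - d) ltac:(lra)).
assert (B : 1 - 6 * d <= (1 - d) ^ 6).
{ assert (B2 : 1 - 2 * d <= (1 - d) ^ 2) by nra.
  assert (B3 : 1 - 3 * d <= (1 - d) ^ 3) by (simpl; nra).
  replace ((1 - d) ^ 6) with ((1 - d) ^ 3 * (1 - d) ^ 3) by ring.
  assert (0 <= (1 - d) ^ 3) by (apply pow_le; lra).
  assert ((1 - d) ^ 3 <= 1) by (rewrite <- (pow1 3); apply pow_incr; lra). nra. }
assert (12 * X * d <= X - Y).
{ apply Rle_trans with (12 * X * ((X - Y) / (12 * X))).
  - apply Rmult_le_compat_l; lra.
  - right; field; lra. }
assert (Y < X) by (unfold X, Y; exact L). nra.
Qed.

(** * Coefficient inequalities *)

Definition contraction (c1 c2 c3 : C) : Prop := forall p0 p1 p2,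
  Cmod (c1 * p0) ^ 2 + Cmod (c2 * p0 + c1 * p1) ^ 2 + Cmod (c3 * p0 + c2 * p1 + c1 * p2) ^ 2
  <= Cmod p0 ^ 2 + Cmod p1 ^ 2 + Cmod p2 ^ 2.

Lemma le_of_sq_le a b : 0 <= b -> a ^ 2 <= b ^ 2 -> a <= b.
Proof. intros. apply Rnot_lt_le. intros L. nra. Qed.

(** The identity behind the invariance of the disc under Möbius maps. It evaluates the difference
    between the middle entry of the test vector and that of its image. *)
Lemma conj_cross (c x s : C) :
  Cmod (Cconj c * x + s) ^ 2 - Cmod (x + c * s) ^ 2 = (1 - Cmod c ^ 2) * (Cmod s ^ 2 - Cmod x ^ 2).
Proof.
rewrite !Cmod2_alt. destruct c, x, s. simpl. ring.
Qed.

(* Both bounds come from testing the contraction on the vectors that make its Schur complements appear. *)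
Lemma contraction_schur c1 c2 c3 : contraction c1 c2 c3 ->
  let d := 1 - Cmod c1 ^ 2 in
  0 <= d /\ Cmod c2 <= d /\
  Cmod (d * c3 + Cconj c1 * c2 ^ 2) <= d ^ 2 - Cmod c2 ^ 2.
Proof.
intros H d.
assert (N1 := Cmod_ge_0 c1). assert (N2 := Cmod_ge_0 c2). assert (N3 := Cmod_ge_0 c3).
assert (H1 := H 1%C 0%C 0%C).
replace (c1 * 1)%C with c1 in H1 by ring. replace (c2 * 1 + c1 * 0)%C with c2 in H1 by ring.
replace (c3 * 1 + c2 * 0 + c1 * 0)%C with c3 in H1 by ring.
rewrite Cmod_0, Cmod_1 in H1.
assert (d0 : 0 <= d) by (unfold d; nra). split; auto.
destruct (Req_dec d 0) as [Z | Z].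
{ assert (c2 = 0%C) by (apply Cmod_eq_0; unfold d in Z; nra).
  assert (c3 = 0%C) by (apply Cmod_eq_0; unfold d in Z; nra).
  subst c2 c3. rewrite Z. replace (0 * 0 + Cconj c1 * 0 ^ 2)%C with (RtoC 0) by (simpl; ring).
  rewrite Cmod_0. split; [lra | simpl; lra]. }
assert (dp : 0 < d) by lra.
assert (dC : RtoC d <> 0%C) by (intros E; apply RtoC_inj in E; lra).
assert (pC : (c1 * Cconj c1)%C = (1 - RtoC d)%C).
{ rewrite <- Cmod2_conj. unfold d. rewrite RtoC_minus. ring. }
set (Delta := (d * c3 + Cconj c1 * c2 ^ 2)%C).
assert (F : forall a s : C, Cmod (Delta * a + c2 * s) ^ 2 <=
  d ^ 2 * ((d ^ 2 - Cmod c2 ^ 2) * Cmod a ^ 2 + Cmod s ^ 2)).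
{ intros a s. set (E := (Delta * a + c2 * s)%C).
  (* The third entry minimises |p2|^2 - |E + c1 p2|^2 and makes the third image entry [E / d]; the
     first two make the contribution of [c3] and [c2] exactly [E]. *)
  assert (T := H (d * a)%C (Cconj c1 * (c2 * a) + s)%C (Cconj c1 * E / d)%C).
  replace (c2 * (d * a) + c1 * (Cconj c1 * (c2 * a) + s))%C with (c2 * a + c1 * s)%C in T.
  2:{ replace (c1 * (Cconj c1 * (c2 * a) + s))%C with ((c1 * Cconj c1) * (c2 * a) + c1 * s)%C by ring.
      rewrite pC. ring. }
  replace (c3 * (d * a) + c2 * (Cconj c1 * (c2 * a) + s) + c1 * (Cconj c1 * E / d))%C with (E / d)%C in T.
  2:{ replace (c3 * (d * a) + c2 * (Cconj c1 * (c2 * a) + s))%C with E by (unfold E, Delta; simpl; ring).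
      replace (c1 * (Cconj c1 * E / d))%C with ((c1 * Cconj c1) * (E / d))%C by (field; auto).
      rewrite pC. field; auto. }
  assert (X := conj_cross c1 (c2 * a) s). fold d in X.
  rewrite !Cmod_div, !Cmod_mult, !Cmod_R, Cmod_conj, (Rabs_pos_eq d) in T by auto.
  rewrite (Cmod_mult c2 a) in X.
  set (e := Cmod E) in *. set (q := Cmod c2) in *. set (al := Cmod a) in *. set (si := Cmod s) in *.
  assert (P : Cmod c1 ^ 2 = 1 - d) by (unfold d; ring).
  assert (Y : d * ((e / d) ^ 2) <= d ^ 2 * (d * al ^ 2) + d * (si ^ 2 - (q * al) ^ 2)).
  { replace ((Cmod c1 * e / d) ^ 2) with (Cmod c1 ^ 2 * (e / d) ^ 2) in T by (field; lra).
    replace ((Cmod c1 * (d * al)) ^ 2) with (Cmod c1 ^ 2 * (d * al) ^ 2) in T by ring.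
    rewrite P in T. clearbody e q al si. clear - T X. nra. }
  apply Rmult_le_reg_l with (/ d); [now apply Rinv_0_lt_compat |].
  replace (/ d * e ^ 2) with (d * (e / d) ^ 2) by (field; lra).
  replace (/ d * (d ^ 2 * ((d ^ 2 - q ^ 2) * al ^ 2 + si ^ 2)))
    with (d ^ 2 * (d * al ^ 2) + d * (si ^ 2 - (q * al) ^ 2)) by (field; lra).
  exact Y. }
set (g := d ^ 2 - Cmod c2 ^ 2) in *.
assert (g0 : 0 <= g).
{ assert (T := F 1%C 0%C). rewrite Cmod_0, Cmod_1 in T.
  assert (0 <= d ^ 2 * g); [| apply Rmult_le_reg_l with (d ^ 2); [nra | lra]].
  generalize (pow2_ge_0 (Cmod (Delta * 1 + c2 * 0))). nra. }
split; [apply le_of_sq_le; [lra | unfold g in g0; lra] |].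
apply le_of_sq_le; auto.
destruct (Req_dec g 0) as [Zg | Zg].
- assert (T := F 1%C 0%C). rewrite Cmod_0, Cmod_1, Zg in T.
  replace (Delta * 1 + c2 * 0)%C with Delta in T by ring. rewrite Zg. lra.
(* For this choice [Delta * a + c2 * s] collapses to d^2 Delta, since |c2|^2 = d^2 - g, and [F]
   reduces to g |Delta|^2 <= g^3. This says nothing when g = 0, hence the separate case. *)
- assert (T := F (RtoC g) (Delta * Cconj c2)%C).
  replace (Delta * g + c2 * (Delta * Cconj c2))%C with (RtoC (d ^ 2) * Delta)%C in T.
  2:{ replace (c2 * (Delta * Cconj c2))%C with ((c2 * Cconj c2) * Delta)%C by ring.
      rewrite <- Cmod2_conj. replace (d ^ 2) with (g + Cmod c2 ^ 2) by (unfold g; ring).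
      rewrite RtoC_plus. ring. }
  rewrite !Cmod_mult, Cmod_conj, !Cmod_R, (Rabs_pos_eq g), (Rabs_pos_eq (d ^ 2)) in T by (auto; nra).
  set (D2 := Cmod Delta ^ 2).
  assert (T2 : d ^ 2 * (g * (g ^ 2 - D2)) >= 0).
  { unfold D2. replace (Cmod c2 ^ 2) with (d ^ 2 - g) in T by (unfold g; ring).
    replace ((Cmod Delta * Cmod c2) ^ 2) with (Cmod Delta ^ 2 * Cmod c2 ^ 2) in T by ring.
    replace (Cmod c2 ^ 2) with (d ^ 2 - g) in T by (unfold g; ring).
    assert (T3 : d ^ 2 * (d ^ 2 * Cmod Delta ^ 2) <= d ^ 2 * (g * g ^ 2 + Cmod Delta ^ 2 * (d ^ 2 - g)))
      by (eapply Rle_trans; [right | exact T]; ring).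
    nra. }
  assert (0 < d ^ 2 * g) by (apply Rmult_lt_0_compat; [nra | lra]).
  apply Rnot_lt_le. intros L. nra.
Qed.

(** The bound |c2| <= 1 - |c1|^2 leaves room for mu |c1|^2. *)
Lemma fekete_szego_bound c1 c2 c3 mu : contraction c1 c2 c3 -> 0 <= mu <= 1 ->
  Cmod (c2 - RtoC mu * c1 ^ 2) <= 1.
Proof.
intros H Hmu. destruct (contraction_schur _ _ _ H) as [d0 [d1 _]].
eapply Rle_trans; [apply Cmod_tri_sub |].
rewrite Cmod_mult, Cmod_pow, Cmod_R, Rabs_pos_eq by lra.
generalize (pow2_ge_0 (Cmod c1)). nra.
Qed.

(** Multiplied by d = 1 - |c1|^2, the expression is the Schur term, at most d^2 - |c2|^2, minus [V].
    It suffices that |V| <= d |c1|^2 + |c2|^2, because d^2 + d |c1|^2 = d. *)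
Lemma third_coef_bound c1 c2 c3 m n : contraction c1 c2 c3 -> 0 < n <= 1 -> m ^ 2 <= 4 * n ->
  Cmod (c3 - RtoC m * c1 * c2 + RtoC n * c1 ^ 3) <= 1.
Proof.
intros H Hn Hm. destruct (contraction_schur _ _ _ H) as [d0 [d1 d2]].
set (d := 1 - Cmod c1 ^ 2) in *.
assert (N1 := Cmod_ge_0 c1). assert (N2 := Cmod_ge_0 c2). assert (N3 := Cmod_ge_0 c3).
destruct (Req_dec d 0) as [Z | Z].
{ assert (c2 = 0%C) by (apply Cmod_eq_0; lra).
  assert (c3 = 0%C).
  { apply Cmod_eq_0. assert (T := H 1%C 0%C 0%C).
    replace (c1 * 1)%C with c1 in T by ring. replace (c2 * 1 + c1 * 0)%C with c2 in T by ring.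
    replace (c3 * 1 + c2 * 0 + c1 * 0)%C with c3 in T by ring.
    rewrite Cmod_0, Cmod_1 in T. unfold d in Z. nra. }
  subst c2 c3. replace (0 - m * c1 * 0 + n * c1 ^ 3)%C with (n * c1 ^ 3)%C by ring.
  rewrite Cmod_mult, Cmod_pow, Cmod_R, Rabs_pos_eq by lra.
  assert (Cmod c1 = 1) by (unfold d in Z; nra). rewrite H0. lra. }
assert (dp : 0 < d) by lra.
set (V := (Cconj c1 * c2 ^ 2 + RtoC m * RtoC d * c1 * c2 - RtoC n * RtoC d * c1 ^ 3)%C).
set (p := Cmod c1 ^ 2) in *. set (q := Cmod c2 ^ 2) in *.
assert (p0 : 0 <= p) by apply pow2_ge_0. assert (q0 : 0 <= q) by apply pow2_ge_0.
assert (HV : Cmod V <= d * p + q).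
{ apply le_of_sq_le; [nra |].
  set (Rr := Re (c2 * Cconj c1 ^ 2)%C).
  (* |V|^2 depends on the arguments of c1 and c2 only through [Rr], and the factor 4 n completes the
     square in it. The rest is nonnegative: m^2 <= 4 n gives 4 n p + d m^2 <= 4 n (p + d) = 4 n, and
     n <= 1 gives q + n d p <= q + d p. *)
  assert (I : 4 * n * ((d * p + q) ^ 2 - Cmod V ^ 2) =
    d * (4 * n * Rr + m * (n * d * p - q)) ^ 2 + 4 * n * (d * p + q) ^ 2
    - (4 * n * p + d * m ^ 2) * (q + n * d * p) ^ 2).
  { clearbody d. unfold p, q, Rr, V. rewrite !Cmod2_alt. destruct c1, c2. simpl. ring. }
  assert (J : (4 * n * p + d * m ^ 2) * (q + n * d * p) ^ 2 <= 4 * n * (d * p + q) ^ 2).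
  { apply Rmult_le_compat.
    - assert (0 <= d * m ^ 2) by (apply Rmult_le_pos; [lra | apply pow2_ge_0]). nra.
    - apply pow2_ge_0.
    - assert (d * m ^ 2 <= d * (4 * n)) by (apply Rmult_le_compat_l; lra).
      assert (E : 4 * n = 4 * n * p + d * (4 * n)) by (unfold d; ring). lra.
    - apply pow_incr. assert (0 <= d * p) by nra. split; nra. }
  assert (S := Rmult_le_pos _ _ d0 (pow2_ge_0 (4 * n * Rr + m * (n * d * p - q)))).
  assert (0 <= 4 * n * ((d * p + q) ^ 2 - Cmod V ^ 2)) by lra.
  assert (0 <= (d * p + q) ^ 2 - Cmod V ^ 2) by (apply Rmult_le_reg_l with (4 * n); lra). lra. }
apply Rmult_le_reg_l with d; auto.
replace d with (Cmod (RtoC d)) at 1 by (rewrite Cmod_R, Rabs_pos_eq; lra).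
rewrite <- Cmod_mult.
replace (d * (c3 - m * c1 * c2 + n * c1 ^ 3))%C with ((d * c3 + Cconj c1 * c2 ^ 2) - V)%C
  by (unfold V; ring).
eapply Rle_trans; [apply Cmod_tri_sub |].
replace (d * 1) with ((d ^ 2 - q) + (d * p + q)) by (unfold d; ring).
lra.
Qed.

(** * Logarithm, square root and arcsine *)

Lemma polar_Carg (z : C) : z <> 0%C -> cos (Carg z) = Re z / Cmod z /\ sin (Carg z) = Im z / Cmod z.
Proof.
intros Hz. assert (M : 0 < Cmod z) by (apply Cmod_gt_0; exact Hz).
set (t := Re z / Cmod z).
assert (T : t ^ 2 + (Im z / Cmod z) ^ 2 = 1).
{ unfold t. replace ((Re z / Cmod z) ^ 2 + (Im z / Cmod z) ^ 2)
    with ((Re z ^ 2 + Im z ^ 2) / Cmod z ^ 2) by (field; lra).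
  rewrite <- Cmod2_alt. field; lra. }
assert (B : -1 <= t <= 1) by (generalize (pow2_ge_0 (Im z / Cmod z)); nra).
assert (S : sin (acos t) = Rabs (Im z) / Cmod z).
{ rewrite sin_acos by auto.
  replace (1 - t²) with ((Rabs (Im z) / Cmod z) ^ 2).
  - apply sqrt_pow2. apply Rdiv_le_0_compat; auto. apply Rabs_pos.
  - replace ((Rabs (Im z) / Cmod z) ^ 2) with (Rabs (Im z) ^ 2 / Cmod z ^ 2) by (field; lra).
    rewrite <- (pow2_abs (Im z / Cmod z)) in T.
    unfold Rdiv in T. rewrite Rabs_mult, (Rabs_pos_eq (/ Cmod z)) in T
      by (left; now apply Rinv_0_lt_compat).
    unfold Rsqr. unfold Rdiv. replace (/ Cmod z ^ 2) with (/ Cmod z * / Cmod z) by (field; lra). nra. }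
unfold Carg. fold t. destruct (Rle_dec 0 (Im z)) as [P | P].
- rewrite cos_acos by auto. rewrite S, Rabs_pos_eq by auto. auto.
- rewrite cos_neg, sin_neg, cos_acos by auto. rewrite S, Rabs_left by lra. split; auto. field; lra.
Qed.

Lemma Carg_bound z : Rabs (Carg z) <= PI.
Proof.
unfold Carg. assert (B := acos_bound (Re z / Cmod z)). assert (P := PI_RGT_0).
destruct (Rle_dec 0 (Im z)); apply Rabs_le; lra.
Qed.

(** On the right half-plane the argument is an arctangent, hence continuous. Continuity of the
    logarithm and of the square root is needed only there. *)
Lemma Carg_right (z : C) : 0 < Re z -> - (PI / 2) < Carg z < PI / 2 /\ Carg z = atan (Im z / Re z).
Proof.
intros Hz.
assert (z0 : z <> 0%C) by (intros ->; simpl in Hz; lra).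
assert (M : 0 < Cmod z) by (apply Cmod_gt_0; exact z0).
destruct (polar_Carg z z0) as [C S]. assert (B := Carg_bound z). apply Rabs_le_between in B.
assert (cp : 0 < cos (Carg z)) by (rewrite C; now apply Rdiv_lt_0_compat).
assert (P := PI_RGT_0).
assert (B2 : - (PI / 2) < Carg z < PI / 2).
{ split; apply Rnot_le_lt; intros L.
  - rewrite <- cos_neg in cp. generalize (cos_le_0 (- Carg z) ltac:(lra) ltac:(lra)). lra.
  - generalize (cos_le_0 (Carg z) ltac:(lra) ltac:(lra)). lra. }
split; auto. rewrite <- (atan_tan (Carg z)) by lra. f_equal. unfold tan. rewrite S, C. field. lra.
Qed.

Lemma Cexp_Clog (z : C) : z <> 0%C -> Cexp (Clog z) = z.
Proof.
intros Hz. assert (M : 0 < Cmod z) by (apply Cmod_gt_0; exact Hz).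
destruct (polar_Carg z Hz) as [C S].
unfold Clog, Cexp. simpl. rewrite exp_ln, C, S by auto.
apply C_ext; simpl; field; lra.
Qed.

Definition right_half (z : C) : Prop := 0 < Re z.

Lemma right_half_near z : right_half z -> near z right_half.
Proof.
intros H. exists (Re z). split; [exact H |]. intros y Hy. unfold right_half in *.
assert (Q := re_le_Cmod (y - z)).
replace (Re (y - z)) with (Re y - Re z) in Q by (destruct y, z; reflexivity).
apply Rabs_le_between in Q. lra.
Qed.

Lemma tends_of_parts (f : C -> C) z :
  filterlim (fun y => Re (f y)) (near z) (locally (Re (f z))) ->
  filterlim (fun y => Im (f y)) (near z) (locally (Im (f z))) -> cont f z.
Proof.
intros H1 H2 eps He.
assert (He2 : 0 < eps / 2) by lra.
assert (K1 := proj1 (filterlim_locally _ _) H1 (mkposreal _ He2)).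
assert (K2 := proj1 (filterlim_locally _ _) H2 (mkposreal _ He2)).
generalize (filter_and _ _ K1 K2). apply filter_imp. intros y [B1 B2].
eapply Rle_lt_trans; [apply Cmod_le_ReIm |].
change (Rabs (Re (f y) - Re (f z)) < eps / 2) in B1.
change (Rabs (Im (f y) - Im (f z)) < eps / 2) in B2.
replace (Re (f y - f z)) with (Re (f y) - Re (f z)) by (destruct (f y), (f z); reflexivity).
replace (Im (f y - f z)) with (Im (f y) - Im (f z)) by (destruct (f y), (f z); reflexivity).
lra.
Qed.

Lemma cont_Clog z : right_half z -> cont Clog z.
Proof.
intros Hz. unfold right_half in Hz.
assert (z0 : z <> 0%C) by (intros ->; simpl in Hz; lra).
assert (M : 0 < Cmod z) by (apply Cmod_gt_0; exact z0).
assert (Cm : filterlim Cmod (near z) (locally (Cmod z))).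
{ apply filterlim_locally. intros eps. exists eps. split; [apply cond_pos |].
  intros y Hy. change (Rabs (Cmod y - Cmod z) < eps).
  eapply Rle_lt_trans; [| exact Hy]. apply Rabs_le_between. split; [| apply Cmod_tri_inv].
  rewrite Cmod_sub_sym. generalize (Cmod_tri_inv z y). lra. }
destruct (tends_part (near z) (fun y => y) z (cont_id z)) as [Cr Ci'].
apply tends_of_parts; unfold Clog; simpl.
- eapply filterlim_comp; [exact Cm |]. apply (continuous_ln _ M).
- apply (filterlim_ext_loc (fun y => atan (Im y / Re y))).
  + generalize (right_half_near z Hz). apply filter_imp. intros y Hy. symmetry. now apply Carg_right.
  + rewrite (proj2 (Carg_right z Hz)).
    apply (filterlim_comp _ _ _ (fun y => Im y / Re y) atan _ (locally (Im z / Re z))).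
    * unfold Rdiv. apply (filterlim_comp_2 (G := locally (Im z)) (H := locally (/ Re z))
        (fun y => Im y) (fun y => / Re y) Rmult); [exact Ci' | |].
      -- eapply filterlim_comp; [exact Cr |]. apply (continuous_Rinv (Re z)); lra.
      -- apply (filterlim_mult (K := R_AbsRing) (Im z) (/ Re z)).
    * apply (ex_derive_continuous atan). eexists. apply is_derive_Reals, derivable_pt_lim_atan.
Qed.

Lemma Cder_Clog z : right_half z -> Cder Clog z (/ z)%C.
Proof.
intros Hz.
assert (N : forall y, right_half y -> y <> 0%C) by (intros y Hy ->; unfold right_half in Hy; simpl in Hy; lra).
apply (Cder_inverse Cexp); auto.
- now apply cont_Clog.
- generalize (right_half_near z Hz). apply filter_imp. intros y Hy. apply Cexp_Clog; auto.
- apply Cder_eq with (Cexp (Clog z)); [apply Cder_Cexp | apply Cexp_Clog; auto].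
Qed.

Lemma hol_Clog : hol right_half Clog.
Proof.
exists Cinv. intros z Hz. split; [now apply Cder_Clog |].
eexists. apply Cder_inv. intros ->. unfold right_half in Hz. simpl in Hz. lra.
Qed.

Lemma Csqrt_exp (z : C) : z <> 0%C -> Csqrt z = Cexp (Clog z * RtoC (/ 2)).
Proof.
intros Hz. assert (M : 0 < Cmod z) by (apply Cmod_gt_0; exact Hz).
unfold Csqrt, Clog, Cexp. simpl.
replace (ln (Cmod z) * / 2 - Carg z * 0) with (ln (Cmod z) / 2) by (unfold Rdiv; ring).
replace (ln (Cmod z) * 0 + Carg z * / 2) with (Carg z / 2) by (unfold Rdiv; ring).
replace (exp (ln (Cmod z) / 2)) with (sqrt (Cmod z)).
- apply C_ext; simpl; ring.
- apply sqrt_lem_1; [lra | left; apply exp_pos |].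
  rewrite <- exp_plus. replace (ln (Cmod z) / 2 + ln (Cmod z) / 2) with (ln (Cmod z)) by lra.
  now apply exp_ln.
Qed.

Lemma Csqrt_sq (z : C) : (Csqrt z * Csqrt z)%C = z.
Proof.
destruct (Ceq_dec z 0) as [-> | n].
- unfold Csqrt. rewrite Cmod_0, sqrt_0. ring.
- rewrite Csqrt_exp by auto. rewrite <- Cexp_plus.
  replace (Clog z * RtoC (/ 2) + Clog z * RtoC (/ 2))%C with (Clog z).
  + now apply Cexp_Clog.
  + apply C_ext; simpl; field.
Qed.

Lemma Cmod_Csqrt (z : C) : Cmod (Csqrt z) ^ 2 = Cmod z.
Proof. rewrite <- (Csqrt_sq z) at 2. rewrite Cmod_mult. ring. Qed.

Lemma Re_Csqrt z : right_half z -> 0 < Re (Csqrt z).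
Proof.
intros Hz. assert (z0 : z <> 0%C) by (intros ->; unfold right_half in Hz; simpl in Hz; lra).
assert (M : 0 < Cmod z) by (apply Cmod_gt_0; exact z0).
unfold Csqrt. simpl. rewrite Rmult_0_l, Rminus_0_r. apply Rmult_lt_0_compat.
- now apply sqrt_lt_R0.
- destruct (Carg_right z Hz) as [B _]. apply cos_gt_0; lra.
Qed.

Lemma hol_Csqrt : hol right_half Csqrt.
Proof.
apply hol_ext with (fun z => Cexp (Clog z * RtoC (/ 2))).
- exact right_half_near.
- intros z Hz. symmetry. apply Csqrt_exp. intros ->. unfold right_half in Hz; simpl in Hz; lra.
- apply (hol_comp _ (fun _ => True) (fun z => Clog z * RtoC (/ 2))%C); [| apply hol_Cexp | easy].
  apply hol_mult; [apply hol_Clog | apply hol_const].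
Qed.

Lemma Cder_Csqrt z : right_half z -> Cder Csqrt z (/ (2 * Csqrt z))%C.
Proof.
intros Hz. assert (z0 : z <> 0%C) by (intros ->; unfold right_half in Hz; simpl in Hz; lra).
assert (s0 : Csqrt z <> 0%C).
{ intros E. generalize (Re_Csqrt z Hz). rewrite E. simpl. lra. }
apply (Cder_inverse (fun y => y * y)%C Csqrt).
- apply (hol_cont right_half); auto. apply hol_Csqrt.
- apply filter_forall. intros; apply Csqrt_sq.
- eapply Cder_eq; [apply Cder_mult; apply Cder_id | cbv beta; ring].
- apply Cmult_neq_0; auto. intros E; apply RtoC_inj in E; lra.
Qed.

Definition csin (u : C) : C := ((Cexp (Ci * u) - Cexp (- (Ci * u))) / (2 * Ci))%C.

Lemma Ci_neq_0 : Ci <> 0%C.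
Proof. apply Cmod_gt_0. rewrite Cmod_Ci. lra. Qed.

Lemma Ci_sq : (Ci * Ci)%C = (- (1))%C.
Proof. apply C_ext; simpl; ring. Qed.

Lemma hol_csin U : hol U csin.
Proof.
assert (E : hol U (fun u => Cexp (Ci * u))).
{ apply (hol_comp _ (fun _ => True) (fun u => Ci * u)%C); [| apply hol_Cexp | easy].
  apply hol_mult; [apply hol_const | apply hol_id]. }
assert (E2 : hol U (fun u => Cexp (- (Ci * u)))).
{ apply (hol_comp _ (fun _ => True) (fun u => - (Ci * u))%C); [| apply hol_Cexp | easy].
  destruct (hol_mult U (fun _ => (- Ci)%C) (fun u => u) (hol_const _ _) (hol_id _)) as [f' H].
  exists f'. intros z Hz. destruct (H z Hz) as [H1 H2]. split; auto.
  apply Cder_ext with (2 := H1). apply filter_forall. intros; ring. }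
unfold csin. apply hol_mult; [| apply hol_const].
destruct (hol_plus _ _ _ E (hol_mult _ _ _ (hol_const _ (-1)) E2)) as [f' H].
exists f'. intros z Hz. destruct (H z Hz) as [H1 H2]. split; auto.
apply Cder_ext with (2 := H1). apply filter_forall. intros; ring.
Qed.

Definition arcsin_base (z : C) : C := (Ci * z + Csqrt (1 - z * z))%C.

(** The two factors are exp (i arcsin z) and exp (-i arcsin z). *)
Lemma arcsin_base_inv z : (arcsin_base z * (Csqrt (1 - z * z) - Ci * z))%C = 1%C.
Proof.
unfold arcsin_base. set (s := Csqrt (1 - z * z)).
replace ((Ci * z + s) * (s - Ci * z))%C with (s * s - (Ci * Ci) * (z * z))%C by ring.
rewrite Ci_sq. unfold s. rewrite Csqrt_sq. ring.
Qed.

Lemma arcsin_base_neq_0 z : arcsin_base z <> 0%C.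
Proof.
intros E. assert (H := arcsin_base_inv z). rewrite E in H.
apply (f_equal Cmod) in H. rewrite Cmod_mult, Cmod_0, Cmod_1 in H. lra.
Qed.

(** Valid for every [z], whatever the branches do, since only Exp Log = id and the square of the
    square root enter. Hence it applies to a Schwarz function that reaches the boundary. *)
Lemma csin_Carcsin z : csin (Carcsin z) = z.
Proof.
unfold csin, Carcsin. fold (arcsin_base z).
replace (Ci * (- Ci * Clog (arcsin_base z)))%C with (- (Ci * Ci) * Clog (arcsin_base z))%C by ring.
rewrite Ci_sq. replace (- - (1) * Clog (arcsin_base z))%C with (Clog (arcsin_base z)) by ring.
rewrite Cexp_opp, Cexp_Clog by apply arcsin_base_neq_0.
assert (H := arcsin_base_inv z). assert (N := arcsin_base_neq_0 z). assert (N2 := Ci_neq_0).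
assert (T : RtoC 2 <> 0%C) by (intros E; apply RtoC_inj in E; lra).
replace (/ arcsin_base z)%C with (Csqrt (1 - z * z) - Ci * z)%C.
- unfold arcsin_base. field. auto.
- replace (Csqrt (1 - z * z) - Ci * z)%C
    with ((arcsin_base z * (Csqrt (1 - z * z) - Ci * z)) / arcsin_base z)%C by (field; auto).
  rewrite H. field; auto.
Qed.

(** exp (i arcsin z) and its inverse both have modulus at most 3, so the real part of the logarithm
    is at most 3 in absolute value, and the argument adds at most pi <= 4. The closed disc is needed
    because |w| = 1 is allowed. *)
Lemma Carcsin_bounded z : Cmod z <= 1 -> Cmod (Carcsin z) <= 7.
Proof.
intros Hz. assert (Z0 := Cmod_ge_0 z).
set (s := Csqrt (1 - z * z)).
assert (S : Cmod s <= 2).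
{ assert (T := Cmod_Csqrt (1 - z * z)). fold s in T.
  assert (Q := Cmod_tri_sub 1 (z * z)). rewrite Cmod_1, Cmod_mult in Q.
  generalize (Cmod_ge_0 s). nra. }
assert (Y : Cmod (arcsin_base z) <= 3).
{ unfold arcsin_base. fold s. eapply Rle_trans; [apply Cmod_triangle |].
  rewrite Cmod_mult, Cmod_Ci. lra. }
assert (X : Cmod (s - Ci * z) <= 3).
{ eapply Rle_trans; [apply Cmod_tri_sub |]. rewrite Cmod_mult, Cmod_Ci. lra. }
assert (I := f_equal Cmod (arcsin_base_inv z)). fold s in I. rewrite Cmod_mult, Cmod_1 in I.
assert (N := proj1 (Cmod_gt_0 _) (arcsin_base_neq_0 z)).
assert (L : Rabs (ln (Cmod (arcsin_base z))) <= 3).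
{ assert (Lb : forall x, 0 < x -> x <= 3 -> ln x <= 3).
  { intros x Hx Hx3. rewrite <- (ln_exp 3). apply ln_le; auto.
    generalize (exp_ineq1_le 3). lra. }
  apply Rabs_le_between. split; [| now apply Lb].
  rewrite <- (Rinv_inv (Cmod (arcsin_base z))), ln_Rinv by now apply Rinv_0_lt_compat.
  apply Ropp_le_contravar. apply Lb; [now apply Rinv_0_lt_compat |].
  replace (/ Cmod (arcsin_base z)) with (Cmod (s - Ci * z)); auto.
  apply Rmult_eq_reg_l with (Cmod (arcsin_base z)); [| lra]. rewrite I. field. lra. }
unfold Carcsin. fold (arcsin_base z). rewrite Cmod_mult, Cmod_opp, Cmod_Ci, Rmult_1_l.
eapply Rle_trans; [apply Cmod_le_ReIm |]. unfold Clog. simpl.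
generalize (Carg_bound (arcsin_base z)) PI_4. lra.
Qed.

Lemma one_sub_sq_right z : Cmod z < 1 -> right_half (1 - z * z).
Proof.
intros Hz. unfold right_half.
assert (Q := re_le_Cmod (z * z)). rewrite Cmod_mult in Q.
apply Rabs_le_between in Q. assert (Z0 := Cmod_ge_0 z).
replace (Re (1 - z * z)) with (1 - Re (z * z)) by (destruct z; simpl; ring). nra.
Qed.

(** Y and 1/Y have real parts of the same sign, and their sum 2 sqrt (1 - z^2) has positive real
    part. *)
Lemma arcsin_base_right z : Cmod z < 1 -> right_half (arcsin_base z).
Proof.
intros Hz. unfold right_half. set (Y := arcsin_base z).
assert (S := Re_Csqrt _ (one_sub_sq_right z Hz)).
assert (N : Y <> 0%C) by apply arcsin_base_neq_0.
assert (M : 0 < Cmod Y) by (apply Cmod_gt_0; exact N).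
assert (E : (Cconj Y * RtoC (/ Cmod Y ^ 2))%C = (Csqrt (1 - z * z) - Ci * z)%C).
{ replace (Csqrt (1 - z * z) - Ci * z)%C
    with ((Y * Cconj Y) * RtoC (/ Cmod Y ^ 2) * (Csqrt (1 - z * z) - Ci * z))%C.
  - replace (Y * Cconj Y * RtoC (/ Cmod Y ^ 2) * (Csqrt (1 - z * z) - Ci * z))%C
      with (Cconj Y * RtoC (/ Cmod Y ^ 2) * (Y * (Csqrt (1 - z * z) - Ci * z)))%C by ring.
    unfold Y. rewrite arcsin_base_inv. ring.
  - rewrite <- Cmod2_conj, <- RtoC_mult, Rinv_r by (apply pow_nonzero; lra). ring. }
apply (f_equal Re) in E.
replace (Re (Cconj Y * RtoC (/ Cmod Y ^ 2))) with (Re Y * / Cmod Y ^ 2) in E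
  by (destruct Y; simpl; ring).
assert (P : Re Y * / Cmod Y ^ 2 + Re Y = 2 * Re (Csqrt (1 - z * z))).
{ rewrite E. unfold Y, arcsin_base. destruct z, (Csqrt (1 - (r, r0) * (r, r0))). simpl. ring. }
assert (I : 0 < / Cmod Y ^ 2) by (apply Rinv_0_lt_compat, pow_lt; lra).
nra.
Qed.

Lemma Cder_Carcsin z : Cmod z < 1 -> Cder Carcsin z (/ Csqrt (1 - z * z))%C.
Proof.
intros Hz. assert (RH := one_sub_sq_right z Hz).
set (s := Csqrt (1 - z * z)).
assert (s0 : s <> 0%C).
{ intros E. generalize (Re_Csqrt _ RH). fold s. rewrite E. simpl. lra. }
assert (T : RtoC 2 <> 0%C) by (intros E; apply RtoC_inj in E; lra).
assert (N := arcsin_base_neq_0 z).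
unfold Carcsin. eapply Cder_eq.
- apply (Cder_mult (fun _ => (- Ci)%C) (fun z => Clog (arcsin_base z))); [apply Cder_const |].
  apply (Cder_comp arcsin_base Clog); [| apply Cder_Clog; now apply arcsin_base_right].
  unfold arcsin_base. apply Cder_plus.
  + apply (Cder_mult (fun _ => Ci) (fun y => y)); [apply Cder_const | apply Cder_id].
  + apply (Cder_comp (fun y => 1 - y * y)%C Csqrt); [| now apply Cder_Csqrt].
    apply Cder_minus; [apply Cder_const | apply Cder_mult; apply Cder_id].
- cbv beta. fold s.
  replace (0 * z + Ci * 1 + / (2 * s) * (0 - (1 * z + z * 1)))%C with (Ci * arcsin_base z / s)%C.
  + replace (0 * Clog (arcsin_base z) + - Ci * (/ arcsin_base z * (Ci * arcsin_base z / s)))%C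
      with (- (Ci * Ci) / s)%C by (field; auto). rewrite Ci_sq. field. auto.
  + unfold arcsin_base. fold s.
    replace (Ci * (Ci * z + s) / s)%C with ((Ci * Ci) * z / s + Ci)%C by (field; auto).
    rewrite Ci_sq. field. auto.
Qed.

Lemma hol_Carcsin : hol (Cdisc 1) Carcsin.
Proof.
exists (fun z => / Csqrt (1 - z * z))%C. intros z Hz. split; [now apply Cder_Carcsin |].
assert (RH := one_sub_sq_right z Hz).
assert (s0 : Csqrt (1 - z * z) <> 0%C).
{ intros E. generalize (Re_Csqrt _ RH). rewrite E. simpl. lra. }
eexists. apply (Cder_comp (fun z => Csqrt (1 - z * z)) Cinv); [| now apply Cder_inv].
apply (Cder_comp (fun y => 1 - y * y)%C Csqrt); [| now apply Cder_Csqrt].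
apply Cder_minus; [apply Cder_const | apply Cder_mult; apply Cder_id].
Qed.

Lemma Clog_1 : Clog 1 = 0%C.
Proof.
assert (A := proj2 (Carg_right 1 ltac:(simpl; lra))). unfold Clog.
rewrite Cmod_1, ln_1, A. simpl. replace (0 / 1) with 0 by field. now rewrite atan_0.
Qed.

Lemma Carcsin_0 : Carcsin 0 = 0%C.
Proof.
unfold Carcsin. replace (Ci * 0 + Csqrt (1 - 0 * 0))%C with (RtoC 1).
- rewrite Clog_1. ring.
- replace (1 - 0 * 0)%C with (RtoC 1) by ring. rewrite Csqrt_exp, Clog_1.
  + replace (0 * RtoC (/ 2))%C with (RtoC 0) by ring. rewrite Cexp_0. ring.
  + intros E; apply RtoC_inj in E; lra.
Qed.

(* [2 - 2 sqrt (1 - s)] dominates [arcsin s] and is itself at most [2 s]. *)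
Lemma Carcsin_le z : Cmod z < 1 -> Cmod (Carcsin z) <= 2 * Cmod z.
Proof.
intros Hz. assert (Z0 := Cmod_ge_0 z). set (m := Cmod z) in *.
assert (Q := mean_value_ineq (fun u => Carcsin (u * z)) (fun u => / Csqrt (1 - (u * z) * (u * z)) * z)%C
  (fun t => - 2 * sqrt (1 - t * m)) (fun t => m / sqrt (1 - t * m)) 0 1 ltac:(lra)).
assert (pos : forall t, 0 <= t <= 1 -> 0 < 1 - t * m) by (intros; nra).
assert (Ct : forall t, 0 <= t <= 1 -> Cmod (RtoC t * z) = t * m).
{ intros t Ht. rewrite Cmod_mult, Cmod_R, Rabs_pos_eq; [easy | lra]. }
cbv beta in Q.
replace (0 * z)%C with (RtoC 0) in Q by ring. replace (1 * z)%C with z in Q by ring.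
rewrite Carcsin_0 in Q. replace (Carcsin z - 0)%C with (Carcsin z) in Q by ring.
eapply Rle_trans; [apply Q |].
- intros t Ht. assert (tm := pos t Ht). eapply Cder_eq.
  + apply (Cder_comp (fun u => u * z)%C Carcsin).
    * apply (Cder_mult (fun u => u) (fun _ => z)); [apply Cder_id | apply Cder_const].
    * apply Cder_Carcsin. rewrite Ct by auto. lra.
  + cbv beta. ring.
- intros t Ht. assert (tm := pos t Ht). auto_derive; [exact tm |].
  replace (1 + - (t * m)) with (1 - t * m) by ring. field. apply Rgt_not_eq, sqrt_lt_R0. exact tm.
- intros t Ht. assert (tm := pos t Ht).
  rewrite Cmod_mult. fold m.
  assert (RH := one_sub_sq_right (t * z) ltac:(rewrite Ct by auto; lra)).
  assert (s0 : Csqrt (1 - (t * z) * (t * z)) <> 0%C).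
  { intros E. generalize (Re_Csqrt _ RH). rewrite E. simpl. lra. }
  rewrite Cmod_inv by auto. unfold Rdiv. rewrite Rmult_comm.
  apply Rmult_le_compat_l; auto. apply Rinv_le_contravar; [now apply sqrt_lt_R0 |].
  apply le_of_sq_le; [apply Cmod_ge_0 |]. rewrite Cmod_Csqrt, pow2_sqrt by lra.
  assert (T := Cmod_tri_inv 1 ((t * z) * (t * z))). rewrite Cmod_1, Cmod_mult, Ct in T by auto.
  assert (0 <= t * m) by nra. nra.
- rewrite Rmult_0_l, Rminus_0_r, sqrt_1, Rmult_1_l.
  assert (1 - m <= sqrt (1 - m)); [| lra].
  assert (S := sqrt_sqrt (1 - m) ltac:(lra)). assert (P := sqrt_pos (1 - m)).
  assert (sqrt (1 - m) <= 1) by (apply le_of_sq_le; [lra | simpl; nra]). nra.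
Qed.

(** * The upper bounds *)

Lemma Cder_is_derive f z l : Cder f z l -> @is_derive C_AbsRing C_NormedModule f z l.
Proof.
intros H. rewrite Cder_eps in H. split; [apply is_linear_scal_l |].
intros x Hx. apply (is_filter_lim_locally_unique (K := C_AbsRing) (V := AbsRing_NormedModule C_AbsRing)) in Hx.
subst x. intros eps. destruct (H eps (cond_pos eps)) as [d [Hd HH]].
apply locally_C.
apply (locally_le_locally_norm (V := C_NormedModule)).
exists (mkposreal d Hd). intros y Hy. apply (HH y). exact Hy.
Qed.

Lemma C_derive_eq f z l : Cder f z l -> C_derive f z = l.
Proof. intros H. apply is_C_derive_unique. now apply Cder_is_derive. Qed.

Lemma jet_val f a0 a1 a2 a3 : jet f a0 a1 a2 a3 -> f 0%C = a0.
Proof. intros [e [_ H]]. apply near_self in H. rewrite H. simpl; ring. Qed.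

(** The coefficients follow from Exp' = Exp, which reads (n+1) e_(n+1) = e_n, and from Exp 0 = 1. *)
Lemma jet_Cexp : jet Cexp 1 1 (/ 2) (/ 6).
Proof.
destruct (hol_pseries Cexp 1 Rlt_0_1 (hol_Cexp _)) as [e [He _]].
destruct (pseries_Cder e Cexp 1 He) as [h' H'].
assert (E : forall n, (INR (S n) * e (S n))%C = e n).
{ apply (pseries_unique _ _ Cexp 1 Rlt_0_1).
  - intros z Hz. destruct (H' z (proj2 Hz)) as [H1 H2].
    now rewrite (Cder_unique _ _ _ _ H1 (Cder_Cexp z)) in H2.
  - intros z Hz. apply He. apply Hz. }
assert (J := jet_series e Cexp 1 Rlt_0_1 He).
assert (E0 : e 0%nat = 1%C) by (rewrite <- (jet_val _ _ _ _ _ J); apply Cexp_0).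
assert (E1 := E 0%nat). assert (E2 := E 1%nat). assert (E3 := E 2%nat).
simpl INR in E1, E2, E3. rewrite E0 in E1.
assert (T2 : RtoC 2 <> 0%C) by (intros X; apply RtoC_inj in X; lra).
assert (T3 : RtoC 3 <> 0%C) by (intros X; apply RtoC_inj in X; lra).
assert (T6 : RtoC 6 <> 0%C) by (intros X; apply RtoC_inj in X; lra).
assert (F1 : e 1%nat = 1%C) by (rewrite <- E1; ring).
rewrite F1 in E2. replace (1 + 1) with 2 in E2 by ring.
assert (F2 : e 2%nat = (/ 2)%C).
{ replace (e 2%nat) with ((2 * e 2%nat) / 2)%C by (field; auto). rewrite E2. field; auto. }
rewrite F2 in E3. replace (1 + 1 + 1) with 3 in E3 by ring.
assert (F3 : e 3%nat = (/ 6)%C).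
{ replace (e 3%nat) with ((3 * e 3%nat) / 3)%C by (field; auto). rewrite E3.
  replace (RtoC 6) with (2 * 3)%C by (rewrite <- RtoC_mult; f_equal; ring). field; auto. }
eapply jet_coef; [exact J | | | |]; auto.
Qed.

Lemma jet_csin : jet csin 0 1 0 (- / 6).
Proof.
assert (T2 : RtoC 2 <> 0%C) by (intros X; apply RtoC_inj in X; lra).
assert (T6 : RtoC 6 <> 0%C) by (intros X; apply RtoC_inj in X; lra).
assert (I0 := Ci_neq_0).
assert (JI := jet_mult _ _ _ _ _ _ _ _ _ _ (jet_const Ci) jet_id).
assert (JI' : jet (fun z => Ci * z)%C 0 Ci 0 0) by (eapply jet_coef; [exact JI | ring ..]).
assert (JM' : jet (fun z => - Ci * z)%C 0 (- Ci) 0 0).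
{ eapply jet_coef; [exact (jet_mult _ _ _ _ _ _ _ _ _ _ (jet_const (- Ci)) jet_id) | ring ..]. }
assert (E1 := jet_comp _ _ _ _ _ _ _ _ _ jet_Cexp JI').
assert (E2 := jet_comp _ _ _ _ _ _ _ _ _ jet_Cexp JM').
assert (J := jet_mult _ _ _ _ _ _ _ _ _ _
  (jet_plus _ _ _ _ _ _ _ _ _ _ E1 (jet_mult _ _ _ _ _ _ _ _ _ _ (jet_const (-1)) E2))
  (jet_const (/ (2 * Ci)))).
apply jet_ext with (g := csin) in J.
2:{ apply filter_forall. intros z. unfold csin. replace (- Ci * z)%C with (- (Ci * z))%C by ring.
    field. auto. }
eapply jet_coef; [exact J | | | |].
- field; auto.
- field; auto.
- simpl. field; auto.
- simpl.
  replace (Ci * (Ci * (Ci * 1)))%C with ((Ci * Ci) * Ci)%C by ring.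
  replace (- Ci * (- Ci * (- Ci * 1)))%C with (- ((Ci * Ci) * Ci))%C by ring.
  rewrite Ci_sq. field; auto.
Qed.

(* Along a ray, [|p|^2 exp (C t)] is nondecreasing once [|p'| <= C/2 |p|]. *)
Lemma log_derivative_bounded_nonzero (p p' : C -> C) M :
  (forall u, Cmod u < 1 -> Cder p u (p' u)) -> p 0%C <> 0%C ->
  (forall u, Cmod u < 1 -> p u <> 0%C -> Cmod (u * p' u) <= M * Cmod (p u)) ->
  forall z, Cmod z < 1 -> p z <> 0%C.
Proof.
intros Hp p0 HM z Hz.
assert (H0 := Hp 0%C ltac:(rewrite Cmod_0; lra)). apply Cder_cont in H0.
destruct (tends_nonzero _ _ _ H0 p0) as [d [Hd Nd]].
(* The hypothesis controls t p'(tz) z and not p'(tz) z itself, so the argument starts at a positive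
   [t0], close enough to 0 for continuity to give p(t0 z) <> 0; the growth constant pays a factor 1
   / t0. *)
set (t0 := Rmin 1 (d / 2)).
assert (T0 : 0 < t0) by (apply Rmin_glb_lt; lra).
assert (T1 : t0 <= 1) by apply Rmin_l. assert (T2 : t0 <= d / 2) by apply Rmin_r.
assert (Z0 := Cmod_ge_0 z).
set (Cc := 2 * (Rabs M / t0)).
assert (Cz : forall t, 0 <= t <= 1 -> Cmod (RtoC t * z) < 1).
{ intros t Ht. rewrite Cmod_mult, Cmod_R, Rabs_pos_eq by lra. nra. }
assert (q : forall t : R, 0 <= t <= 1 -> Cder (fun u => p (u * z)%C) (RtoC t) (p' (t * z) * z)%C).
{ intros t Ht. eapply Cder_eq.
  - apply (Cder_comp (fun u => u * z)%C p); [| apply Hp; auto].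
    apply (Cder_mult (fun u => u) (fun _ => z)); [apply Cder_id | apply Cder_const].
  - cbv beta. ring. }
set (N := fun t : R => (Re (p (t * z)%C) ^ 2 + Im (p (t * z)%C) ^ 2) * exp (Cc * t)).
set (N' := fun t : R => (2 * (Re (p (t * z)%C) * Re (p' (t * z) * z)%C
    + Im (p (t * z)%C) * Im (p' (t * z) * z)%C)
    + Cc * (Re (p (t * z)%C) ^ 2 + Im (p (t * z)%C) ^ 2)) * exp (Cc * t)).
assert (DN : forall t, 0 <= t <= 1 -> is_derive N t (N' t)).
{ intros t Ht. destruct (Cder_real _ _ _ (q t Ht)) as [D1 D2].
  unfold N. evar_last.
  - apply (is_derive_mult (fun t : R => Re (p (t * z)%C) ^ 2 + Im (p (t * z)%C) ^ 2) (fun t => exp (Cc * t))).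
    + apply (is_derive_plus (fun t : R => Re (p (t * z)%C) ^ 2)).
      * apply (is_derive_pow (fun t : R => Re (p (t * z)%C)) 2). exact D1.
      * apply (is_derive_pow (fun t : R => Im (p (t * z)%C)) 2). exact D2.
    + assert (X : is_derive (fun t => exp (Cc * t)) t (Cc * exp (Cc * t)))
        by (auto_derive; [easy | ring]). exact X.
    + intros; apply Rmult_comm.
  - unfold N'. simpl. unfold plus, mult; simpl. ring. }
destruct (MVT_gen N t0 1 N') as [c [Hc E]].
{ rewrite Rmin_left, Rmax_right by lra. intros x Hx. apply DN; lra. }
{ rewrite Rmin_left, Rmax_right by lra. intros x Hx. apply continuity_pt_filterlim.
  apply (ex_derive_continuous N). eexists. apply DN; lra. }
rewrite Rmin_left, Rmax_right in Hc by lra.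
assert (P : 0 <= N' c).
{ unfold N'. apply Rmult_le_pos; [| left; apply exp_pos].
  set (a := p (c * z)%C). set (b := (p' (c * z) * z)%C).
  (* The bound on p' is available only where [p] does not vanish; where it vanishes, [N'] is 0. *)
  assert (B : Cmod b <= Cc / 2 * Cmod a \/ a = 0%C).
  { destruct (Ceq_dec a 0) as [Za | Na]; [now right | left].
    assert (K := HM (c * z)%C (Cz c ltac:(lra)) Na). fold a in K.
    replace (c * z * p' (c * z))%C with (c * b)%C in K by (unfold b; ring).
    rewrite Cmod_mult, Cmod_R, Rabs_pos_eq in K by lra.
    assert (A0 := Cmod_ge_0 a). assert (B0 := Cmod_ge_0 b).
    apply Rmult_le_reg_l with t0; auto.
    replace (t0 * (Cc / 2 * Cmod a)) with (Rabs M * Cmod a) by (unfold Cc; field; lra).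
    apply Rle_trans with (c * Cmod b); [apply Rmult_le_compat_r; lra |].
    eapply Rle_trans; [exact K |]. apply Rmult_le_compat_r; auto. apply Rle_abs. }
  rewrite <- Cmod2_alt.
  assert (X : - (Cmod a * Cmod b) <= Re a * Re b + Im a * Im b).
  { assert (Q := re_le_Cmod (Cconj a * b)). rewrite Cmod_mult, Cmod_conj in Q.
    replace (Re (Cconj a * b)) with (Re a * Re b + Im a * Im b) in Q
      by (destruct a, b; simpl; ring).
    apply Rabs_le_between in Q. lra. }
  assert (A0 := Cmod_ge_0 a). assert (B0 := Cmod_ge_0 b).
  destruct B as [B | B].
  - nra.
  - rewrite B in *. simpl. rewrite Cmod_0. nra. }
assert (Q : 0 < N t0).
{ unfold N. rewrite <- Cmod2_alt. apply Rmult_lt_0_compat; [| apply exp_pos].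
  apply pow_lt. apply Cmod_gt_0. apply Nd.
  replace (t0 * z - 0)%C with (t0 * z)%C by ring.
  rewrite Cmod_mult, Cmod_R, Rabs_pos_eq by lra. nra. }
assert (F : 0 < N 1) by nra.
intros Zz. unfold N in F. rewrite <- Cmod2_alt in F.
replace (1 * z)%C with z in F by ring. rewrite Zz, Cmod_0 in F. simpl in F. lra.
Qed.

(** Coefficients are compared in k u f' = z f'' with u = arcsin w. As w = sin u, the third
    coefficient of [u] is c3 + c1^3 / 6, the origin of that term. Writing f = z phi brings a4 within
    reach of a third-order jet. *)
Lemma C_arcsin_coefs f w : classA f -> (forall z, Omega z -> Cmod (w z) <= 1) ->
  (forall z, Omega z -> (1 + z * C_derive (C_derive f) z / C_derive f z)%C =
     (1 + RtoC (2 / PI) * Carcsin (w z))%C) ->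
  hol (Cdisc 1) w /\ exists phi a2 a3 a4 c1 c2 c3,
    (forall z, Omega z -> f z = z * phi z)%C /\ jet phi 1 a2 a3 a4 /\ jet w 0 c1 c2 c3 /\
    let k := RtoC (2 / PI) in
    (2 * a2 = k * c1 /\ 6 * a3 = k * (c2 + 2 * a2 * c1) /\
    12 * a4 = k * (c3 + c1 ^ 3 / 6 + 2 * a2 * c2 + 3 * a3 * c1))%C.
Proof.
intros [_ [a [A0 [A1 Ha]]]] Bw E. unfold Omega in *.
assert (Ha' : forall z, Cmod z < 1 -> ser (fun n => a n * z ^ n)%C (f z)).
{ intros z Hz. apply is_pseries_ser. now apply Ha. }
clear Ha.
destruct (pseries_Cder _ _ _ Ha') as [f1 H1].
destruct (pseries_Cder (fun n => INR (S n) * a (S n))%C f1 1 (fun z Hz => proj2 (H1 z Hz))) as [f2 H2].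
assert (Hf1 := pseries_hol _ f1 1 (fun z Hz => proj2 (H1 z Hz))).
assert (Hf2 := pseries_hol _ f2 1 (fun z Hz => proj2 (H2 z Hz))).
assert (J1 := jet_series _ f1 1 Rlt_0_1 (fun z Hz => proj2 (H1 z Hz))).
assert (J2 := jet_series _ f2 1 Rlt_0_1 (fun z Hz => proj2 (H2 z Hz))).
cbv beta in J1, J2.
assert (P := PI_RGT_0). set (k := RtoC (2 / PI)) in *.
assert (k0 : k <> 0%C).
{ intros X. apply RtoC_inj in X. assert (0 < 2 / PI) by (apply Rdiv_lt_0_compat; lra). lra. }
assert (E' : forall z, Cmod z < 1 -> (z * f2 z / f1 z)%C = (k * Carcsin (w z))%C).
{ intros z Hz. assert (Ez := E z Hz).
  assert (D1 : forall y, Cmod y < 1 -> C_derive f y = f1 y) by (intros; now apply C_derive_eq, H1).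
  rewrite D1 in Ez by auto.
  replace (C_derive (C_derive f) z) with (f2 z) in Ez.
  - replace (z * f2 z / f1 z)%C with (1 + z * f2 z / f1 z - 1)%C by ring. rewrite Ez. ring.
  - symmetry. apply C_derive_eq. apply Cder_ext with f1; [| now apply H2].
    generalize (Cdisc_near 1 z Hz). apply filter_imp. intros y Hy. now rewrite D1. }
assert (N1 : forall z, Cmod z < 1 -> f1 z <> 0%C).
{ apply (log_derivative_bounded_nonzero f1 f2 (Cmod k * 7)).
  - intros u Hu. now apply H2.
  - rewrite (jet_val _ _ _ _ _ J1), A1. simpl. intros X.
    replace (1 * 1)%C with (RtoC 1) in X by ring. apply RtoC_inj in X. lra.
  - intros u Hu nu. replace (u * f2 u)%C with (k * Carcsin (w u) * f1 u)%C.
    + rewrite !Cmod_mult. apply Rmult_le_compat_r; [apply Cmod_ge_0 |].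
      apply Rmult_le_compat_l; [apply Cmod_ge_0 |]. apply Carcsin_bounded. auto.
    + rewrite <- E' by auto. field. auto. }
set (u := fun z => (/ k * (z * f2 z * / f1 z))%C).
assert (Hu : hol (Cdisc 1) u).
{ unfold u. repeat (apply hol_mult || apply hol_const || apply hol_id || exact Hf2).
  apply hol_inv; [exact Hf1 | exact N1]. }
assert (wu : forall z, Cmod z < 1 -> csin (u z) = w z).
{ intros z Hz. rewrite <- (csin_Carcsin (w z)). f_equal. unfold u.
  replace (z * f2 z * / f1 z)%C with (z * f2 z / f1 z)%C by reflexivity.
  rewrite E' by auto. field. auto. }
split.
{ apply hol_ext with (fun z => csin (u z)).
  - apply Cdisc_near.
  - exact wu.
  - apply (hol_comp _ (fun _ => True) u csin); auto. apply hol_csin. }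
destruct (hol_pseries u 1 Rlt_0_1 Hu) as [v [Hv _]].
assert (Ju := jet_series v u 1 Rlt_0_1 Hv).
assert (M1 := jet_mult _ _ _ _ _ _ _ _ _ _ (jet_const k) (jet_mult _ _ _ _ _ _ _ _ _ _ Ju J1)).
assert (M2 := jet_mult _ _ _ _ _ _ _ _ _ _ jet_id J2).
cbv beta in M1, M2.
apply (jet_ext _ (fun z => z * f2 z)%C) in M1.
2:{ generalize (Cdisc_near 1 0 ltac:(unfold Cdisc; rewrite Cmod_0; lra)). apply filter_imp.
    intros z Hz. unfold u. field. split; auto. }
destruct (jet_unique _ _ _ _ _ _ _ _ _ M1 M2) as [Q0 [Q1 [Q2 Q3]]].
rewrite A1 in Q0, Q1, Q2, Q3. simpl INR in Q0, Q1, Q2, Q3.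
assert (V0 : v 0%nat = 0%C).
{ replace (v 0%nat) with (k * (v 0%nat * (1 * 1)) / k)%C by (field; auto). rewrite Q0. field; auto. }
rewrite V0 in *.
destruct (pseries_div a f 1 Ha' A0) as [phi Hphi].
exists phi, (a 2%nat), (a 3%nat), (a 4%nat), (v 1%nat), (v 2%nat), (v 3%nat - v 1%nat ^ 3 / 6)%C.
split; [| split; [| split]].
- intros z Hz. now apply Hphi.
- rewrite <- A1. apply (jet_series (fun n => a (S n)) _ 1 Rlt_0_1).
  intros z Hz. now apply Hphi.
- assert (T6 : RtoC 6 <> 0%C) by (intros X; apply RtoC_inj in X; lra).
  assert (JW := jet_comp _ _ _ _ _ _ _ _ _ jet_csin Ju).
  apply (jet_ext _ w) in JW.
  + eapply jet_coef; [exact JW | | | |]; try (simpl; field; auto; fail).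
  + generalize (Cdisc_near 1 0 ltac:(unfold Cdisc; rewrite Cmod_0; lra)). apply filter_imp. exact wu.
- assert (T6 : RtoC 6 <> 0%C) by (intros X; apply RtoC_inj in X; lra).
  assert (R2 : RtoC (1 + 1) = 2%C) by (f_equal; ring).
  assert (R3 : RtoC (1 + 1 + 1) = 3%C) by (f_equal; ring).
  assert (R4 : RtoC (1 + 1 + 1 + 1) = 4%C) by (f_equal; ring).
  rewrite ?R2, ?R3, ?R4 in *.
  assert (S2 : RtoC 6 = (2 * 3)%C) by (rewrite <- RtoC_mult; f_equal; ring).
  assert (S3 : RtoC 12 = (3 * 4)%C) by (rewrite <- RtoC_mult; f_equal; ring).
  split; [| split].
  + match type of Q1 with ?L = ?R => transitivity R; [ring | rewrite <- Q1; ring] end.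
  + rewrite S2. match type of Q2 with ?L = ?R => transitivity R; [ring | rewrite <- Q2; ring] end.
  + replace (v 3%nat - v 1%nat ^ 3 / 6 + v 1%nat ^ 3 / 6)%C with (v 3%nat) by ring.
    rewrite S3. match type of Q3 with ?L = ?R => transitivity R; [ring | rewrite <- Q3; ring] end.
Qed.

(** With l(w) = 2 sum Gamma_n w^n and G = exp l, the inverse is w G(w), and f (g w) = w becomes G
    phi(w G) = 1. The factor w being divided out, third-order jets determine Gamma_3. *)
Lemma inv_log_coefs_formula f phi a2 a3 a4 Gamma :
  (forall z, Omega z -> f z = z * phi z)%C -> jet phi 1 a2 a3 a4 -> inv_log_coeffs f Gamma ->
  (Gamma 1%nat = - (a2 / 2) /\ Gamma 2%nat = - ((a3 - 3 / 2 * a2 ^ 2) / 2) /\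
   Gamma 3%nat = - ((a4 - 4 * a2 * a3 + 10 / 3 * a2 ^ 3) / 2))%C.
Proof.
intros Hf Jphi [G0 [g [r [Hr [Hg HG]]]]].
(* The given expansion leaves out the origin; [l] includes it, so that it has a jet at 0. *)
set (l := fun w => CSer (fun n => RtoC 2 * Gamma n * w ^ n)%C).
assert (Sl : forall w, Cmod w < r -> ser (fun n => RtoC 2 * Gamma n * w ^ n)%C (l w)).
{ intros w Hw. destruct (Ceq_dec w 0) as [-> | n].
  - eapply CSer_correct. apply (ser_at_0 (fun n => RtoC 2 * Gamma n)%C).
  - assert (W : 0 < Cmod w) by (apply Cmod_gt_0; exact n).
    eapply CSer_correct. apply is_pseries_ser. apply HG. lra. }
assert (Jl := jet_series _ l r Hr Sl). cbv beta in Jl. rewrite G0 in Jl.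
assert (Jl' : jet l 0 (2 * Gamma 1%nat) (2 * Gamma 2%nat) (2 * Gamma 3%nat))
  by (eapply jet_coef; [exact Jl | ring ..]).
assert (JG := jet_comp _ _ _ _ _ _ _ _ _ jet_Cexp Jl').
set (G := fun w => Cexp (l w)) in *.
assert (gG : forall w, 0 < Cmod w < r -> g w = (w * G w)%C).
{ intros w Hw. assert (w0 : w <> 0%C) by (apply Cmod_gt_0; lra).
  destruct (Hg w (proj2 Hw)) as [O1 O2].
  assert (g0 : g w <> 0%C).
  { intros Z. rewrite Hf in O2 by auto. rewrite Z in O2. apply w0. rewrite <- O2. ring. }
  assert (E : l w = Clog (g w / w)).
  { apply (ser_unique _ _ _ (Sl w (proj2 Hw))). apply is_pseries_ser. now apply HG. }
  unfold G. rewrite E, Cexp_Clog.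
  - field; auto.
  - intros Z. apply g0. replace (g w) with (g w / w * w)%C by (field; auto). rewrite Z. ring. }
assert (Ju := jet_mult _ _ _ _ _ _ _ _ _ _ jet_id JG).
assert (Ju' : jet (fun w => w * G w)%C 0 1 (2 * Gamma 1%nat) (2 * Gamma 2%nat + / 2 * (2 * Gamma 1%nat) ^ 2)).
{ eapply jet_coef; [exact Ju | ring ..]. }
assert (JP := jet_comp _ _ _ _ _ _ _ _ _ Jphi Ju').
assert (J := jet_mult _ _ _ _ _ _ _ _ _ _ JG JP). cbv beta in J.
apply (jet_ext _ (fun _ => 1%C)) in J.
2:{ exists r. split; auto. intros w Hw. replace (w - 0)%C with w in Hw by ring.
    destruct (Ceq_dec w 0) as [-> | n].
    - replace (0 * G 0)%C with (RtoC 0) by ring. rewrite (jet_val _ _ _ _ _ Jphi).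
      rewrite (jet_val _ _ _ _ _ JG). ring.
    - assert (W : 0 < Cmod w) by (apply Cmod_gt_0; exact n).
      destruct (Hg w Hw) as [O1 O2]. rewrite Hf in O2 by auto. rewrite gG in O2 by lra.
      fold (G w). replace (G w * phi (w * G w))%C with (w * G w * phi (w * G w) / w)%C by (field; auto).
      rewrite O2. field; auto. }
destruct (jet_unique _ _ _ _ _ _ _ _ _ J (jet_const 1)) as [_ [Q1 [Q2 Q3]]].
assert (T2 : RtoC 2 <> 0%C) by (intros X; apply RtoC_inj in X; lra).
assert (T3 : RtoC 3 <> 0%C) by (intros X; apply RtoC_inj in X; lra).
(* Larger numerals are opaque to [field] on [C], so they are expressed through 2 and 3. *)
assert (S6 : RtoC 6 = (2 * 3)%C) by (rewrite <- RtoC_mult; f_equal; ring).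
assert (S10 : RtoC 10 = (2 * 2 * 2 + 2)%C) by (rewrite <- !RtoC_mult, <- RtoC_plus; f_equal; ring).
assert (S4 : RtoC 4 = (2 * 2)%C) by (rewrite <- !RtoC_mult; f_equal; ring).
rewrite S6 in *. rewrite S10, S4.
assert (X1 : Gamma 1%nat = (- (a2 / 2))%C).
{ apply Csub_0. replace (Gamma 1%nat - - (a2 / 2))%C with ((1 * (a2 * 1) + 1 * (2 * Gamma 1%nat) * 1) / 2)%C
    by (field; auto). rewrite Q1. field; auto. }
assert (X2 : Gamma 2%nat = (- ((a3 - 3 / 2 * a2 ^ 2) / 2))%C).
{ apply Csub_0. rewrite X1 in Q2.
  transitivity (0 / 2)%C; [| field; auto]. rewrite <- Q2. simpl. field; auto. }
split; [exact X1 | split; [exact X2 |]].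
apply Csub_0. rewrite X1, X2 in Q3.
transitivity (0 / 2)%C; [| field; auto]. rewrite <- Q3. simpl. field; auto.
Qed.

(** Stated for a given [w] and not through [subordinate], so that the same formulas serve the bounds
    and, with [w] a known power of [z], the extremal functions. *)
Lemma Gamma_schwarz_coefs f w Gamma : classA f -> (forall z, Omega z -> Cmod (w z) <= 1) ->
  (forall z, Omega z -> (1 + z * C_derive (C_derive f) z / C_derive f z)%C =
     (1 + RtoC (2 / PI) * Carcsin (w z))%C) ->
  inv_log_coeffs f Gamma ->
  hol (Cdisc 1) w /\ exists c1 c2 c3, jet w 0 c1 c2 c3 /\
    let k := 2 / PI in
    (Gamma 1%nat = - (RtoC (k / 4) * c1) /\
     Gamma 2%nat = - (RtoC (k / 12) * (c2 - RtoC (5 / 4 * k) * c1 ^ 2)) /\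
     Gamma 3%nat = - (RtoC (k / 24) * (c3 - RtoC (5 / 2 * k) * c1 * c2
        + RtoC (1 / 6 + 3 / 2 * k ^ 2) * c1 ^ 3)))%C.
Proof.
intros Hf Bw E HG.
destruct (C_arcsin_coefs f w Hf Bw E) as [Hw [phi [a2 [a3 [a4 [c1 [c2 [c3 [F [Jp [Jw [E2 [E3 E4]]]]]]]]]]]]].
split; auto. exists c1, c2, c3. split; auto.
destruct (inv_log_coefs_formula f phi a2 a3 a4 Gamma F Jp HG) as [G1 [G2 G3]].
intros k. fold k in E2, E3, E4.
assert (nz : forall x, x <> 0 -> RtoC x <> 0%C) by (intros x Hx X; apply RtoC_inj in X; lra).
assert (T2 := nz 2 ltac:(lra)). assert (T3 := nz 3 ltac:(lra)).
assert (S6 : RtoC 6 = (2 * 3)%C) by (rewrite <- RtoC_mult; f_equal; ring).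
assert (S10 : RtoC 10 = (2 * 2 * 2 + 2)%C) by (rewrite <- !RtoC_mult, <- RtoC_plus; f_equal; ring).
assert (S4 : RtoC 4 = (2 * 2)%C) by (rewrite <- !RtoC_mult; f_equal; ring).
assert (S12 : RtoC 12 = (2 * 2 * 3)%C) by (rewrite <- !RtoC_mult; f_equal; ring).
assert (S24 : RtoC 24 = (2 * 2 * 2 * 3)%C) by (rewrite <- !RtoC_mult; f_equal; ring).
assert (S5 : RtoC 5 = (2 * 2 + 1)%C) by (rewrite <- !RtoC_mult, <- RtoC_plus; f_equal; ring).
assert (A2 : a2 = (RtoC k * c1 / 2)%C) by (rewrite <- E2; field; auto).
assert (A3 : a3 = (RtoC k * (c2 + 2 * a2 * c1) / 6)%C) by (rewrite <- E3, S6; field; auto).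
assert (A4 : a4 = (RtoC k * (c3 + c1 ^ 3 / 6 + 2 * a2 * c2 + 3 * a3 * c1) / 12)%C)
  by (rewrite <- E4, S12; field; auto).
assert (d : forall x y, y <> 0 -> RtoC (x / y) = (RtoC x / RtoC y)%C) by (intros; now apply RtoC_div).
rewrite G1, G2, G3, A4, A3, A2.
rewrite !RtoC_plus, !RtoC_mult, RtoC_pow, !d by lra.
rewrite ?S10, ?S24, ?S12, ?S6, ?S5, ?S4.
split; [| split]; simpl; field; auto.
Qed.

Theorem upper_bounds f Gamma : C_arcsin f -> inv_log_coeffs f Gamma ->
  Cmod (Gamma 1%nat) <= 1 / (2 * PI) /\
  Cmod (Gamma 2%nat) <= 1 / (6 * PI) /\
  Cmod (Gamma 3%nat) <= 1 / (12 * PI).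
Proof.
intros [[Hf _] [w [[_ [_ Bw]] E]]] HG. cbv beta in E.
destruct (Gamma_schwarz_coefs f w Gamma Hf Bw E HG) as [Hw [c1 [c2 [c3 [Jw [G1 [G2 G3]]]]]]].
assert (K : contraction c1 c2 c3) by (intros p0 p1 p2; now apply (toeplitz_contraction w)).
set (k := 2 / PI) in *.
(* pi > 3 gives k < 2/3, hence 5k/4 <= 1 for the second coefficient, and 1/6 + 3k^2/2 <= 1 and
   (5k/2)^2 <= 4 (1/6 + 3k^2/2) for the third. *)
assert (P : 3 < PI) by (generalize PI2_3_2; unfold PI2 in *; lra).
assert (k0 : 0 < k) by (apply Rdiv_lt_0_compat; lra).
assert (k1 : k < 2 / 3) by (unfold k; apply Rmult_lt_compat_l; [lra | apply Rinv_lt_contravar; lra]).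
assert (B : forall x c, 0 < x -> Cmod c <= 1 -> Cmod (- (RtoC x * c)) <= x).
{ intros x c Hx Hc. rewrite Cmod_opp, Cmod_mult, Cmod_R, Rabs_pos_eq by lra. nra. }
rewrite G1, G2, G3.
replace (1 / (2 * PI)) with (k / 4) by (unfold k; field; lra).
replace (1 / (6 * PI)) with (k / 12) by (unfold k; field; lra).
replace (1 / (12 * PI)) with (k / 24) by (unfold k; field; lra).
split; [| split]; apply B; try lra.
- destruct (contraction_schur _ _ _ K) as [d0 _]. apply le_of_sq_le; lra.
- apply (fekete_szego_bound c1 c2 c3); auto; lra.
- apply third_coef_bound; auto; nra.
Qed.

(** * The extremal functions *)

Lemma RtoC_neq_0 (x : R) : x <> 0 -> RtoC x <> 0%C.
Proof. intros Hx E. apply RtoC_inj in E. auto. Qed.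

Lemma segment_mean_value (f F : C -> C) r M z1 z2 :
  (forall z, Cmod z <= r -> Cder f z (F z)) -> (forall z, Cmod z <= r -> Cmod (F z) <= M) ->
  Cmod z1 <= r -> Cmod z2 <= r -> Cmod (f z1 - f z2) <= M * Cmod (z1 - z2).
Proof.
intros Hf HM H1 H2.
assert (B : forall t : R, 0 <= t <= 1 -> Cmod (z2 + t * (z1 - z2)) <= r).
{ intros t Ht. replace (z2 + t * (z1 - z2))%C with (RtoC (1 - t) * z2 + t * z1)%C
    by (rewrite RtoC_minus; ring).
  eapply Rle_trans; [apply Cmod_triangle |]. rewrite !Cmod_mult, !Cmod_R, !Rabs_pos_eq by lra. nra. }
assert (Q := mean_value_ineq (fun u => f (z2 + u * (z1 - z2))%C)
  (fun u => F (z2 + u * (z1 - z2)) * (z1 - z2))%C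
  (fun t => M * Cmod (z1 - z2) * t) (fun _ => M * Cmod (z1 - z2)) 0 1 ltac:(lra)).
cbv beta in Q.
replace (z2 + 1 * (z1 - z2))%C with z1 in Q by ring.
replace (z2 + 0 * (z1 - z2))%C with z2 in Q by ring.
replace (M * Cmod (z1 - z2) * 1 - M * Cmod (z1 - z2) * 0) with (M * Cmod (z1 - z2)) in Q by ring.
apply Q.
- intros t Ht. eapply Cder_eq.
  + apply (Cder_comp (fun u => z2 + u * (z1 - z2))%C f); [| apply Hf; auto].
    apply (Cder_plus (fun _ => z2)); [apply Cder_const |].
    apply (Cder_mult (fun u => u) (fun _ => z1 - z2)%C); [apply Cder_id | apply Cder_const].
  + cbv beta. ring.
- intros t Ht. auto_derive; [easy | ring].
- intros t Ht. rewrite Cmod_mult. apply Rmult_le_compat_r; [apply Cmod_ge_0 | auto].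
Qed.

(* Picard iteration [z <- w + psi z] for [f = id - psi], where [psi] is 1/2-Lipschitz. *)
Lemma local_inverse (f : C -> C) rho : 0 < rho -> f 0%C = 0%C ->
  (forall z, Cmod z <= rho -> cont f z) ->
  (forall z1 z2, Cmod z1 <= rho -> Cmod z2 <= rho ->
    Cmod ((z1 - f z1) - (z2 - f z2)) <= / 2 * Cmod (z1 - z2)) ->
  forall w, Cmod w < rho / 2 -> exists z, Cmod z <= rho /\ f z = w.
Proof.
intros Hr f0 Cf L w Hw.
set (s := fix s n := match n with O => RtoC 0 | S n => (w + (s n - f (s n)))%C end).
assert (B : forall n, Cmod (s n) <= rho).
{ induction n as [| n IH]; simpl.
  - rewrite Cmod_0; lra.
  - eapply Rle_trans; [apply Cmod_triangle |].
    assert (Q := L (s n) 0%C IH ltac:(rewrite Cmod_0; lra)). rewrite f0 in Q.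
    replace (s n - f (s n) - (0 - 0))%C with (s n - f (s n))%C in Q by ring.
    replace (s n - 0)%C with (s n) in Q by ring. lra. }
assert (St : forall n, Cmod (s (S n) - s n) <= Cmod w * (/ 2) ^ n).
{ induction n as [| n IH].
  - simpl. rewrite f0. replace (w + (0 - 0) - 0)%C with w by ring. lra.
  - replace (s (S (S n)) - s (S n))%C
      with ((s (S n) - f (s (S n))) - (s n - f (s n)))%C by (simpl; ring).
    eapply Rle_trans; [apply L; apply B |]. simpl pow. lra. }
destruct (ser_dom (fun n => s (S n) - s n)%C _ St) as [l [Hl _]].
{ apply (ex_series_scal_l (V := R_NormedModule) (Cmod w)). apply ex_series_geom.
  rewrite Rabs_pos_eq; lra. }
assert (Ts : tends eventually s l).
{ eapply tends_ext; [apply _ | | exact Hl]. apply filter_forall. intros n.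
  induction n as [| n IH]; [reflexivity |].
  transitivity (psum (fun n => s (S n) - s n)%C n + (s (S n) - s n))%C; [reflexivity |].
  rewrite IH. ring. }
assert (Bl : Cmod l <= rho).
{ apply (tends_le eventually s); auto. apply filter_forall. exact B. }
exists l. split; auto.
assert (T1 : tends eventually (fun n => s (S n)) l).
{ intros eps He. apply eventually_S with (P := fun n => Cmod (s n - l) < eps). now apply Ts. }
assert (T2 : tends eventually (fun n => s (S n)) (w + (l + - f l))%C).
{ simpl. apply tends_plus; [apply _ | apply tends_const, _ |].
  apply tends_plus; [apply _ | exact Ts |]. apply tends_opp; [apply _ |].
  apply tends_comp; [apply _ | exact Ts | auto]. }
assert (E := tends_unique eventually _ _ _ T1 T2).
replace (f l) with (w - ((w + (l + - f l)) - l))%C by ring. rewrite <- E. ring.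
Qed.

(** Near 0 the derivative is within 1/2 of 1, so z - f z is 1/2-Lipschitz and [f] has a local
    inverse, differentiable with derivative 1 / F(g w). It factors as w G(w) with G(0) = 1, and half
    the Taylor coefficients of Log G are the required [Gamma]. *)
Lemma inv_log_coeffs_exist (f F : C -> C) :
  (forall z, Cmod z < 1 -> Cder f z (F z) /\ exists l, Cder F z l) ->
  f 0%C = 0%C -> F 0%C = 1%C -> exists Gamma, inv_log_coeffs f Gamma.
Proof.
intros Hf f0 F0.
assert (H0 : Cmod 0 < 1) by (rewrite Cmod_0; lra).
assert (CF : cont F 0).
{ destruct (Hf _ H0) as [_ [l Hl]]. now apply Cder_cont in Hl. }
destruct (CF (/ 2) ltac:(lra)) as [d [Hd HF]]. rewrite F0 in HF.
set (rho := Rmin (/ 2) (d / 2)).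
assert (Hr : 0 < rho) by (apply Rmin_glb_lt; lra).
assert (Hr1 : rho <= / 2) by apply Rmin_l. assert (Hr2 : rho <= d / 2) by apply Rmin_r.
assert (BF : forall z, Cmod z <= rho -> Cmod (1 - F z) <= / 2).
{ intros z Hz. rewrite Cmod_sub_sym. left. apply HF. replace (z - 0)%C with z by ring. lra. }
assert (L : forall z1 z2, Cmod z1 <= rho -> Cmod z2 <= rho ->
  Cmod ((z1 - f z1) - (z2 - f z2)) <= / 2 * Cmod (z1 - z2)).
{ intros z1 z2. apply (segment_mean_value (fun z => z - f z)%C (fun z => 1 - F z)%C); auto.
  intros z Hz. apply Cder_minus; [apply Cder_id | apply Hf; lra]. }
assert (cf : forall z, Cmod z <= rho -> cont f z).
{ intros z Hz. apply Cder_cont with (F z). apply Hf. lra. }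
assert (EX := local_inverse f rho Hr f0 cf L).
set (g := fun w => epsilon (inhabits (RtoC 0)) (fun z => Cmod z <= rho /\ f z = w)).
assert (Hg : forall w, Cmod w < rho / 2 -> Cmod (g w) <= rho /\ f (g w) = w).
{ intros w Hw. unfold g. apply epsilon_spec. now apply EX. }
(* As g w - w is 1/2-Lipschitz in g w, the inverse is 2-Lipschitz; this supplies the continuity that
   [Cder_inverse] asks for. *)
assert (Lg : forall w1 w2, Cmod w1 < rho / 2 -> Cmod w2 < rho / 2 ->
  Cmod (g w1 - g w2) <= 2 * Cmod (w1 - w2)).
{ intros w1 w2 H1 H2. destruct (Hg w1 H1) as [A1 B1], (Hg w2 H2) as [A2 B2].
  assert (Q := L _ _ A1 A2). rewrite B1, B2 in Q.
  assert (T := Cmod_tri_inv (g w1 - g w2) (w1 - w2)).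
  replace (g w1 - g w2 - (w1 - w2))%C with (g w1 - w1 - (g w2 - w2))%C in T by ring. lra. }
assert (Hr0 : Cmod 0 < rho / 2) by (rewrite Cmod_0; lra).
assert (cg : forall w, Cmod w < rho / 2 -> cont g w).
{ intros w Hw eps He.
  assert (N := Cdisc_near _ _ Hw).
  assert (N2 : near w (fun y => Cmod (y - w) < eps / 2)) by (exists (eps / 2); split; [lra | auto]).
  generalize (filter_and _ _ N N2). apply filter_imp. intros y [Y1 Y2].
  eapply Rle_lt_trans; [apply Lg; auto | lra]. }
assert (Fn : forall z, Cmod z <= rho -> F z <> 0%C).
{ intros z Hz E. assert (Q := BF z Hz). rewrite E in Q. replace (1 - 0)%C with (RtoC 1) in Q by ring.
  rewrite Cmod_1 in Q. lra. }
assert (Dg : forall w, Cmod w < rho / 2 -> Cder g w (/ F (g w))%C).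
{ intros w Hw. apply (Cder_inverse f g); auto.
  - generalize (Cdisc_near _ _ Hw). apply filter_imp. intros y Hy. now apply Hg.
  - apply Hf. generalize (proj1 (Hg w Hw)). lra.
  - apply Fn. now apply Hg. }
assert (hg : hol (Cdisc (rho / 2)) g).
{ exists (fun w => / F (g w))%C. intros w Hw. split; [now apply Dg |].
  destruct (Hg w Hw) as [A B].
  destruct (proj2 (Hf (g w) ltac:(lra))) as [l Hl].
  eexists. apply (Cder_comp (fun w => F (g w)) Cinv); [| apply Cder_inv; auto].
  apply (Cder_comp g F); eauto. }
destruct (hol_pseries g (rho / 2) ltac:(lra) hg) as [b [Hb _]].
assert (hf : hol (Cdisc 1) f) by (exists F; intros z Hz; now apply Hf).
destruct (hol_pseries f 1 Rlt_0_1 hf) as [a [Ha _]].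
assert (g0 : g 0%C = 0%C).
{ apply Cmod_eq_0. apply Rle_antisym; [| apply Cmod_ge_0].
  destruct (Hg _ Hr0) as [A B]. assert (Q := L _ 0%C A ltac:(rewrite Cmod_0; lra)).
  rewrite B, f0 in Q. replace (g 0 - 0 - (0 - 0))%C with (g 0) in Q by ring.
  replace (g 0 - 0)%C with (g 0) in Q by ring. generalize (Cmod_ge_0 (g 0)). lra. }
assert (b0 : b 0%nat = 0%C).
{ rewrite <- g0. apply (ser_unique _ _ _ (ser_at_0 b) (Hb _ Hr0)). }
destruct (pseries_div b g _ Hb b0) as [G HG].
assert (Jb := jet_series b g (rho / 2) ltac:(lra) Hb). rewrite b0 in Jb.
assert (Ja := jet_series a f 1 Rlt_0_1 Ha).
assert (a1 : a 1%nat = 1%C).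
{ destruct (pseries_Cder a f 1 Ha) as [f' H']. destruct (H' _ H0) as [D1 D2].
  rewrite (Cder_unique _ _ _ _ D1 (proj1 (Hf _ H0))), F0 in D2.
  assert (Q := ser_unique _ _ _ (ser_at_0 (fun n => INR (S n) * a (S n))%C) D2). simpl in Q.
  rewrite <- Q. ring. }
assert (b1 : b 1%nat = 1%C).
{ assert (J := jet_comp _ _ _ _ _ _ _ _ _ Ja Jb).
  apply (jet_ext _ (fun w => w)) in J.
  - destruct (jet_unique _ _ _ _ _ _ _ _ _ J jet_id) as [_ [Q _]]. rewrite a1 in Q. rewrite <- Q. ring.
  - generalize (Cdisc_near _ _ Hr0). apply filter_imp. intros w Hw. now apply Hg. }
assert (hG : hol (Cdisc (rho / 2)) G).
{ apply (pseries_hol (fun n => b (S n))). intros z Hz. now apply HG. }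
assert (G0 : G 0%C = 1%C).
{ rewrite <- b1. apply (ser_unique _ _ _ (proj1 (HG _ Hr0)) (ser_at_0 (fun n => b (S n)))). }
(* The disc is shrunk until |G - 1| < 1, which puts [G] in the right half-plane, where [Clog] is
   holomorphic. *)
destruct (hol_cont _ _ 0%C hG Hr0 1 Rlt_0_1) as [e [He NG]]. rewrite G0 in NG.
set (r := Rmin (rho / 2) e).
assert (r0 : 0 < r) by (apply Rmin_glb_lt; lra).
assert (r1 : r <= rho / 2) by apply Rmin_l. assert (r2 : r <= e) by apply Rmin_r.
assert (RG : forall w, Cdisc r w -> right_half (G w)).
{ intros w Hw. unfold Cdisc in Hw. assert (Q := NG w ltac:(replace (w - 0)%C with w by ring; lra)).
  assert (T := re_le_Cmod (G w - 1)).
  replace (Re (G w - 1)) with (Re (G w) - 1) in T by (destruct (G w); simpl; ring).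
  apply Rabs_le_between in T. unfold right_half. lra. }
assert (hH : hol (Cdisc r) (fun w => Clog (G w))).
{ apply (hol_comp _ right_half G Clog); [| apply hol_Clog | exact RG].
  apply (hol_sub (Cdisc (rho / 2))); [| exact hG]. unfold Cdisc. intros; lra. }
destruct (hol_pseries _ r r0 hH) as [eta [Heta _]].
exists (fun n => eta n / 2)%C. split.
- replace (eta 0%nat) with (RtoC 0); [unfold Cdiv; ring |].
  assert (S0 := Heta 0%C ltac:(rewrite Cmod_0; lra)). cbv beta in S0. rewrite G0, Clog_1 in S0.
  apply (ser_unique _ _ _ S0 (ser_at_0 eta)).
- exists g, r. split; [auto | split].
  + intros w Hw. destruct (Hg w ltac:(lra)) as [A B]. split; auto. unfold Omega. lra.
  + intros w Hw. apply is_pseries_ser.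
    assert (w0 : w <> 0%C) by (apply Cmod_gt_0; lra).
    destruct (HG w ltac:(lra)) as [_ E].
    replace (g w / w)%C with (G w) by (rewrite E; field; auto).
    generalize (Heta w (proj2 Hw)). apply ser_ext. intros n. field.
Qed.

(** Along the segment from z2 to z1, with v = z1 - z2, the function Re (conj v f) has derivative
    |v|^2 Re F > 0, so the values of [f] at the two ends differ. *)
Lemma noshiro_warschawski (f F : C -> C) :
  (forall z, Cmod z < 1 -> Cder f z (F z)) -> (forall z, Cmod z < 1 -> 0 < Re (F z)) ->
  univalent_on_Omega f.
Proof.
intros Hf HR z1 z2 H1 H2 E. unfold Omega in *.
destruct (Ceq_dec (z1 - z2) 0) as [Z | Z]; [now apply Csub_0 |]. exfalso.
set (v := (z1 - z2)%C) in *.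
assert (B : forall t : R, 0 <= t <= 1 -> Cmod (z2 + t * v) < 1).
{ intros t Ht. unfold v. replace (z2 + t * (z1 - z2))%C with (RtoC (1 - t) * z2 + t * z1)%C
    by (rewrite RtoC_minus; ring).
  eapply Rle_lt_trans; [apply Cmod_triangle |]. rewrite !Cmod_mult, !Cmod_R, !Rabs_pos_eq by lra.
  assert (A1 := Cmod_ge_0 z1). assert (A2 := Cmod_ge_0 z2). destruct (Req_dec t 0); nra. }
assert (K : forall t : R, 0 <= t <= 1 ->
  is_derive (fun t : R => Re (Cconj v * f (z2 + t * v))%C) t (Re (F (z2 + t * v)%C) * Cmod v ^ 2)).
{ intros t Ht.
  assert (Q : Cder (fun u => Cconj v * f (z2 + u * v))%C (RtoC t) (RtoC (Cmod v ^ 2) * F (z2 + t * v))%C).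
  { eapply Cder_eq.
    - apply (Cder_mult (fun _ => Cconj v) (fun u => f (z2 + u * v)%C)); [apply Cder_const |].
      apply (Cder_comp (fun u => z2 + u * v)%C f); [| apply Hf; auto].
      apply (Cder_plus (fun _ => z2)); [apply Cder_const |].
      apply (Cder_mult (fun u => u) (fun _ => v)); [apply Cder_id | apply Cder_const].
    - cbv beta. rewrite Cmod2_conj. ring. }
  apply Cder_real in Q. destruct Q as [Q _]. revert Q.
  replace (Re (RtoC (Cmod v ^ 2) * F (z2 + t * v))%C) with (Re (F (z2 + t * v)%C) * Cmod v ^ 2); auto.
  set (c := Cmod v ^ 2). destruct (F (z2 + t * v)%C). simpl. ring. }
destruct (MVT_gen (fun t : R => Re (Cconj v * f (z2 + t * v))%C) 0 1
  (fun t : R => Re (F (z2 + t * v)%C) * Cmod v ^ 2)) as [c [Hc Q]].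
- rewrite Rmin_left, Rmax_right by lra. intros x Hx. apply K; lra.
- rewrite Rmin_left, Rmax_right by lra. intros x Hx. apply continuity_pt_filterlim.
  apply (ex_derive_continuous (fun t : R => Re (Cconj v * f (z2 + t * v))%C)). eexists. now apply K.
- rewrite Rmin_left, Rmax_right in Hc by lra.
  replace (z2 + 1 * v)%C with z1 in Q by (unfold v; ring).
  replace (z2 + 0 * v)%C with z2 in Q by ring. rewrite E in Q.
  assert (P := HR _ (B c Hc)). assert (V : 0 < Cmod v) by (apply Cmod_gt_0; exact Z).
  assert (0 < Re (F (z2 + c * v)%C) * Cmod v ^ 2); [| lra].
  apply Rmult_lt_0_compat; auto. apply pow_lt; auto.
Qed.

(** [A] extends arcsin z / z over the origin. From |arcsin z| <= 2 |z| comes |A| <= 2 and, along the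
    segment from 0, |L| <= 2, which later keeps the argument of the extremal derivative below pi /
    2. *)
Lemma arcsin_log_primitive : exists A L : C -> C,
  (forall z, Cmod z < 1 -> Carcsin z = (z * A z)%C /\ Cder L z (A z) /\ Cmod (L z) <= 2) /\
  hol (Cdisc 1) A /\ L 0%C = 0%C.
Proof.
destruct (hol_pseries _ 1 Rlt_0_1 hol_Carcsin) as [a [Ha _]].
assert (H0 : Cmod 0 < 1) by (rewrite Cmod_0; lra).
assert (a0 : a 0%nat = 0%C).
{ rewrite <- Carcsin_0. apply (ser_unique _ _ _ (ser_at_0 a) (Ha _ H0)). }
destruct (pseries_div a _ 1 Ha a0) as [A HA].
destruct (pseries_prim (fun n => a (S n)) A 1 (fun z Hz => proj1 (HA z Hz))) as [b [L [b0 [_ HL]]]].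
assert (L0 : L 0%C = 0%C).
{ transitivity (b 0%nat); [| exact b0]. apply (ser_unique _ _ _ (proj1 (HL _ H0)) (ser_at_0 b)). }
(* The derivative of arcsin at 0 is read off from sin (arcsin z) = z. *)
assert (a1 : a 1%nat = 1%C).
{ assert (J := jet_series a _ 1 Rlt_0_1 Ha). rewrite a0 in J.
  assert (J2 := jet_comp _ _ _ _ _ _ _ _ _ jet_csin J).
  apply (jet_ext _ (fun z => z)) in J2.
  - destruct (jet_unique _ _ _ _ _ _ _ _ _ J2 jet_id) as [_ [Q _]]. rewrite <- Q. ring.
  - apply filter_forall. intros z. apply csin_Carcsin. }
assert (A0 : A 0%C = 1%C).
{ rewrite <- a1. apply (ser_unique _ _ _ (proj1 (HA _ H0)) (ser_at_0 (fun n => a (S n)))). }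
assert (BA : forall z, Cmod z < 1 -> Cmod (A z) <= 2).
{ intros z Hz. destruct (Ceq_dec z 0) as [-> | n].
  - rewrite A0, Cmod_1. lra.
  - assert (P : 0 < Cmod z) by (apply Cmod_gt_0; exact n).
    assert (Q := Carcsin_le z Hz). rewrite (proj2 (HA z Hz)), Cmod_mult in Q.
    apply Rmult_le_reg_l with (Cmod z); lra. }
exists A, L. split; [| split; auto].
- intros z Hz. split; [now apply HA | split; [now apply HL |]].
  assert (Q := segment_mean_value L A (Cmod z) 2 z 0%C
    (fun y Hy => proj2 (HL y (Rle_lt_trans _ _ _ Hy Hz)))
    (fun y Hy => BA y (Rle_lt_trans _ _ _ Hy Hz)) ltac:(lra) ltac:(rewrite Cmod_0; apply Cmod_ge_0)).
  rewrite L0 in Q. replace (L z - 0)%C with (L z) in Q by ring.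
  replace (z - 0)%C with z in Q by ring. lra.
- apply (pseries_hol (fun n => a (S n))). intros z Hz. now apply HA.
Qed.

Lemma Cmod_pow_lt_1 z n : Cmod z < 1 -> Cmod (z ^ S n) < 1.
Proof.
intros Hz. rewrite Cmod_pow. assert (Z0 := Cmod_ge_0 z).
assert (Cmod z ^ n <= 1) by (rewrite <- (pow1 n); apply pow_incr; lra). simpl. nra.
Qed.

(* The function with [f' = exp ((k/n) L(z^n))], where [k = 2/pi], so that [z f''/f' = k arcsin (z^n)]. *)
Lemma extremal_function n : exists f Gamma,
  C_arcsin f /\ inv_log_coeffs f Gamma /\
  (forall z, Omega z -> (1 + z * C_derive (C_derive f) z / C_derive f z)%C =
     (1 + RtoC (2 / PI) * Carcsin (z ^ S n))%C).
Proof.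
destruct arcsin_log_primitive as [A [L [HL [hA L0]]]].
assert (H0 : Cmod 0 < 1) by (rewrite Cmod_0; lra).
assert (P : 3 < PI) by (generalize PI2_3_2; unfold PI2 in *; lra).
(* The exponent is [S n], so that n = 0, 1, 2 stand for w = z, z^2, z^3. *)
set (k := 2 / PI). set (N := INR (S n)).
assert (N1 : 1 <= N) by (unfold N; rewrite S_INR; generalize (pos_INR n); lra).
assert (k0 : 0 < k) by (apply Rdiv_lt_0_compat; lra).
assert (k1 : k < 2 / 3) by (unfold k; apply Rmult_lt_compat_l; [lra | apply Rinv_lt_contravar; lra]).
set (F := fun z => Cexp (RtoC (k / N) * L (z ^ S n)%C)).
set (F' := fun z => (F z * (RtoC k * (A (z ^ S n) * z ^ n)))%C).
assert (DF : forall z, Cmod z < 1 -> Cder F z (F' z)).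
{ intros z Hz. unfold F. eapply Cder_eq.
  - apply (Cder_comp (fun z => RtoC (k / N) * L (z ^ S n))%C Cexp); [| apply Cder_Cexp].
    apply (Cder_mult (fun _ => RtoC (k / N)) (fun z => L (z ^ S n)%C)); [apply Cder_const |].
    apply (Cder_comp (fun z => z ^ S n)%C L); [apply Cder_pow |].
    apply HL. now apply Cmod_pow_lt_1.
  - unfold F', F. simpl pred. fold N. rewrite RtoC_div by lra.
    assert (RtoC N <> 0%C) by (apply RtoC_neq_0; lra). cbv beta. field. auto. }
assert (hL : hol (Cdisc 1) L).
{ destruct hA as [A' HA']. exists A. intros z Hz. split; [now apply HL |].
  eexists. apply HA'. exact Hz. }
assert (hF : hol (Cdisc 1) F).
{ apply (hol_comp _ (fun _ => True) (fun z => RtoC (k / N) * L (z ^ S n))%C Cexp); [| apply hol_Cexp | easy].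
  apply hol_mult; [apply hol_const |].
  apply (hol_comp _ (Cdisc 1) (fun z => z ^ S n)%C L); auto.
  - apply (hol_pow _ (fun z => z)), hol_id.
  - intros z Hz. now apply Cmod_pow_lt_1. }
assert (F0 : F 0%C = 1%C).
{ unfold F. replace (0 ^ S n)%C with (RtoC 0) by (simpl; ring). rewrite L0.
  replace (RtoC (k / N) * 0)%C with (RtoC 0) by ring. apply Cexp_0. }
assert (RF : forall z, Cmod z < 1 -> 0 < Re (F z)).
{ intros z Hz. unfold F. set (x := (RtoC (k / N) * L (z ^ S n))%C).
  (* |Im x| <= 2 k / N <= 2 k < 4/3 < pi/2, so exp x has positive real part. *)
  assert (B : Rabs (Im x) <= 4 / 3).
  { eapply Rle_trans; [apply im_le_Cmod |]. unfold x. rewrite Cmod_mult, Cmod_R.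
    assert (kN : 0 < k / N) by (apply Rdiv_lt_0_compat; lra).
    rewrite Rabs_pos_eq by lra.
    assert (kN2 : k / N <= k).
    { rewrite <- (Rmult_1_r k) at 2. apply Rmult_le_compat_l; [lra |].
      rewrite <- Rinv_1. apply Rinv_le_contravar; lra. }
    assert (Q := proj2 (proj2 (HL _ (Cmod_pow_lt_1 z n Hz)))).
    assert (Q0 := Cmod_ge_0 (L (z ^ S n)%C)). nra. }
  apply Rabs_le_between in B. change (0 < exp (Re x) * cos (Im x)). apply Rmult_lt_0_compat; [apply exp_pos |].
  apply cos_gt_0; lra. }
destruct (hol_pseries F 1 Rlt_0_1 hF) as [p [Hp _]].
destruct (pseries_prim p F 1 Hp) as [b [f [b0 [bS Hf]]]].
assert (Df : forall z, Cmod z < 1 -> Cder f z (F z)) by (intros z Hz; now apply Hf).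
assert (f0 : f 0%C = 0%C).
{ transitivity (b 0%nat); [| exact b0]. apply (ser_unique _ _ _ (proj1 (Hf _ H0)) (ser_at_0 b)). }
destruct (inv_log_coeffs_exist f F) as [Gamma HG]; auto.
{ intros z Hz. split; [auto | exists (F' z); auto]. }
exists f, Gamma.
assert (D1 : forall z, Cmod z < 1 -> C_derive f z = F z) by (intros; now apply C_derive_eq, Df).
assert (E : forall z, Omega z -> (1 + z * C_derive (C_derive f) z / C_derive f z)%C =
     (1 + RtoC (2 / PI) * Carcsin (z ^ S n))%C).
{ intros z Hz. unfold Omega in Hz. rewrite D1 by auto.
  replace (C_derive (C_derive f) z) with (F' z).
  - rewrite (proj1 (HL _ (Cmod_pow_lt_1 z n Hz))). fold k. unfold F'.
    assert (Fz : F z <> 0%C) by apply Cexp_neq_0. simpl. field. auto.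
  - symmetry. apply C_derive_eq. apply Cder_ext with F; [| auto].
    generalize (Cdisc_near 1 z Hz). apply filter_imp. intros y Hy. now rewrite D1. }
split; [| split; auto]. split; [split |].
- split.
  + intros z Hz. exists (F z). apply Cder_is_derive. now apply Df.
  + exists b. split; [auto | split].
    * assert (Q := bS 0%nat). simpl in Q. replace (b 1%nat) with (1 * b 1%nat)%C by ring. rewrite Q.
      rewrite <- F0. apply (ser_unique _ _ _ (ser_at_0 p) (Hp _ H0)).
    * intros z Hz. apply is_pseries_ser. now apply Hf.
- now apply (noshiro_warschawski f F).
- exists (fun z => z ^ S n)%C. split; [split; [| split] | exact E].
  + intros z Hz. eexists. apply Cder_is_derive. apply Cder_pow.
  + simpl. ring.
  + intros z Hz. left. now apply Cmod_pow_lt_1.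
Qed.

Lemma extremal_coefs n c1 c2 c3 : jet (fun z => z ^ S n)%C 0 c1 c2 c3 ->
  exists f Gamma, C_arcsin f /\ inv_log_coeffs f Gamma /\
    let k := 2 / PI in
    (Gamma 1%nat = - (RtoC (k / 4) * c1) /\
     Gamma 2%nat = - (RtoC (k / 12) * (c2 - RtoC (5 / 4 * k) * c1 ^ 2)) /\
     Gamma 3%nat = - (RtoC (k / 24) * (c3 - RtoC (5 / 2 * k) * c1 * c2
        + RtoC (1 / 6 + 3 / 2 * k ^ 2) * c1 ^ 3)))%C.
Proof.
intros J. destruct (extremal_function n) as [f [Gamma [Hf [HG E]]]].
exists f, Gamma. split; auto. split; auto.
destruct (Gamma_schwarz_coefs f (fun z => z ^ S n)%C Gamma (proj1 (proj1 Hf))) as [_ [d1 [d2 [d3 [J' Q]]]]]; auto.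
{ intros z Hz. left. now apply Cmod_pow_lt_1. }
destruct (jet_unique _ _ _ _ _ _ _ _ _ J J') as [_ [-> [-> ->]]]. exact Q.
Qed.

Theorem theorem3p3 :
  (forall (f : C -> C) (Gamma : nat -> C),
     C_arcsin f -> inv_log_coeffs f Gamma ->
     Cmod (Gamma 1%nat) <= 1 / (2 * PI) /\
     Cmod (Gamma 2%nat) <= 1 / (6 * PI) /\
     Cmod (Gamma 3%nat) <= 1 / (12 * PI)) /\
  (exists (f : C -> C) (Gamma : nat -> C),
     C_arcsin f /\ inv_log_coeffs f Gamma /\
     Cmod (Gamma 1%nat) = 1 / (2 * PI)) /\
  (exists (f : C -> C) (Gamma : nat -> C),
     C_arcsin f /\ inv_log_coeffs f Gamma /\
     Cmod (Gamma 2%nat) = 1 / (6 * PI)) /\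
  (exists (f : C -> C) (Gamma : nat -> C),
     C_arcsin f /\ inv_log_coeffs f Gamma /\
     Cmod (Gamma 3%nat) = 1 / (12 * PI)).
Proof.
assert (P := PI_RGT_0).
assert (J2 := jet_mult _ _ _ _ _ _ _ _ _ _ jet_id jet_id).
assert (J3 := jet_mult _ _ _ _ _ _ _ _ _ _ jet_id J2).
assert (N : forall x, 0 < x -> Cmod (- (RtoC x * 1)) = x).
{ intros x Hx. rewrite Cmod_opp, Cmod_mult, Cmod_R, Cmod_1, Rabs_pos_eq; lra. }
split; [exact upper_bounds | split; [| split]].
(* For w = z, z^2, z^3 in turn only c1, c2 or c3 is nonzero and equals 1, so the formula for Gamma
   of the same index reduces to -k/4, -k/12 or -k/24. *)
- destruct (extremal_coefs 0 1 0 0) as [f [Gamma [H1 [H2 [Q _]]]]].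
  + apply jet_ext with (2 := jet_id). apply filter_forall. intros; simpl; ring.
  + exists f, Gamma. split; [exact H1 | split; [exact H2 |]]. rewrite Q, N by (repeat apply Rdiv_lt_0_compat; lra). field. lra.
- destruct (extremal_coefs 1 0 1 0) as [f [Gamma [H1 [H2 [_ [Q _]]]]]].
  + apply jet_ext with (2 := jet_coef _ _ _ _ _ 0 0 1 0 J2 ltac:(ring) ltac:(ring) ltac:(ring) ltac:(ring)).
    apply filter_forall. intros; simpl; ring.
  + exists f, Gamma. split; [exact H1 | split; [exact H2 |]]. rewrite Q.
    replace (1 - RtoC (5 / 4 * (2 / PI)) * 0 ^ 2)%C with (RtoC 1) by (simpl; ring).
    rewrite N by (repeat apply Rdiv_lt_0_compat; lra). field. lra.
- destruct (extremal_coefs 2 0 0 1) as [f [Gamma [H1 [H2 [_ [_ Q]]]]]].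
  + apply jet_ext with (2 := jet_coef _ _ _ _ _ 0 0 0 1 J3 ltac:(ring) ltac:(ring) ltac:(ring) ltac:(ring)).
    apply filter_forall. intros; simpl; ring.
  + exists f, Gamma. split; [exact H1 | split; [exact H2 |]]. rewrite Q.
    replace (1 - RtoC (5 / 2 * (2 / PI)) * 0 * 0 + RtoC (1 / 6 + 3 / 2 * (2 / PI) ^ 2) * 0 ^ 3)%C
      with (RtoC 1) by (simpl; ring).
    rewrite N by (repeat apply Rdiv_lt_0_compat; lra). field. lra.
Qed.
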